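(* Let $\mathcal C$ be a cone structure on a manifold $M$ of dimension $n\ge2$. For any choice of a timelike 1-form $\Omega$ and an $\Omega$-unit timelike vector field $T$, there exists a unique (smooth) Finsler metric $F$ on the vector bundle $\ker\Omega\subset TM$ such that, for any $v_p\in TM\setminus\mathbf 0$, $$v_p\in\mathcal C\iff v_p=F(\pi(v_p))\,T_p+\pi(v_p),\qquad( * )$$ where $\pi:TM\to\ker\Omega$ is the projection determined by $v_p=\Omega(v_p)T_p+\pi(v_p)$. Conversely, for any cone triple $(\Omega,T,F)$ composed of a non-vanishing 1-form $\Omega$ on $M$, a vector field $T$ with $\Omega(T)\equiv1$ and a Finsler metric $F$ on $\ker\Omega$, there exists a unique cone structure $\mathcal C$ satisfying $( * )$.
   Context: ''Smooth'' means $C^\infty$. $\mathbf 0$ is the zero section of $TM$. Finsler metric on a vector bundle $E\to M$: a continuous function $F:E\to[0,\infty)$, positive and smooth away from the zero section, with $F(\lambda v)=\lambda F(v)$ for $\lambda>0$, such that $g_v(u,w)=\frac12\frac{\partial^2}{\partial r\partial s}F^2(v+ru+sw)|_{r=s=0}$ is positive definite for all $v\neq0$. Cone: let $V$ be a real vector space of dimension $n\ge2$. A (strong) cone in $V$ is a nonempty smooth hypersurface $\mathcal C_0$ embedded in $V\setminus\{0\}$ such that: (i) $v\in\mathcal C_0,\ \lambda>0\Rightarrow\lambda v\in\mathcal C_0$; (ii) $v\in\mathcal C_0\Rightarrow -v\notin\mathcal C_0$; (iii) $\mathcal C_0$ is the boundary in $V\setminus\{0\}$ of an open subset $A_0\subset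 V\setminus\{0\}$ (its interior) which is convex; (iv) the second fundamental form of $\mathcal C_0$ as an affine hypersurface of $V$, with respect to a transverse direction pointing into $A_0$ (sign such that boundaries of convex sets have positive semi-definite form), is positive semi-definite with radical at each $v\in\mathcal C_0$ spanned by $v$. Cone structure: an embedded hypersurface $\mathcal C$ of $TM$ such that for each $p\in M$, $\mathcal C_p:=\mathcal C\cap T_pM$ is a cone in $T_pM$, with interior $A_p$, and $T_v(T_pM)+T_v\mathcal C=T_v(TM)$ for $v\in\mathcal C_p$. Vectors in $A=\bigcup_pA_p$ are called timelike and vectors in $A\cup\mathcal C$ causal. A 1-form $\Omega$ is timelike if $\Omega(v)>0$ for every causal $v$. A vector field $T$ is $\Omega$-unit timelike if each $T_p$ is timelike and $\Omega(T)\equiv1$. *)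

(* Defs.v *)
From HB Require Import structures.
From mathcomp Require Import all_boot all_order all_algebra.
From mathcomp Require Import all_classical all_reals all_analysis.

Set Implicit Arguments.
Unset Strict Implicit.
Unset Printing Implicit Defensive.

Import Order.TTheory GRing.Theory Num.Theory.
Import numFieldNormedType.Exports.

Local Open Scope classical_set_scope.
Local Open Scope ring_scope.

(* The normed spaces V, W below are always finite dimensional (R, R^n,
   R^n x R^n), and U is always open: [Ck] and [smooth_on] are meant for that
   case only. *)

Fixpoint Ck (R : realType) (V W : normedModType R) (k : nat)
    (U : set V) (f : V -> W) : Prop :=
  if k is j.+1 then
    (forall x, U x -> differentiable f x) /\
    (forall v : V, Ck j U (fun x => 'D_v f x))
  else forall x, U x -> {for x, continuous f}.

Definition smooth_on (R : realType) (V W : normedModType R)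
    (U : set V) (f : V -> W) : Prop :=
  forall k, Ck k U f.

(* Smoothness of a function on an arbitrary subset D: it is locally the
   restriction of a smooth function on an open set of V.  On an embedded
   submanifold D this is smoothness for its induced structure. *)
Definition smooth_within (R : realType) (V W : normedModType R)
    (D : set V) (f : V -> W) : Prop :=
  forall x, D x -> exists (U : set V) (g : V -> W),
    [/\ open U, U x, smooth_on U g & forall y, U y -> D y -> f y = g y].

Definition diffeo_on (R : realType) (V : normedModType R)
    (U : set V) (f : V -> V) : Prop :=
  exists g : V -> V,
    [/\ smooth_on U f, open (f @` U), smooth_on (f @` U) g &
        forall x, U x -> g (f x) = x].

(* Around each of its points, S is carried onto a piece of a linear hyperplane
   by a local diffeomorphism of V (slice chart). *)
Definition embedded_hypersurface (R : realType) (V : normedModType R)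
    (S : set V) : Prop :=
  forall x, S x ->
  exists (U : set V) (f : V -> V) (l : {linear V -> R^o}),
    [/\ open U, U x, diffeo_on U f, exists v, l v != 0 &
        forall y, U y -> (S y <-> l (f y) = 0)].

(* T_x S, as the set of velocities at x of smooth curves in S *)
Definition tangent_to (R : realType) (V : normedModType R)
    (S : set V) (x : V) : set V :=
  [set w | exists (e : R) (c : R^o -> V),
    [/\ 0 < e, smooth_on [set t : R^o | `|t| < e] c, c 0 = x,
        forall t, `|t| < e -> S (c t) & w = 'D_(1 : R^o) c 0]].

Section Cones.
Variables (R : realType) (n : nat).
Notation V := 'rV[R]_n.

(* The affine second fundamental form h of S at x with respect to xi, i.e.
   D_X Y = (tangential part) + h(X, Y) xi, D being the flat connection of V and
   Y being extended to a vector field tangent to S near x.  With xi pointing to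
   the inside, boundaries of convex sets have h >= 0. *)
Definition second_fundamental_form (S : set V) (x xi X Y : V) : R :=
  xget 0 [set h : R | exists (U : set V) (Yf : V -> V),
    [/\ open U, U x, smooth_on U Yf,
        (forall y, U y -> S y -> tangent_to S y (Yf y)) /\ Yf x = Y &
        tangent_to S x ('D_X Yf x - h *: xi)]].

Definition is_cone_interior (C A : set V) : Prop :=
  [/\ open A, ~ A 0, convex_set A &
      C = (closure A `\` interior A) `\` [set 0]].

(* For a cone C there is only one such A. *)
Definition cone_interior (C : set V) : set V :=
  xget set0 [set A | is_cone_interior C A].

Definition transverse_inward (C : set V) (v xi : V) : Prop :=
  ~ tangent_to C v xi /\
  exists2 e : R, 0 < e &
    forall t, 0 < t -> t < e -> cone_interior C (v + t *: xi).

Record is_cone (C : set V) : Prop := IsCone {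
  cone_nonempty : C !=set0;
  cone_neq0 : forall v, C v -> v != 0;
  cone_hypersurface : embedded_hypersurface C;
  cone_scale : forall v (a : R), C v -> 0 < a -> C (a *: v);
  cone_salient : forall v, C v -> ~ C (- v);
  cone_boundary : exists A, is_cone_interior C A;
  cone_strong : forall v, C v -> exists2 xi, transverse_inward C v xi &
    (forall X, tangent_to C v X ->
       0 <= second_fundamental_form C v xi X X) /\
    (forall X, tangent_to C v X ->
       (forall Y, tangent_to C v Y -> second_fundamental_form C v xi X Y = 0)
       <-> (exists a : R, X = a *: v))
}.

End Cones.

(* Outside [chart_dom] (resp. its image) the maps [chart_map] and [chart_inv]
   take irrelevant values. *)
Record chart (R : realType) (n : nat) (M : topologicalType) := Chart {
  chart_dom : set M;
  chart_map :> M -> 'rV[R]_n;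
  chart_inv : 'rV[R]_n -> M;
  chart_dom_open : open chart_dom;
  chart_img_open : open (chart_map @` chart_dom);
  chart_mapK : forall p, chart_dom p -> chart_inv (chart_map p) = p;
  chart_continuous : forall p, chart_dom p -> {for p, continuous chart_map};
  chart_inv_continuous :
    forall x, (chart_map @` chart_dom) x -> {for x, continuous chart_inv}
}.

Definition transition (R : realType) (n : nat) (M : topologicalType)
    (phi psi : chart R n M) : 'rV[R]_n -> 'rV[R]_n :=
  psi \o chart_inv phi.

(* Smooth manifolds of dimension n.  [chart_at p] is a preferred chart around
   p; it is only used to name the elements of the tangent space at p. *)
Record manifold (R : realType) (n : nat) := Manifold {
  mfd_carrier :> topologicalType;
  mfd_hausdorff : hausdorff_space mfd_carrier;
  mfd_second_countable : @second_countable mfd_carrier;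
  atlas : set (chart R n mfd_carrier);
  chart_at : mfd_carrier -> chart R n mfd_carrier;
  chart_at_atlas : forall p, atlas (chart_at p);
  mem_chart_at : forall p, chart_dom (chart_at p) p;
  atlas_compatible : forall phi psi, atlas phi -> atlas psi ->
    smooth_on (phi @` (chart_dom phi `&` chart_dom psi)) (transition phi psi)
}.

(* A tangent vector at p is given by its components in the chart [chart_at p];
   this makes T_p M the vector space R^n.  The components of the same vector
   in another chart around p are given by [tcoord]. *)
Definition tangent_space (R : realType) (n : nat) (M : manifold R n) (p : M)
  := 'rV[R]_n.

Record tangent_bundle (R : realType) (n : nat) (M : manifold R n) := TVec {
  base : M;
  vec : tangent_space base
}.

Section TangentBundle.
Variables (R : realType) (n : nat) (M : manifold R n).
Notation TM := (tangent_bundle M).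
Notation V := 'rV[R]_n.

Definition tcoord (phi : chart R n M) (p : M) (v : V) : V :=
  'd (transition (chart_at p) phi) (chart_at p p) v.

Definition tvec (phi : chart R n M) (p : M) (w : V) : V :=
  'd (transition phi (chart_at p)) (phi p) w.

(* The charts (x, w) of TM induced by charts of M, and their inverses; they
   define the topology and the smooth structure of TM. *)
Definition tchart (phi : chart R n M) (v : TM) : V * V :=
  (phi (base v), tcoord phi (base v) (vec v)).

Definition tchart_inv (phi : chart R n M) (y : V * V) : TM :=
  TVec (tvec phi (chart_inv phi y.1) y.2 : tangent_space (chart_inv phi y.1)).

Definition timage (phi : chart R n M) (S : set TM) : set (V * V) :=
  tchart phi @` [set v | S v /\ chart_dom phi (base v)].

Definition fiber (S : set TM) (p : M) : set V :=
  [set v | S (TVec (v : tangent_space p))].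

(* Smoothness is expressed through the components in charts. *)
Record one_form := OneForm {
  form_map :> forall p : M, {linear 'rV[R]_n -> R^o};
  form_smooth : forall phi, atlas phi -> forall w : V,
    smooth_on (phi @` chart_dom phi)
      (fun x => form_map (chart_inv phi x) (tvec phi (chart_inv phi x) w))
}.

Record vector_field := VectorField {
  field_map :> forall p : M, tangent_space p;
  field_smooth : forall phi, atlas phi ->
    smooth_on (phi @` chart_dom phi)
      (fun x => tcoord phi (chart_inv phi x) (field_map (chart_inv phi x)))
}.

Record is_cone_structure (C : set TM) : Prop := IsConeStructure {
  cstr_hypersurface :
    forall phi, atlas phi -> embedded_hypersurface (timage phi C);
  cstr_cone : forall p, is_cone (fiber C p);
  (* T_v(T_p M) + T_v C = T_v(TM), read in the charts of TM *)
  cstr_transverse : forall phi v, atlas phi -> C v -> chart_dom phi (base v) ->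
    forall w : V * V, exists a b : V * V,
      [/\ tangent_to (timage phi [set u | base u = base v]) (tchart phi v) a,
          tangent_to (timage phi C) (tchart phi v) b & w = a + b]
}.

Definition timelike (C : set TM) : set TM :=
  [set v | cone_interior (fiber C (base v)) (vec v)].

Definition causal (C : set TM) : set TM := timelike C `|` C.

Definition timelike_form (C : set TM) (Om : one_form) : Prop :=
  forall v, causal C v -> 0 < Om (base v) (vec v).

Definition unit_timelike_field (C : set TM) (Om : one_form)
    (T : vector_field) : Prop :=
  (forall p, timelike C (TVec (T p))) /\ (forall p, Om p (T p) = 1).

Definition nonvanishing (Om : one_form) : Prop :=
  forall p, exists v : tangent_space p, Om p v != 0.

Definition ker (Om : one_form) : set TM := [set v | Om (base v) (vec v) = 0].

Definition proj_ker (Om : one_form) (T : vector_field) (v : TM) : TM :=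
  TVec (vec v - Om (base v) (vec v) *: T (base v) : tangent_space (base v)).

(* g_v(u, w) *)
Definition fundamental_tensor (F : TM -> R) (p : M) (v u w : V) : R :=
  2^-1 * derive1 (fun r : R =>
    derive1 (fun s : R =>
      F (TVec (v + r *: u + s *: w : tangent_space p)) ^+ 2) 0) 0.

(* Finsler metrics on a smooth vector subbundle E of TM.  Only the values of F
   on E matter. *)
Record is_finsler (E : set TM) (F : TM -> R) : Prop := IsFinsler {
  finsler_ge0 : forall v, E v -> 0 <= F v;
  finsler_continuous : forall phi, atlas phi ->
    {within timage phi E, continuous (F \o tchart_inv phi)};
  finsler_gt0 : forall v, E v -> vec v != 0 -> 0 < F v;
  finsler_smooth : forall phi, atlas phi ->
    smooth_within (timage phi [set v | E v /\ vec v != 0])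
      (F \o tchart_inv phi : V * V -> R^o);
  finsler_homogeneous : forall p (v : tangent_space p) (a : R),
    E (TVec v) -> 0 < a ->
    F (TVec (a *: v : tangent_space p)) = a * F (TVec v);
  finsler_posdef : forall p (v u : tangent_space p),
    E (TVec v) -> E (TVec u) -> v != 0 -> u != 0 ->
    0 < fundamental_tensor F p v u u
}.

(* v in C <-> v = F(pi(v)) T + pi(v), for all v in TM minus the zero section *)
Definition cone_triple_eq (C : set TM) (Om : one_form) (T : vector_field)
    (F : TM -> R) : Prop :=
  forall v : TM, vec v != 0 ->
    (C v <-> vec v = F (proj_ker Om T v) *: T (base v) + vec (proj_ker Om T v)).

End TangentBundle.

(* Main.v *)
Require Import Defs.
From HB Require Import structures.
From mathcomp Require Import all_boot all_order all_algebra.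
From mathcomp Require Import all_classical all_reals all_analysis.
From mathcomp Require Import ring lra.

(** In the fibre over p, the interior A_p of the cone is an open convex cone
    containing T_p, and Omega > 0 on it.  Hence every line u + R T_p with u <> 0
    in ker Omega meets C_p in exactly one point u + F(u) T_p, which defines F,
    and C_p is the graph {Omega = F o pi}.  As T_p lies in A_p it is not tangent
    to C_p, so, by the transversality of the cone structure, the implicit
    function theorem applied to a slice chart of C makes F smooth away from the
    zero section.  Continuity at the zero section follows from subadditivity and
    homogeneity, which bound F by a multiple of the norm, locally uniformly.

    For a graph {Omega = F o pi}, the second fundamental form at v is a positive
    multiple of the Hessian Q of F o pi at v.  Since g(u, u) = F Q(u, u) + dF(u)^2
    and Q has v and T in its kernel, g is positive definite if and only if Q is
    positive semidefinite on the tangent space with radical spanned by v.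
    Conversely, positive definiteness of g makes F o pi convex, so that
    {Omega > F o pi} is a convex interior for the graph of F. *)

Set Implicit Arguments.
Unset Strict Implicit.
Unset Printing Implicit Defensive.

Import Order.TTheory GRing.Theory Num.Theory.
Import numFieldNormedType.Exports.

Local Open Scope classical_set_scope.
Local Open Scope ring_scope.

(* Otherwise unification unfolds iterated derivatives into limits. *)
Local Opaque derive.

(** * Smooth maps between finite-dimensional spaces *)

Section Differentiability.
Variables (R : realType) (V W : normedModType R).
Implicit Types (f g : V -> W) (x v : V).

(** Tangent spaces are sets of velocities of curves, and the second fundamental form is chosen among
    values given by arbitrary extensions, so neither can be computed directly. Both are computed
    once for a regular level set of a function $\Phi$: the tangent space is the kernel of $d\Phi$
    and the form is $-D_XD_Y\Phi/D_\xi\Phi$. With $\Phi=\Omega-F\circ\pi$ the strong cone condition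
    becomes a statement on a Hessian. Using $F\circ\pi$ on the whole fibre, instead of $F$ on a
    hyperplane, keeps the calculus on open sets of a vector space. The price is the axis $\mathbb
    RT_p$, where $F\circ\pi$ is not smooth and which needs separate arguments. A slice chart gives
    some defining function of the cone structure, and a vector that is not tangent to the fibre of
    the cone could still be killed by its differential. Transversality excludes this: it makes the
    restriction to the fibre regular. The interior of a cone is a choice too, so for a given graph
    it has to be shown that no other set qualifies. *)

Lemma differentiable_epsP f x (L : {linear V -> W}) : continuous L ->
  (forall e : R, 0 < e ->
     \forall h \near (0 : V), `|f (h + x) - f x - L h| <= e * `|h|) ->
  differentiable f x /\ 'd f x = L :> (V -> W).
Proof.
move=> Lc fL.
have E : f \o shift x = cst (f x) + L +o_ (0 : V) id.
  apply/eqaddoP => e e0; near=> h => /=.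
  rewrite !fctE /= opprD addrA.
  by near: h; exact: fL.
have dE := diff_unique Lc E.
by split=> //; apply/diff_locallyP; rewrite dE.
Unshelve. all: by end_near. Qed.

Lemma differentiable_eps f x (e : R) : differentiable f x -> 0 < e ->
  \forall h \near (0 : V), `|f (h + x) - f x - 'd f x h| <= e * `|h|.
Proof.
move=> /diff_locallyP[_ /eqaddoP fx] e0.
have := fx e e0; apply: filterS => h /=.
by rewrite !fctE /= opprD addrA.
Qed.

Lemma near_eq_differentiable f g x : (\forall y \near x, f y = g y) ->
  differentiable f x -> differentiable g x.
Proof.
move=> fg df; apply: (proj1 (@differentiable_epsP g x ('d f x) _ _)).
  exact: diff_continuous.
move=> e e0; have fgx : f x = g x by exact: nbhs_singleton fg.
have fg0 : \forall h \near (0 : V), f (h + x) = g (h + x).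
  move: fg; rewrite (near_shift 0); apply: filterS => h /=.
  by rewrite subr0.
near=> h; rewrite -fgx -(_ : f (h + x) = g (h + x)); last by near: h.
by near: h; exact: differentiable_eps.
Unshelve. all: by end_near. Qed.

Lemma deriveDv f x v w : differentiable f x ->
  'D_(v + w) f x = 'D_v f x + 'D_w f x.
Proof. by move=> df; rewrite !deriveE // linearD. Qed.

Lemma deriveZv f x v (a : R) : differentiable f x ->
  'D_(a *: v) f x = a *: 'D_v f x.
Proof. by move=> df; rewrite !deriveE // linearZ. Qed.

Lemma deriveNv f x v : differentiable f x -> 'D_(- v) f x = - 'D_v f x.
Proof. by move=> df; rewrite !deriveE // linearN. Qed.

Lemma derive_sumv f x (s : nat) (c : 'I_s -> R) (e : 'I_s -> V) :
  differentiable f x ->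
  'D_(\sum_i c i *: e i) f x = \sum_i c i *: 'D_(e i) f x.
Proof.
move=> df; rewrite deriveE // linear_sum; apply: eq_bigr => i _.
by rewrite linearZ deriveE.
Qed.

End Differentiability.

Lemma derive_comp (R : realType) (U V W : normedModType R) (g : U -> V)
    (f : V -> W) (x v : U) : differentiable g x -> differentiable f (g x) ->
  'D_v (f \o g) x = 'D_('D_v g x) f (g x).
Proof.
move=> dg df; have dfg := differentiable_comp dg df.
by rewrite (deriveE v dfg) (deriveE v dg) (deriveE _ df) diff_comp.
Qed.

Lemma derive_linear (R : realType) (V W : normedModType R)
    (l : {linear V -> W}) (x v : V) : continuous l -> 'D_v l x = l v.
Proof.
move=> lc; rewrite deriveE; first by rewrite diff_lin.
exact: linear_differentiable.
Qed.

Section Ck.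
Variable R : realType.
Implicit Types V W : normedModType R.

Lemma Ck_near_eq V W k (U : set V) (f g : V -> W) :
  (forall x, U x -> \forall y \near x, f y = g y) -> Ck k U f -> Ck k U g.
Proof.
elim: k f g => [|k IH] f g fg /=.
  move=> fc x Ux; have := fc x Ux.
  have fgx := fg x Ux; rewrite /prop_for /continuous_at.
  rewrite -(nbhs_singleton fgx) => fcx.
  apply: cvg_trans fcx; apply: near_eq_cvg.
  by apply: filterS fgx => y ->.
move=> [df Df]; split.
  by move=> x Ux; apply: near_eq_differentiable (df x Ux); exact: fg.
move=> v; apply: IH (Df v) => x Ux.
have /nbhs_interior := fg x Ux.
by apply: filterS => y; apply: near_eq_derive.
Qed.

Lemma Ck_eq V W k (U : set V) (f g : V -> W) : open U ->
  (forall x, U x -> f x = g x) -> Ck k U f -> Ck k U g.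
Proof.
move=> oU fg; apply: Ck_near_eq => x Ux.
by near=> y; apply: fg; near: y; exact: open_nbhs_nbhs.
Unshelve. all: by end_near. Qed.

Lemma Ck_sub V W k (U U' : set V) (f : V -> W) :
  U `<=` U' -> Ck k U' f -> Ck k U f.
Proof.
move=> UU'; elim: k f => [|k IH] f /=; first by move=> h x /UU'; exact: h.
by move=> [df Df]; split=> [x /UU'|v]; [exact: df|exact: IH].
Qed.

(** Continuity and derivatives at [x] only see [f] near [x], whatever the set, so [U'] may vary with
    the point and need be neither open nor contained in [U]. *)
Lemma Ck_pointwise V W k (U : set V) (f : V -> W) :
  (forall x, U x -> exists2 U', U' x & Ck k U' f) -> Ck k U f.
Proof.
elim: k f => [|k IH] f /=.
  by move=> h x /h[U' U'x]; exact.
move=> h; split=> [x /h[U' U'x [df _]]|v]; first exact: df.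
by apply: IH => x /h[U' U'x [_ Df]]; exists U'.
Qed.

Lemma Ck_pred V W k (U : set V) (f : V -> W) : Ck k.+1 U f -> Ck k U f.
Proof.
elim: k f => [|k IH] f /=.
  by move=> [df _] x Ux; apply: differentiable_continuous; exact: df.
by move=> [df Df]; split=> // v; apply: IH; exact: Df.
Qed.

Lemma Ck_continuous V W k (U : set V) (f : V -> W) x :
  Ck k U f -> U x -> {for x, continuous f}.
Proof. by elim: k f => [|k IH] f; [exact|move=> /Ck_pred; exact: IH]. Qed.

Lemma Ck_cst V W k (U : set V) (c : W) : Ck k U (fun=> c).
Proof.
elim: k c => [|k IH] c /=; first by move=> x _; exact: cst_continuous.
split=> [x _|v]; first exact: differentiable_cst.
have -> // : 'D_v (fun _ : V => c) = fun=> 0.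
by apply/funext => x; exact: derive_cst.
Qed.

Lemma Ck_linear V W k (U : set V) (l : {linear V -> W}) : continuous l ->
  Ck k U l.
Proof.
move=> lc; case: k => [|k] /=; first by move=> x _; exact: lc.
split=> [x _|v]; first exact: linear_differentiable.
have -> : 'D_v l = fun=> l v; last exact: Ck_cst.
by apply/funext => x; exact: derive_linear.
Qed.

Lemma Ck_add V W k (U : set V) (f g : V -> W) : open U ->
  Ck k U f -> Ck k U g -> Ck k U (fun x => f x + g x).
Proof.
move=> oU; elim: k f g => [|k IH] f g /=.
  by move=> fc gc x Ux; apply: cvgD; [exact: fc|exact: gc].
move=> [df Df] [dg Dg]; split=> [x Ux|v].
  by apply: differentiableD; [exact: df|exact: dg].
apply: Ck_eq (IH _ _ (Df v) (Dg v)) => // x Ux.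
by rewrite -deriveD //; apply: diff_derivable; [exact: df|exact: dg].
Qed.

Lemma Ck_linear_comp V W (X : normedModType R) k (U : set V) (f : V -> W)
    (l : {linear W -> X}) : open U -> continuous l ->
  Ck k U f -> Ck k U (l \o f).
Proof.
move=> oU lc; elim: k f => [|k IH] f /=.
  move=> fc x Ux; apply: continuous_comp; [exact: fc|exact: lc].
move=> [df Df]; split=> [x Ux|v].
  apply: differentiable_comp; first exact: df.
  exact: linear_differentiable.
apply: Ck_eq (IH _ (Df v)) => // x Ux /=.
rewrite derive_comp ?derive_linear //; first exact: df.
exact: linear_differentiable.
Qed.

Lemma Ck_opp V W k (U : set V) (f : V -> W) : open U ->
  Ck k U f -> Ck k U (fun x => - f x).
Proof.
move=> oU; elim: k f => [|k IH] f /=.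
  by move=> fc x Ux; apply: cvgN; exact: fc.
move=> [df Df]; split=> [x Ux|v]; first by apply: differentiableN; exact: df.
apply: Ck_eq (IH _ (Df v)) => // x Ux.
by rewrite -deriveN //; apply: diff_derivable; exact: df.
Qed.

Lemma Ck_sum V W k (U : set V) (s : nat) (f : 'I_s -> V -> W) : open U ->
  (forall i, Ck k U (f i)) -> Ck k U (fun x => \sum_i f i x).
Proof.
move=> oU; elim: s f => [|s IH] f fk.
  by apply: Ck_eq (@Ck_cst V W k U 0) => // x _; rewrite big_ord0.
apply: (Ck_eq oU (f := fun x => f ord0 x + \sum_i f (lift ord0 i) x)).
  by move=> x _; rewrite big_ord_recl.
by apply: Ck_add => //; exact: IH.
Qed.

Lemma Ck_pair V W (X : normedModType R) k (U : set V) (f : V -> W)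
    (g : V -> X) : open U -> Ck k U f -> Ck k U g ->
  Ck k U (fun x => (f x, g x)).
Proof.
move=> oU; elim: k f g => [|k IH] f g /=.
  by move=> fc gc x Ux; apply: cvg_pair; [exact: fc|exact: gc].
move=> [df Df] [dg Dg]; split=> [x Ux|v].
  by apply: differentiable_pair; [exact: df|exact: dg].
apply: Ck_eq (IH _ _ (Df v) (Dg v)) => // x Ux.
have dfx := df x Ux; have dgx := dg x Ux.
rewrite [RHS]deriveE; last exact: differentiable_pair.
by rewrite diff_pair // !deriveE.
Qed.

End Ck.

(** * Finite-dimensional spaces; products, inverses and composites of $C^k$ maps *)

Section FiniteDimension.
Variable R : realType.
Implicit Types V W : normedModType R.

Definition findim V := exists (s : nat) (e : 'I_s -> V)
    (l : 'I_s -> {linear V -> R^o}),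
  (forall i, continuous (l i)) /\ forall v, v = \sum_i l i v *: e i.

Lemma findim_real : findim R^o.
Proof.
exists 1%N, (fun=> 1), (fun=> idfun).
split=> [i x|v]; first exact: cvg_id.
by rewrite big_ord1 /= [RHS]mulr1.
Qed.

Lemma findim_row (n : nat) : findim 'rV[R]_n.
Proof.
pose l (i : 'I_n) (v : 'rV[R]_n) : R^o := v 0 i.
have ll i : linear (l i) by move=> a u v; rewrite /l !mxE.
pose L i : {linear 'rV[R]_n -> R^o} :=
  HB.pack (l i) (GRing.isLinear.Build _ _ _ _ (l i) (ll i)).
exists n, (fun i => delta_mx 0 i), L; split=> [i|v].
  exact: coord_continuous.
exact: row_sum_delta.
Qed.

Lemma findim_prod V W : findim V -> findim W -> findim (V * W)%type.
Proof.
move=> [s [e [l [lc le]]]] [t [e' [l' [lc' le']]]].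
pose k (i : 'I_(s + t)) (p : V * W) : R^o :=
  match fintype.split i with inl a => l a p.1 | inr b => l' b p.2 end.
have kl i : linear (k i).
  by move=> a p q; rewrite /k; case: (fintype.split i) => j /=; rewrite linearP.
pose K i : {linear (V * W)%type -> R^o} :=
  HB.pack (k i) (GRing.isLinear.Build _ _ _ _ (k i) (kl i)).
exists (s + t)%N, (fun i => match fintype.split i with
   inl a => (e a, 0) | inr b => (0, e' b) end), K; split=> [i|[v w]].
  rewrite /K /= /k; case: (fintype.split i) => j p.
    by apply: (@continuous_comp _ _ _ fst (l j)); [exact: cvg_fst|exact: lc].
  by apply: (@continuous_comp _ _ _ snd (l' j)); [exact: cvg_snd|exact: lc'].
rewrite big_split_ord /=.
have lE (i : 'I_s) : k (lshift t i) (v, w) = l i v.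
  by rewrite /k -[lshift t i]/(unsplit (inl i)) unsplitK.
have rE (i : 'I_t) : k (rshift s i) (v, w) = l' i w.
  by rewrite /k -[rshift s i]/(unsplit (inr i)) unsplitK.
under eq_bigr => i _.
  rewrite lE -[lshift t i]/(unsplit (inl i)) unsplitK; over.
under [X in _ + X]eq_bigr => i _.
  rewrite rE -[rshift s i]/(unsplit (inr i)) unsplitK; over.
apply/pair_equal_spec; split => /=.
  rewrite !(raddf_sum fst) /= [X in _ + X]big1 ?addr0; last first.
    by move=> i _; rewrite scaler0.
  exact: le.
rewrite !(raddf_sum snd) /= big1 ?add0r; last by move=> i _; rewrite scaler0.
exact: le'.
Qed.

Lemma Ck_mul V k (U : set V) (f g : V -> R^o) : open U ->
  Ck k U f -> Ck k U g -> Ck k U (fun x => f x * g x : R^o).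
Proof.
move=> oU; elim: k f g => [|k IH] f g.
  by move=> fc gc x Ux; apply: cvgM; [exact: fc|exact: gc].
move=> fk gk; have [df Df] := fk; have [dg Dg] := gk.
split=> [x Ux|v].
  by apply: differentiableM; [exact: df|exact: dg].
have fk' := Ck_pred fk; have gk' := Ck_pred gk.
apply: Ck_eq (Ck_add oU (IH _ _ fk' (Dg v)) (IH _ _ gk' (Df v))) => // x Ux.
rewrite [RHS](@deriveM _ _ f g) //; apply: diff_derivable; [exact: df|exact: dg].
Qed.

Lemma Ck_scalel V W k (U : set V) (f : V -> R^o) (w : W) : open U ->
  Ck k U f -> Ck k U (fun x => f x *: w).
Proof.
move=> oU; elim: k f => [|k IH] f.
  by move=> fc x Ux; apply: cvgZr_tmp; exact: fc.
move=> [df Df]; split=> [x Ux|v].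
  by apply: differentiableZl; exact: df.
apply: Ck_eq (IH _ (Df v)) => // x Ux.
rewrite [RHS]deriveE; last by apply: differentiableZl; exact: df.
by rewrite diffZl ?deriveE //; exact: df.
Qed.

Lemma Ck_scale V W k (U : set V) (f : V -> R^o) (g : V -> W) :
  findim W -> open U -> Ck k U f -> Ck k U g -> Ck k U (fun x => f x *: g x).
Proof.
move=> [s [e [l [lc le]]]] oU fk gk.
apply: (Ck_eq oU (f := fun x => \sum_i (f x * l i (g x)) *: e i)).
  move=> x _; rewrite [in RHS](le (g x)) scaler_sumr.
  by apply: eq_bigr => i _; rewrite scalerA.
apply: Ck_sum => // i; apply: Ck_scalel => //; apply: Ck_mul => //.
exact: (Ck_linear_comp oU (lc i) gk).
Qed.

Lemma Ck_inv V k (U : set V) (f : V -> R^o) : open U ->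
  (forall x, U x -> f x != 0) -> Ck k U f -> Ck k U (fun x => (f x)^-1 : R^o).
Proof.
move=> oU f0; elim: k f f0 => [|k IH] f f0.
  by move=> fc x Ux; apply: cvgV; [exact: f0|exact: fc].
move=> fk; have [df Df] := fk; split=> [x Ux|v].
  by apply: differentiableV; [exact: df|exact: f0].
have ik := IH f f0 (Ck_pred fk).
apply: (Ck_eq oU _ (Ck_opp oU (Ck_mul oU (Ck_mul oU ik ik) (Df v)))) => x Ux.
rewrite [RHS](@deriveV _ _ f) ?f0 //; last by apply: diff_derivable; exact: df.
by rewrite -invfM -expr2 scaleNr.
Qed.

Lemma Ck_comp V W (Y : normedModType R) k (U : set Y) (U' : set V)
    (g : Y -> V) (f : V -> W) : findim V -> findim W ->
  open U -> (forall x, U x -> U' (g x)) -> Ck k U g -> Ck k U' f ->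
  Ck k U (f \o g).
Proof.
move=> fV fW oU UU'; elim: k f => [|k IH] f.
  by move=> gc fc x Ux; apply: continuous_comp; [exact: gc|apply/fc/UU'].
move=> gk fk; have [dg Dg] := gk; have [df Df] := fk; split=> [x Ux|v].
  by apply: differentiable_comp; [exact: dg|apply/df/UU'].
have [s [e [l [lc le]]]] := fV.
(* The chain rule yields a derivative of [f] in the moving direction ['D_v g x]. Its coordinates are
   as regular as ['D_v g], and the induction hypothesis applies to each ['D_(e i) f]. *)
apply: (Ck_eq oU (f := fun x => \sum_i l i ('D_v g x) *: 'D_(e i) f (g x))).
  move=> x Ux; rewrite derive_comp; [|exact: dg|by apply/df/UU'].
  by rewrite [in RHS](le ('D_v g x)) derive_sumv //; apply/df/UU'.
apply: Ck_sum => // i; apply: Ck_scale => //.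
  exact: (Ck_linear_comp oU (lc i) (Dg v)).
exact: (IH _ (Ck_pred gk) (Df (e i))).
Qed.

End FiniteDimension.

(** * Mean values and symmetry of second derivatives *)

Section Clairaut.
Variables (R : realType) (V : normedModType R).

Lemma is_derive_line (W : normedModType R) (f : V -> W) (x u : V) (t : R) :
  differentiable f (x + t *: u) ->
  is_derive t (1 : R) (fun s : R => f (x + s *: u)) ('D_u f (x + t *: u)).
Proof.
move=> df.
have dZ : is_diff t (fun s : R => s *: u) (fun s => s *: u).
  exact: is_diff_scalel.
have dZu : differentiable (fun s : R => s *: u) t by [].
have dl : differentiable (fun s : R => x + s *: u : V) t.
  exact: differentiableD.
have E : 'D_1 (fun s : R => x + s *: u : V) t = u.
  rewrite deriveE // (@diffD _ _ _ (cst x) (fun s : R => s *: u)) // diff_cst.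
  by rewrite diff_val /= add0r scale1r.
apply: DeriveDef; first by apply: diff_derivable; exact: differentiable_comp dl df.
by rewrite [LHS](@derive_comp R R^o V W (fun s : R => x + s *: u) f t 1) // E.
Qed.

Lemma mean_value_line (f : V -> R^o) (x u : V) (s : R) : 0 < s ->
  (forall t : R, 0 <= t <= s -> differentiable f (x + t *: u)) ->
  exists2 t : R, 0 < t < s & f (x + s *: u) - f x = s * 'D_u f (x + t *: u).
Proof.
move=> s0 df; pose g (t : R) : R := f (x + t *: u).
have dg (t : R) : 0 <= t <= s -> is_derive t 1 g ('D_u f (x + t *: u)).
  by move=> /df; exact: is_derive_line.
have dg' (t : R) : t \in `]0, s[ -> is_derive t 1 g ('D_u f (x + t *: u)).
  by rewrite in_itv /= => /andP[t0 ts]; apply: dg; rewrite !ltW.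
have gc : {within `[0, s], continuous g}.
  apply: derivable_within_continuous => t; rewrite in_itv /= => ts.
  by have [] := dg t ts.
have [t] := MVT s0 dg' gc.
rewrite in_itv /= => ts E; exists t => //.
by move: E; rewrite /g scale0r addr0 subr0 mulrC.
Qed.

(** Mean value theorem twice: along [u] for $y\mapsto f(y+sv)-f(y)$, then along [v] for $D_uf$. The
    second difference is symmetric in [u] and [v], which is what [deriveC] exploits. *)
Lemma mixed_difference (f : V -> R^o) (U : set V) (x u v : V) (s : R) :
  0 < s -> Ck 2 U f ->
  (forall a b : R, 0 <= a <= s -> 0 <= b <= s -> U (x + a *: u + b *: v)) ->
  exists a b : R, [/\ 0 < a < s, 0 < b < s &
    f (x + s *: u + s *: v) - f (x + s *: u) - (f (x + s *: v) - f x) =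
    s * s * 'D_v ('D_u f) (x + a *: u + b *: v)].
Proof.
move=> s0 [df Df] Us; have s0s : 0 <= s <= s by rewrite ltW /=.
pose g (y : V) : R^o := f (y + s *: v) - f y.
have dfv (y : V) : U (y + s *: v) ->
    differentiable (fun y : V => f (y + s *: v)) y.
  move=> Uy; apply: (@differentiable_comp _ _ _ _ (fun y => y + s *: v)).
    exact: differentiableD.
  exact: df.
have DfvE (y : V) : U (y + s *: v) ->
    'D_u (fun y : V => f (y + s *: v)) y = 'D_u f (y + s *: v).
  move=> Uy; have dT : differentiable (fun y : V => y + s *: v) y.
    exact: differentiableD.
  rewrite [LHS](@derive_comp R V V _ (fun y => y + s *: v) f) //; last exact: df.
  by rewrite deriveD // derive_id derive_cst addr0.
have U0 (a : R) : 0 <= a <= s -> U (x + a *: u).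
  move=> as_; have := Us a 0 as_; rewrite scale0r addr0; apply.
  by rewrite lexx ltW.
have dg (t : R) : 0 <= t <= s -> differentiable g (x + t *: u).
  by move=> ts; apply: differentiableB; [exact/dfv/Us|exact/df/U0].
have [a as_ E] := mean_value_line s0 dg.
have as' : 0 <= a <= s by case/andP: as_ => *; rewrite !ltW.
have dDf (t : R) : 0 <= t <= s -> differentiable ('D_u f) (x + a *: u + t *: v).
  by move=> ts; have [Dd _] := Df u; apply: Dd; exact: Us.
have [b bs E'] := mean_value_line s0 dDf.
exists a, b; split => //; rewrite -mulrA -E'.
move: E; rewrite {1 2}/g => ->; congr (_ * _).
rewrite /g deriveB ?DfvE //; [exact: Us| |].
- by apply/diff_derivable/dfv/Us.
- by apply/diff_derivable/df/U0.
Qed.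

Lemma deriveC (f : V -> R^o) (U : set V) (x u v : V) :
  open U -> Ck 2 U f -> U x -> 'D_v ('D_u f) x = 'D_u ('D_v f) x.
Proof.
move=> oU f2 Ux; apply/eqP; rewrite -subr_eq0 -normr_le0; apply/ler_addgt0Pr.
move=> e e0; rewrite add0r.
have [_ Df] := f2.
have [_ Df2] := Df u; have [_ Df2'] := Df v.
have e2 : 0 < e / 2 by rewrite divr_gt0.
have /cvgrPdist_lt/(_ _ e2) c1 := Df2 v x Ux.
have /cvgrPdist_lt/(_ _ e2) c2 := Df2' u x Ux.
have xU : nbhs x U by exact: open_nbhs_nbhs.
have [r /= r0 rP] := (nbhs_normP x _).1 (filterI xU (filterI c1 c2)).
(* With this side length the parallelogram spanned by [s *: u] and [s *: v] at [x] lies within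
   distance [r] of [x]; the summand 1 covers [u = v = 0]. *)
pose s := r / 2 / (`|u| + `|v| + 1).
have d0 : 0 < `|u| + `|v| + 1 by rewrite ltr_wpDl // addr_ge0.
have s0 : 0 < s by apply: divr_gt0 => //; exact: divr_gt0.
have near_s a b : 0 <= a <= s -> 0 <= b <= s -> `|a *: u + b *: v| < r.
  move=> /andP[a0 as_] /andP[b0 bs]; apply: (le_lt_trans (ler_normD _ _)).
  rewrite !normrZ !ger0_norm //.
  apply: (@le_lt_trans _ _ (s * (`|u| + `|v|))).
    by rewrite mulrDr lerD // ler_wpM2r.
  apply: (@le_lt_trans _ _ (s * (`|u| + `|v| + 1))).
    by rewrite ler_wpM2l ?lerDl // ltW.
  by rewrite /s divfK ?gt_eqF // ltr_pdivrMr // ltr_pMr // ltr1n.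
have ball_s a b : 0 <= a <= s -> 0 <= b <= s ->
    ball_ Num.norm x r (x + a *: u + b *: v).
  by move=> as_ bs; rewrite /ball_ /= -addrA opprD addrA subrr add0r normrN near_s.
have Us a b : 0 <= a <= s -> 0 <= b <= s -> U (x + a *: u + b *: v).
  by move=> as_ bs; have [] := rP _ (ball_s _ _ as_ bs).
have Us' a b : 0 <= a <= s -> 0 <= b <= s -> U (x + a *: v + b *: u).
  by move=> as_ bs; rewrite addrAC; exact: Us.
have le2 a : 0 < a < s -> 0 <= a <= s.
  by case/andP => *; rewrite !ltW.
have [a [b [as_ bs E]]] := mixed_difference s0 f2 Us.
have [a' [b' [as' bs' E']]] := mixed_difference s0 f2 Us'.
(* The two second differences agree, so the two mixed derivatives take a common value, at different
   points close to [x]; continuity brings both back to [x]. *)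
have EE : 'D_v ('D_u f) (x + a *: u + b *: v) =
          'D_u ('D_v f) (x + a' *: v + b' *: u).
  apply: (mulfI (_ : s * s != 0)); first by rewrite mulf_neq0 // gt_eqF.
  rewrite [LHS](esym E) [RHS](esym E') [x + s *: v + s *: u]addrAC.
  by rewrite !opprB addrACA [X in _ + X]addrC addrACA.
have [_ [h1 _]] := rP _ (ball_s _ _ (le2 _ as_) (le2 _ bs)).
have := ball_s _ _ (le2 _ bs') (le2 _ as').
rewrite addrAC => /rP[_ [_ h2]].
have tri (p q w : R^o) : `|p - q| < e / 2 -> `|w - q| < e / 2 -> `|p - w| <= e.
  move=> pq; rewrite distrC => wq; rewrite (splitr e) -[X in `|X|](subrKA q).
  exact: le_trans (ler_normD _ _) (lerD (ltW pq) (ltW wq)).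
by rewrite EE in h1; exact: tri h1 h2.
Qed.

End Clairaut.

Lemma nbhs_openP (T : topologicalType) (x : T) (P : set T) :
  nbhs x P -> exists N : set T, [/\ open N, N x & N `<=` P].
Proof. by rewrite nbhsE => -[N [oN Nx] NP]; exists N. Qed.

(** * Implicit function theorem with one real unknown *)

Section ImplicitFunction.
Variables (R : realType) (Y : normedModType R).

Lemma implicit_differentiable (G : Y * R^o -> R^o) (f : Y -> R^o) (y : Y) :
  differentiable G (y, f y) -> 'D_(0, 1) G (y, f y) != 0 ->
  {for y, continuous f} -> (\forall z \near y, G (z, f z) = 0) ->
  differentiable f y /\
  forall v, 'D_v f y = - ('D_(0, 1) G (y, f y))^-1 * 'D_(v, 0) G (y, f y).
Proof.
set p := (y, f y); set B := 'D_(0, 1) G p => dG B0 fc G0.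
pose l (v : Y) : R^o := - B^-1 * 'd G p (v, 0).
have ll : linear l.
  move=> a u v; rewrite /l.
  have -> : (a *: u + v, 0) = a *: (u, 0) + (v, 0) :> Y * R^o.
    by apply/pair_equal_spec; rewrite /= scaler0 addr0.
  by rewrite linearP mulrDr /= scalerAr.
pose L : {linear Y -> R^o} :=
  HB.pack l (GRing.isLinear.Build _ _ _ _ l ll).
have Lc : continuous L.
  move=> v; apply: cvgM; first exact: cvg_cst.
  apply: (@continuous_comp _ _ _ (fun v : Y => (v, 0) : Y * R^o)); last first.
    exact: diff_continuous.
  apply: (@cvg_pair _ _ _ (nbhs v) (nbhs v) (nbhs (0 : R^o))).
    exact: cvg_id.
  exact: cvg_cst.
have [M M0 LM] := linear_lipschitz Lc.
suff [df dE] : differentiable f y /\ 'd f y = L :> (Y -> R^o).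
  by split=> // v; rewrite deriveE // dE /L /= /l deriveE.
apply: differentiable_epsP => // e e0.
(* The linearization of [G] bounds the error by [th * (|h| + |k h|)], where [|k h|] is not yet known
   to be of order [|h|]. The bound [th <= 1/2] absorbs it and gives [|k h| <= (2 * M + 1) * |h|];
   then [th * (2 * M + 3) <= e] suffices. *)
pose th := Num.min 2^-1 (e / (2 * M + 3)).
have M3 : 0 < 2 * M + 3 by rewrite addr_gt0 // mulr_gt0.
have th0 : 0 < th by rewrite lt_min invr_gt0 ltr0n /= divr_gt0.
have th1 : th <= 2^-1 by rewrite ge_min lexx.
have the : th * (2 * M + 3) <= e by rewrite -ler_pdivlMr // ge_min lexx orbT.
pose k (h : Y) : R^o := f (h + y) - f y.
have kc : (h, k h) @[h --> (0 : Y)] --> (0 : Y * R^o).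
  apply: (@cvg_pair _ _ _ (nbhs (0 : Y)) (nbhs (0 : Y)) (nbhs (0 : R^o))).
    exact: cvg_id.
  rewrite -(subrr (f y)); apply: cvgB; last exact: cvg_cst.
  have sc : h + y @[h --> (0 : Y)] --> y.
    by rewrite -[X in _ --> X]add0r; apply: cvgD; [exact: cvg_id|exact: cvg_cst].
  exact: cvg_comp sc fc.
have Bn0 : 0 < `|B| by rewrite normr_gt0.
have H := kc _ (differentiable_eps dG (mulr_gt0 th0 Bn0)).
have G0' : \forall h \near (0 : Y), G (h + y, f (h + y)) = 0.
  move: G0; rewrite (near_shift (0 : Y)); apply: filterS => h /=.
  by rewrite subr0.
have Gp : G p = 0 by exact: nbhs_singleton G0.
have sc1 (a : R^o) : a *: (1 : R^o) = a by exact: mulr1.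
apply: filterS2 G0' H => h Gh /=; rewrite Gp.
have -> : (h, k h) + p = (h + y, f (h + y)).
  by apply/pair_equal_spec; rewrite /= /k subrK.
have -> : (h, k h) = (h, 0) + k h *: (0, 1) :> Y * R^o.
  by apply/pair_equal_spec; rewrite /= scaler0 !addr0 add0r sc1.
rewrite Gh subrr sub0r normrN linearD linearZ /= -(deriveE ((0, 1) : Y * R^o) dG) -/B.
have -> : 'd G p (h, 0) + k h *: B = B * (k h - l h).
  by rewrite /l mulrBr mulNr mulrN opprK mulVKf // addrC [B * _]mulrC.
have -> : f (h + y) - f y = k h by [].
rewrite normrM [th * _]mulrC -mulrA ler_pM2l // => H1.
have nE : `|(h, 0) + k h *: (0, 1) : Y * R^o| = Num.max `|h| `|k h|.
  by rewrite prod_normE /= scaler0 addr0 add0r sc1.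
have H2 := ler_normD (l h) (k h - l h); rewrite subrKC in H2.
rewrite nE in H1.
have LMh := LM h; rewrite -[L h]/(l h) in LMh.
have mle : Num.max `|h| `|k h| <= `|h| + `|k h|.
  by rewrite ge_max lerDl lerDr !normr_ge0.
have h0 : 0 <= `|h| by [].
have H5 : `|k h - l h| <= th * (`|h| + `|k h|).
  by apply: le_trans H1 _; rewrite ler_pM2l.
have fin (d hn a lh : R) : 0 <= hn -> 0 <= a -> d <= th * (hn + a) ->
    a <= lh + d -> lh <= M * hn -> d <= e * hn.
  move=> hn0 a0 I1 I2 I3.
  have I4 : d <= 2^-1 * (hn + a).
    by apply: le_trans I1 _; rewrite ler_wpM2r // addr_ge0.
  have I5 : a <= (2 * M + 1) * hn by lra.
  apply: (@le_trans _ _ (th * (2 * M + 3) * hn)); last by rewrite ler_wpM2r.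
  apply: le_trans I1 _; rewrite -mulrA ler_pM2l //; lra.
exact: fin h0 _ H5 H2 LMh.
Qed.

(** The derivative of $G(y_0,\cdot)$ at [t0] is nonzero, so opposite signs occur at [t0 - s] and
    [t0 + s]. They persist for [z] near [y0], and the intermediate value theorem gives a zero in
    between. *)
Lemma implicit_zero (O : set (Y * R^o)) (G : Y * R^o -> R^o) (y0 : Y) (t0 : R)
    (e : R) :
  open O -> (forall q, O q -> {for q, continuous G}) -> O (y0, t0) ->
  G (y0, t0) = 0 -> differentiable G (y0, t0) -> 'D_(0, 1) G (y0, t0) != 0 ->
  0 < e ->
  \forall z \near y0, exists t : R, [/\ `|t - t0| < e, O (z, t) & G (z, t) = 0].
Proof.
move=> oO Gc O0 G0 dG B0 e0; set B := 'D_(0, 1) G (y0, t0) in B0.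
have Bn0 : 0 < `|B| / 2 by rewrite divr_gt0 ?normr_gt0.
have [[P Q] /= [nP nQ] PQ] : nbhs (y0, t0 : R^o) O by exact: open_nbhs_nbhs.
have [r /= r0 rQ] := (nbhs_normP t0 _).1 nQ.
have cs : ((0 : Y), (s : R^o)) @[s --> (0 : R)] --> (0 : Y * R^o).
  by apply: (@cvg_pair _ _ _ (nbhs (0 : R)) (nbhs (0 : Y)) (nbhs (0 : R^o))); 
    [exact: cvg_cst|exact: cvg_id].
have := cs _ (differentiable_eps dG Bn0).
move=> /(nbhs_normP (0 : R))[d /= d0 dP].
pose s := Num.min (Num.min (r / 2) (e / 2)) (d / 2).
have s0 : 0 < s by rewrite !lt_min !divr_gt0.
have sr : s < r.
  apply: (@le_lt_trans _ _ (r / 2)); first by rewrite !ge_min lexx.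
  by rewrite ltr_pdivrMr // ltr_pMr // ltr1n.
have se : s < e.
  apply: (@le_lt_trans _ _ (e / 2)); first by rewrite !ge_min lexx orbT.
  by rewrite ltr_pdivrMr // ltr_pMr // ltr1n.
have sd : s < d.
  apply: (@le_lt_trans _ _ (d / 2)); first by rewrite !ge_min lexx orbT.
  by rewrite ltr_pdivrMr // ltr_pMr // ltr1n.
have Gs (u : R) : `|u| < d -> `|G (y0, u + t0) - u * B| <= `|B| / 2 * `|u|.
  move=> ud; have := dP u; rewrite /ball_ /= sub0r normrN => /(_ ud).
  have -> : (0, u) + (y0, t0) = (y0, u + t0) :> Y * R^o.
    by apply/pair_equal_spec; rewrite /= add0r.
  have -> : (0, u) = u *: (0, 1) :> Y * R^o.
    by apply/pair_equal_spec; rewrite /= scaler0; split => //; rewrite [RHS]mulr1.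
  rewrite G0 subr0 linearZ /= -(deriveE ((0, 1) : Y * R^o) dG) -/B.
  rewrite prod_normE /= scaler0 normr0 [X in Num.max _ X](_ : _ = `|u|); last first.
    by congr (`|_|); exact: mulr1.
  by rewrite (max_idPr _).
have fin (a b c : R) : c != 0 -> `|a - s * c| <= `|c| / 2 * s ->
    `|b - - s * c| <= `|c| / 2 * s -> a * b < 0.
  move=> c0; rewrite !ler_norml.
  have [c_gt0|c_lt0|cz] := ltgtP c 0; last by rewrite cz eqxx in c0.
    have sc : s * c < 0 by rewrite pmulr_rlt0.
    rewrite ltr0_norm // => /andP[h1 h2] /andP[h3 h4].
    rewrite nmulr_rlt0; lra.
  have sc : 0 < s * c by rewrite mulr_gt0.
  rewrite gtr0_norm // => /andP[h1 h2] /andP[h3 h4].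
  rewrite pmulr_rlt0; lra.
have sgn : G (y0, s + t0) * G (y0, - s + t0) < 0.
  have := Gs s; have := Gs (- s); rewrite !normrN gtr0_norm // => /(_ sd) h1 /(_ sd) h2.
  exact: (fin _ _ _ B0 h2 h1).
have Oz z t : P z -> `|t - t0| <= s -> O (z, t).
  move=> Pz ts; apply: (PQ (z, t)); split=> //=; apply: rQ.
  by rewrite /ball_ /= distrC; exact: le_lt_trans sr.
have zc t : `|t - t0| <= s -> {for y0, continuous (fun z => G (z, t))}.
  move=> ts; have Oyt : O (y0, t) by apply: Oz ts; exact: nbhs_singleton.
  apply: (@continuous_comp _ _ _ (fun z : Y => (z, t) : Y * R^o) G); last first.
    exact: Gc.
  apply: (@cvg_pair _ _ _ (nbhs y0) (nbhs y0) (nbhs (t : R^o))).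
    exact: cvg_id.
  exact: cvg_cst.
have near_sgn : \forall z \near y0, G (z, s + t0) * G (z, - s + t0) < 0.
  have c : {for y0, continuous (fun z => G (z, s + t0) * G (z, - s + t0) : R^o)}.
    by apply: cvgM; apply: zc; rewrite addrK ?normrN gtr0_norm.
  exact: (cvgr_lt _ c).
apply: filterS2 nP near_sgn => z Pz Gz.
pose g (t : R) : R := G (z, t).
have gc : {within `[- s + t0, s + t0], continuous g}.
  apply: continuous_in_subspaceT => t; rewrite inE /= in_itv /= => /andP[h1 h2].
  apply: (@continuous_comp _ _ _ (fun t : R => (z, t) : Y * R^o) G); last first.
    by apply/Gc/Oz => //; rewrite ler_norml; apply/andP; split; lra.
  apply: (@cvg_pair _ _ _ (nbhs t) (nbhs z) (nbhs (t : R^o))).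
    exact: cvg_cst.
  exact: cvg_id.
have ab : - s + t0 <= s + t0 by lra.
have g0 : Num.min (g (- s + t0)) (g (s + t0)) <= 0 <=
    Num.max (g (- s + t0)) (g (s + t0)).
  rewrite /g ge_min le_max; move: Gz.
  move: (G (z, s + t0)) (G (z, - s + t0)) => a b ab0.
  by case: (ltrgt0P a) ab0; case: (ltrgt0P b) => // *; nra.
have [t] := IVT ab gc g0.
rewrite in_itv /= => /andP[h1 h2] gt0.
have ts : `|t - t0| <= s by rewrite ler_norml; apply/andP; split; lra.
by exists t; split => //; [exact: le_lt_trans se|exact: Oz].
Qed.

(** Bootstrap: the formula for ['D_v f] only involves derivatives of [G] at [(y, f y)], hence is as
    regular as [f], and [f] gains one derivative. *)
Lemma implicit_Ck (O : set (Y * R^o)) (G : Y * R^o -> R^o) (N : set Y)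
    (f : Y -> R^o) (k : nat) : findim Y ->
  open O -> smooth_on O G -> open N ->
  (forall y, N y -> [/\ O (y, f y), G (y, f y) = 0 & 'D_(0, 1) G (y, f y) != 0]) ->
  (forall y, N y -> {for y, continuous f}) -> Ck k N f.
Proof.
move=> fY oO Gs oN NG fc.
have df y : N y -> differentiable f y /\
    forall v, 'D_v f y = - ('D_(0, 1) G (y, f y))^-1 * 'D_(v, 0) G (y, f y).
  move=> Ny; have [Oy Gy By] := NG _ Ny.
  apply: implicit_differentiable => //; last 2 first.
  - exact: fc.
  - have nN : nbhs y N by exact: open_nbhs_nbhs.
    by apply: filterS nN => z Nz; have [] := NG _ Nz.
  by have [dG _] := Gs 1%N; exact: dG.
have fYR : findim (Y * R^o)%type by apply: findim_prod => //; exact: findim_real.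
elim: k => [|k IH]; first exact: fc.
split=> [y /df[]//|v].
have gk (w : Y * R^o) : Ck k N (fun y => 'D_w G (y, f y)).
  apply: (@Ck_comp R (Y * R^o)%type R^o Y k N O (fun y => (y, f y)) ('D_w G)) => //.
  - exact: findim_real.
  - by move=> y /NG[].
  - by apply: Ck_pair => //; exact: (@Ck_linear R Y Y k N idfun (fun x => cvg_id)).
  - by have [_ ] := Gs k.+1; exact.
have ik : Ck k N (fun y => ('D_(0, 1) G (y, f y))^-1 : R^o).
  by apply: Ck_inv => // y /NG[].
apply: (Ck_eq oN _ (Ck_mul oN (Ck_opp oN ik) (gk (v, 0)))) => y /df[_ ->].
by [].
Qed.

(** The function [f] is given beforehand and only local uniqueness of the solution is assumed. Zeros
    of [G] exist over nearby points at heights close to [t0], and uniqueness makes them the values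
    of [f], whence continuity. This form suits a metric that is defined by choice. *)
Lemma implicit_function (O : set (Y * R^o)) (G : Y * R^o -> R^o) (f : Y -> R^o)
    (y0 : Y) (t0 : R^o) : findim Y ->
  open O -> smooth_on O G -> O (y0, t0) -> G (y0, t0) = 0 ->
  'D_(0, 1) G (y0, t0) != 0 ->
  (\forall z \near y0, forall t, O (z, t) -> G (z, t) = 0 -> f z = t) ->
  f y0 = t0 /\ exists N : set Y, [/\ open N, N y0, smooth_on N f &
    forall z, N z -> O (z, f z) /\ G (z, f z) = 0].
Proof.
move=> fY oO Gs O0 G0 B0 fu.
have Gc q : O q -> {for q, continuous G} by exact: (Gs 0%N).
have [dG DG] := Gs 1%N.
have f0 : f y0 = t0 by exact: (nbhs_singleton fu _ O0 G0).
split=> //.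
have fcont z t : O (z, t) -> G (z, t) = 0 -> 'D_(0, 1) G (z, t) != 0 ->
    (\forall z \near z, forall t, O (z, t) -> G (z, t) = 0 -> f z = t) ->
    {for z, continuous f} /\ \forall z \near z, O (z, f z) /\ G (z, f z) = 0.
  move=> Oz Gz Bz fuz; have fz : f z = t by exact: (nbhs_singleton fuz _ Oz Gz).
  split.
    apply/cvgrPdist_lt => e e0; rewrite fz.
    apply: filterS2 fuz (implicit_zero oO Gc Oz Gz (dG _ Oz) Bz e0) => y fy.
    by case=> s [st Oy Gy]; rewrite (fy s) // distrC.
  apply: filterS2 fuz (implicit_zero oO Gc Oz Gz (dG _ Oz) Bz ltr01) => y fy.
  by case=> s [st Oy Gy]; rewrite (fy s).
have [fc0 fO0] := fcont _ _ O0 G0 B0 fu.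
have fp : {for y0, continuous (fun z => (z, f z) : Y * R^o)}.
  apply: (@cvg_pair _ _ _ (nbhs y0) (nbhs y0) (nbhs (f y0))) => //.
have Bf : \forall z \near y0, 'D_(0, 1) G (z, f z) != 0.
  have c : {for y0, continuous (fun z => 'D_(0, 1) G (z, f z) : R^o)}.
    apply: (@continuous_comp _ _ _ (fun z : Y => (z, f z) : Y * R^o) ('D_(0, 1) G)).
      exact: fp.
    by apply: DG; rewrite f0.
  by apply: (cvgr_neq0 _ c); rewrite f0.
(* Continuity is wanted at every point of [N], so uniqueness must hold around each of them: hence
   the interior of the set where it holds. *)
have [N [oN Ny0 NP]] := nbhs_openP (filterI (filterI fO0 Bf) (nbhs_interior fu)).
exists N; split => //; last by move=> z /NP[[]].
move=> k; apply: (implicit_Ck k fY oO Gs oN) => z /NP[[[Oz Gz] Bz] fuz] //.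
exact: (fcont z (f z) Oz Gz Bz fuz).1.
Qed.

(** The last partial derivative of [G] does not vanish on the box [O'], whose vertical sections are
    intervals; by the mean value theorem [G] has at most one zero on each of them. *)
Lemma implicit_exists (O : set (Y * R^o)) (G : Y * R^o -> R^o)
    (y0 : Y) (t0 : R^o) : findim Y ->
  open O -> smooth_on O G -> O (y0, t0) -> G (y0, t0) = 0 ->
  'D_(0, 1) G (y0, t0) != 0 ->
  exists (f : Y -> R^o) (N : set Y) (O' : set (Y * R^o)),
    [/\ open N, N y0, open O' & O' `<=` O] /\
    [/\ O' (y0, t0), f y0 = t0, smooth_on N f,
        (forall z, N z -> O' (z, f z) /\ G (z, f z) = 0) &
        (forall z t, O' (z, t) -> G (z, t) = 0 -> f z = t)].
Proof.
move=> fY oO Gs O0 G0 B0.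
have [dG DG] := Gs 1%N.
have nB : nbhs (y0, t0) (O `&` [set q | 'D_(0, 1) G q != 0]).
  apply: filterI; first exact: open_nbhs_nbhs.
  exact: (cvgr_neq0 _ (DG (0, 1) _ O0)).
have [[P Q] /= [nP nQ] PQ] := nB.
have [r /= r0 rQ] := (nbhs_normP t0 _).1 nQ.
pose O' : set (Y * R^o) := [set q | P^° q.1 /\ `|q.2 - t0| < r].
have O'PQ q : O' q -> O q /\ 'D_(0, 1) G q != 0.
  case: q => z t [/= /interior_subset Pz tr]; apply: (PQ (z, t)); split => //=.
  by apply: rQ; rewrite /ball_ /= distrC.
have oO' : open O'.
  apply: openI.
    by apply: open_comp (@open_interior _ P) => q _; exact: cvg_fst.
  apply: (@open_comp _ _ (fun q : Y * R^o => q.2 : R^o) [set t | `|t - t0| < r]).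
    by move=> q _; exact: cvg_snd.
  have -> : [set t | `|t - t0| < r] = ball t0 r.
    by apply/seteqP; split => t; rewrite -ball_normE /ball_ /= distrC.
  exact: ball_open.
have O'0 : O' (y0, t0) by split => /=; rewrite ?subrr ?normr0.
have uniq z t t' : t < t' -> O' (z, t) -> O' (z, t') -> G (z, t) = 0 ->
    G (z, t') = 0 -> False.
  move=> tt' Ot Ot' Gt Gt'.
  have seg s : 0 <= s <= t' - t -> O' ((z, t) + s *: (0, 1)).
    move=> /andP[s0 s1]; split; rewrite /= ?scaler0 ?addr0; first by case: Ot.
    rewrite [s *: 1]mulr1; move: Ot Ot' => [_ /=]; rewrite !ltr_norml.
    move=> /andP[h1 h2] [_ /=]; rewrite ltr_norml => /andP[h3 h4].
    by apply/andP; split; lra.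
  have tt : 0 < t' - t by rewrite subr_gt0.
  have dseg s : 0 <= s <= t' - t -> differentiable G ((z, t) + s *: (0, 1)).
    by move=> /seg/O'PQ[? _]; exact: dG.
  have [s /andP[s0 s1]] := mean_value_line tt dseg.
  have -> : (z, t) + (t' - t) *: (0, 1) = (z, t') :> Y * R^o.
    apply/pair_equal_spec; rewrite /= scaler0 addr0; split => //.
    by rewrite [_ *: _]mulr1 subrKC.
  rewrite Gt Gt' subrr => /esym/eqP; rewrite mulf_eq0 gt_eqF //=.
  have /seg/O'PQ[_ /negP//] : 0 <= s <= t' - t by rewrite !ltW.
pose f z : R^o := xget 0 [set t | O' (z, t) /\ G (z, t) = 0].
have fu z t : O' (z, t) -> G (z, t) = 0 -> f z = t.
  move=> Ot Gt; have [Of Gf] : O' (z, f z) /\ G (z, f z) = 0.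
    by apply: (@xgetPex _ 0 [set t | O' (z, t) /\ G (z, t) = 0]); exists t.
  have [lt|lt|//] := ltgtP (f z) t; exfalso.
    exact: (uniq _ _ _ lt Of Ot Gf Gt).
  exact: (uniq _ _ _ lt Ot Of Gt Gf).
have Gs' : smooth_on O' G by move=> k; apply: Ck_sub (Gs k) => q /O'PQ[].
have [f0 [N [oN Ny0 fs fN]]] := @implicit_function O' G f y0 t0 fY oO' Gs' O'0 G0 B0
  (nearW _ fu).
by exists f, N, O'; split; split => // q /O'PQ[].
Qed.

End ImplicitFunction.

(** * Regular level sets *)

Lemma open_preimage_within (T : topologicalType) (S : topologicalType)
    (U : set T) (f : T -> S) (P : set S) : open U -> open P ->
  (forall x, U x -> {for x, continuous f}) -> open (U `&` f @^-1` P).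
Proof.
move=> oU oP fc; rewrite openE => x [Ux Px]; apply: filterI.
  exact: open_nbhs_nbhs.
by apply: (fc x Ux); exact: open_nbhs_nbhs.
Qed.

Lemma derive_pair (R : realType) (U V W : normedModType R) (f : U -> V)
    (g : U -> W) (x v : U) : differentiable f x -> differentiable g x ->
  'D_v (fun y => (f y, g y)) x = ('D_v f x, 'D_v g x).
Proof.
move=> df dg; rewrite deriveE; last exact: differentiable_pair.
by rewrite diff_pair // (deriveE v df) (deriveE v dg).
Qed.

Section LevelSet.
Variables (R : realType) (W : normedModType R).
Hypothesis fW : findim W.

Lemma smooth_comp_affine (X Y : normedModType R) (U : set W) (Phi : W -> Y)
    (a : X -> W) : findim Y -> open U -> smooth_on U Phi ->
  smooth_on setT a -> open (a @^-1` U) /\ smooth_on (a @^-1` U) (Phi \o a).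
Proof.
move=> fY oU Ps as_; have oP : open (a @^-1` U).
  rewrite -[_ @^-1` _]setTI; apply: open_preimage_within => //.
    exact: openT.
  by move=> x _; exact: (as_ 0%N).
split=> // k.
apply: (@Ck_comp R W Y X k (a @^-1` U) U a Phi) => //.
by apply: Ck_sub (as_ k).
Qed.

Lemma smooth_shear (xi : W) :
  smooth_on setT (fun q : W * R^o => q.1 + q.2 *: xi).
Proof.
move=> k; apply: (@Ck_add R (W * R^o)%type W k setT fst) => //; first exact: openT.
  by apply: (@Ck_linear R (W * R^o)%type W k setT fst) => q; exact: cvg_fst.
apply: (@Ck_scalel R (W * R^o)%type W k setT snd) => //; first exact: openT.
by apply: (@Ck_linear R (W * R^o)%type R^o k setT snd) => q; exact: cvg_snd.
Qed.

Lemma derive_shear (X : normedModType R) (Phi : W -> X) (xi v y : W) (s t : R) :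
  differentiable Phi (y + t *: xi) ->
  'D_(v, s) (fun q : W * R^o => Phi (q.1 + q.2 *: xi)) (y, t) =
  'D_(v + s *: xi) Phi (y + t *: xi).
Proof.
move=> dP; pose a (q : W * R^o) := q.1 + q.2 *: xi.
have la : linear a.
  move=> b p q; rewrite /a /= scalerDr scalerDl addrACA; congr (_ + (_ + _)).
  by rewrite scalerA.
pose L : {linear (W * R^o)%type -> W} :=
  HB.pack a (GRing.isLinear.Build _ _ _ _ a la).
have Lc : continuous L by move=> q; exact: (@smooth_shear xi 0%N q I).
have dL : differentiable L (y, t) by exact: linear_differentiable.
rewrite [LHS](@derive_comp R (W * R^o)%type W X L Phi) //.
by rewrite derive_linear.
Qed.

Variables (S U : set W) (Phi : W -> R^o).
Hypotheses (oU : open U) (Ps : smooth_on U Phi).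
Hypothesis SU : forall y, U y -> (S y <-> Phi y = 0).

Let dPhi y : U y -> differentiable Phi y.
Proof. by move=> Uy; have [] := Ps 1%N => + _; exact. Qed.

(** Straightening by a shear along [xi]: with $l=d\Phi_x$ and $f(w)=w-b^{-1}(l(w)-\Phi(w))\,\xi$ one
    gets $l\circ f=\Phi$, so [f] carries the level set into the hyperplane $l=0$. The inverse is
    $y\mapsto y+h(y)\xi$, where $t=h(y)$ solves $\Phi(y+t\xi)=l(y)$. *)
Lemma level_slice (x xi : W) : U x -> 'D_xi Phi x != 0 ->
  exists (U' : set W) (f : W -> W) (l : {linear W -> R^o}),
    [/\ open U', U' x, diffeo_on U' f, exists v, l v != 0 &
        forall y, U' y -> (S y <-> l (f y) = 0)].
Proof.
move=> Ux b0.
pose l : {linear W -> R^o} := 'd Phi x.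
have lc : continuous l by apply: diff_continuous; exact: dPhi.
set b := 'D_xi Phi x in b0.
have lb : l xi = b by rewrite /b deriveE //; exact: dPhi.
pose c (w : W) : R^o := b^-1 * (l w - Phi w).
pose f w := w - c w *: xi.
have lf w : l (f w) = Phi w.
  rewrite /f linearB linearZ /= lb -[c w *: b]/(c w * b) /c mulrAC mulVf //.
  by rewrite mul1r subKr.
have fK w : f w + c w *: xi = w by rewrite subrK.
have [oO Os] := smooth_comp_affine (@findim_real R) oU Ps (smooth_shear xi).
set O := _ @^-1` _ in oO Os.
pose G (q : W * R^o) : R^o := Phi (q.1 + q.2 *: xi) - l q.1.
have lfst k : Ck k O (fun q : W * R^o => l q.1).
  apply: (@Ck_linear_comp R (W * R^o)%type W R^o k O fst l) => //.
  by apply: (@Ck_linear R (W * R^o)%type W k O fst) => q; exact: cvg_fst.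
have Gs : smooth_on O G.
  by move=> k; apply: Ck_add => //; apply: Ck_opp.
have O0 : O (f x, c x) by rewrite /O /= fK.
have G0 : G (f x, c x) = 0 by rewrite /G /= fK lf subrr.
have B0 : 'D_(0, 1) G (f x, c x) != 0.
  rewrite /G deriveB; last 2 first.
  - by apply: diff_derivable; have [dG _] := Os 1%N; exact: dG.
  - by apply: diff_derivable; have [dG _] := lfst 1%N; exact: dG.
  rewrite derive_shear; last by rewrite fK; exact: dPhi.
  rewrite fK scale1r add0r.
  have -> : 'D_(0, 1) (fun q : W * R^o => l q.1) (f x, c x) = 0.
    rewrite (@derive_comp R (W * R^o)%type W R^o fst l).
    - rewrite derive_linear // (@derive_linear _ _ _ fst) ?linear0 // => q.
      exact: cvg_fst.
    - by apply: (@linear_differentiable _ _ _ fst) => q; exact: cvg_fst.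
    - exact: linear_differentiable.
  by rewrite subr0.
have [h [N [Q [[oN Nx oQ QO] [Q0 hx hs hN hu]]]]] :=
  implicit_exists fW oO Gs O0 G0 B0.
have cs k : Ck k U c.
  apply: Ck_mul => //; first exact: Ck_cst.
  by apply: Ck_add => //; [exact: Ck_linear|exact: Ck_opp].
have fs k : Ck k U f.
  apply: Ck_add => //; first exact: (@Ck_linear R W W k U idfun (fun x => cvg_id)).
  by apply: Ck_opp => //; apply: Ck_scalel.
(* Besides placing [f w] in the domain of [h], this puts [(f w, c w)] in the set [Q] where zeros of
   [G] are unique, so that [h (f w) = c w] and the inverse is correct. *)
pose U' := U `&` (fun w => (f w, c w)) @^-1` ((N `*` setT) `&` Q).
have oU' : open U'.
  apply: open_preimage_within => //.
    apply: openI => //; rewrite (_ : N `*` setT = fst @^-1` N).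
      by apply: open_comp oN => q _; exact: cvg_fst.
    by apply/seteqP; split => q /=; [case|].
  move=> w Uw; apply: (@cvg_pair _ _ _ (nbhs w) (nbhs (f w)) (nbhs (c w))).
    exact: (fs 0%N).
  exact: (cs 0%N).
exists U', f, l; split => //.
- have fU' : f @` U' = N.
    apply/seteqP; split => [y [w [Uw [[/= Nw _] _]] <-] //|y Ny].
    have [Qy Gy] := hN y Ny.
    have cE : c (y + h y *: xi) = h y.
      move: Gy; rewrite /G /= => /eqP; rewrite subr_eq0 => /eqP Gy.
      rewrite /c Gy linearD linearZ /= lb addrAC subrr add0r.
      by rewrite -[_ *: b]/(_ * b) mulrC mulfK.
    have fE : f (y + h y *: xi) = y by rewrite /f cE addrK.
    by exists (y + h y *: xi) => //; split; [exact: (QO _ Qy)|rewrite /= cE fE].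
  exists (fun y => y + h y *: xi); rewrite fU'; split => //.
  - by move=> k; apply: Ck_sub (fs k) => w [].
  - move=> k; apply: Ck_add => //; last by apply: Ck_scalel.
    exact: (@Ck_linear R W W k N idfun (fun x => cvg_id)).
  - move=> w [Uw [/= _ Qw]]; rewrite (hu _ _ Qw) ?fK //.
    by rewrite /G /= fK lf subrr.
- by exists xi; rewrite lb.
- by move=> y [Uy _]; rewrite lf; exact: SU.
Qed.

Lemma smooth_curve0 (c : R^o -> W) (e : R) : 0 < e ->
  smooth_on [set t : R^o | `|t| < e] c -> differentiable c 0.
Proof.
by move=> e0 /(_ 1%N)[dc _]; apply: dc; rewrite /= normr0.
Qed.

Lemma derive_along_curve (c : R^o -> W) (e : R) (g : W -> R^o) : 0 < e ->
  smooth_on [set t : R^o | `|t| < e] c -> differentiable g (c 0) ->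
  (\forall y \near c 0, S y -> g y = 0) ->
  (forall t, `|t| < e -> S (c t)) -> 'D_('D_(1 : R^o) c 0) g (c 0) = 0.
Proof.
move=> e0 cs dg g0 Sc; have dc := smooth_curve0 e0 cs.
rewrite -derive_comp //.
have cc : {for 0, continuous c} by exact: differentiable_continuous.
have : \forall t \near (0 : R^o), (g \o c) t = cst 0 t.
  have te : \forall t \near (0 : R^o), `|t| < e.
    apply/nbhs_normP; exists e => // t /=.
    by rewrite /ball_ /= sub0r normrN.
  apply: filterS2 te (cc _ g0) => t te gt /=.
  by apply: gt; exact: Sc.
by move/near_eq_derive => ->; rewrite derive_cst.
Qed.

(** A vector killed by $d\Phi$ is the velocity of the curve $x+tX+h(t)\xi$ in the level set, with
    [h] from the implicit function theorem: $h'(0)D_\xi\Phi=-D_X\Phi=0$ forces $h'(0)=0$. *)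
Lemma level_tangent (x xi X : W) : U x -> S x -> 'D_xi Phi x != 0 ->
  tangent_to S x X <-> 'D_X Phi x = 0.
Proof.
move=> Ux Sx b0; split.
  move=> [e [c [e0 cs c0 Sc ->]]].
  rewrite -c0; apply: derive_along_curve e0 cs _ _ Sc; rewrite c0.
    exact: dPhi.
  have nU : nbhs x U by exact: open_nbhs_nbhs.
  by apply: filterS nU => y Uy /SU; apply.
move=> X0; have Phix : Phi x = 0 by apply/SU.
pose a (q : R^o * R^o) : W := x + q.1 *: X + q.2 *: xi.
have as_ : smooth_on setT a.
  move=> k; apply: Ck_add; first exact: openT.
    apply: Ck_add; [exact: openT|exact: Ck_cst|].
    apply: (@Ck_scalel R (R^o * R^o)%type W k setT fst); first exact: openT.
    by apply: (@Ck_linear R (R^o * R^o)%type R^o k setT fst) => q; exact: cvg_fst.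
  apply: (@Ck_scalel R (R^o * R^o)%type W k setT snd); first exact: openT.
  by apply: (@Ck_linear R (R^o * R^o)%type R^o k setT snd) => q; exact: cvg_snd.
have [oO Os] := smooth_comp_affine (@findim_real R) oU Ps as_.
set O := _ @^-1` _ in oO Os.
have aE (t : R^o) : a (t, 0) = x + t *: X by rewrite /a /= scale0r addr0.
have a0 : a (0, 0) = x by rewrite aE scale0r addr0.
have O0 : O (0, 0) by rewrite /O /= a0.
have G0 : (Phi \o a) (0, 0) = 0 by rewrite /= a0.
have Da (v s : R^o) : 'D_(v, s) a (0, 0) = v *: X + s *: xi.
  pose l (q : R^o * R^o) : W := q.1 *: X + q.2 *: xi.
  have ll : linear l.
    move=> b p q; rewrite /l /= !scalerDl scalerDr addrACA.
    by rewrite -!scalerA.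
  pose L : {linear (R^o * R^o)%type -> W} :=
    HB.pack l (GRing.isLinear.Build _ _ _ _ l ll).
  have Lc : continuous L.
    move=> q; have := as_ 0%N q I; rewrite /a => ac.
    have -> : (L : _ -> W) = fun q => a q - x.
      by apply/funext => p; rewrite /a -[x + _ + _]addrA [x + _]addrC addrK.
    by apply: cvgB; [exact: ac|exact: cvg_cst].
  have -> : a = fun q => cst x q + L q by apply/funext => q; rewrite /a /= addrA.
  rewrite deriveD; [|exact: derivable_cst|].
    by rewrite derive_cst add0r derive_linear.
  by apply: diff_derivable; exact: linear_differentiable.
have da : differentiable a (0, 0) by have [da _] := as_ 1%N; exact: da.
have DG (v s : R^o) : 'D_(v, s) (Phi \o a) (0, 0) = 'D_(v *: X + s *: xi) Phi x.
  by rewrite derive_comp ?a0 // ?Da //; exact: dPhi.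
have B0 : 'D_(0, 1) (Phi \o a) (0, 0) != 0.
  by rewrite DG scale0r scale1r add0r.
have [h [N [Q [[oN N0 oQ QO] [Q0 h0 hs hN hu]]]]] :=
  implicit_exists (@findim_real R) oO Os O0 G0 B0.
pose c (t : R^o) : W := a (t, h t).
have cs k : Ck k N c.
  rewrite /c; apply: Ck_add => //; last by apply: Ck_scalel.
  apply: Ck_add => //; first exact: Ck_cst.
  apply: (@Ck_scalel R R^o W k N idfun) => //.
  exact: (@Ck_linear R R^o R^o k N idfun (fun x => cvg_id)).
have [e /= e0 eN] := (nbhs_normP (0 : R^o) _).1 (open_nbhs_nbhs (conj oN N0)).
have eN' t : `|t| < e -> N t.
  by move=> te; apply: eN; rewrite /ball_ /= sub0r normrN.
have csE : smooth_on [set t : R^o | `|t| < e] c.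
  by move=> k; apply: Ck_sub (cs k) => t; exact: eN'.
have Sc t : `|t| < e -> S (c t).
  move=> /eN'/hN[/QO Oc Gc]; apply/(SU _).2 => //; exact: Oc.
have dh : differentiable h 0 by have [dh _] := hs 1%N; exact: dh.
have c0 : c 0 = x by rewrite /c h0 a0.
exists e, c; split => //.
have dp : differentiable (fun t : R^o => (t, h t)) (0 : R^o).
  exact: differentiable_pair.
have Dc : 'D_(1 : R^o) c 0 = X + 'D_(1 : R^o) h 0 *: xi.
  rewrite /c (@derive_comp R R^o (R^o * R^o)%type W (fun t => (t, h t)) a) //.
    rewrite h0 [X in 'D_X a _](_ : _ = (1, 'D_(1 : R^o) h 0)); first by rewrite Da scale1r.
    by rewrite (@derive_pair R R^o R^o R^o idfun h) // derive_id.
  by rewrite h0.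
have := @derive_along_curve c e Phi e0 csE; rewrite c0 => /(_ (dPhi Ux)).
have nU : nbhs x U by exact: open_nbhs_nbhs.
have nP : \forall y \near x, S y -> Phi y = 0.
  by apply: filterS nU => y Uy /SU; apply.
move=> /(_ nP Sc); rewrite Dc deriveDv; last exact: dPhi.
rewrite X0 add0r deriveZv; last exact: dPhi.
by move=> /eqP; rewrite mulf_eq0 (negbTE b0) orbF => /eqP ->; rewrite scale0r addr0.
Qed.

(* Differentiating [dPhi (Yf) = 0] along a curve in the level set. *)
Lemma level_second_derivative (x X Y : W) (U1 : set W) (Yf : W -> W) :
  U x -> tangent_to S x X -> open U1 -> U1 x -> smooth_on U1 Yf ->
  (forall y, U1 y -> U y -> S y -> 'D_(Yf y) Phi y = 0) -> Yf x = Y ->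
  'D_('D_X Yf x) Phi x = - 'D_X ('D_Y Phi) x.
Proof.
move=> Ux [e [c [e0 cs c0 Sc ->]]] oU1 U1x Ys Yt YE.
have [s [b [l [lc lb]]]] := fW.
have dY : differentiable Yf x by have [dY _] := Ys 1%N; exact: dY.
have dDP v : differentiable ('D_v Phi) x.
  by have [_ /(_ v)[dDP _]] := Ps 2%N; exact: dDP.
have dl i : differentiable (l i \o Yf) x.
  by apply: differentiable_comp => //; exact: linear_differentiable.
(* The direction [Yf y] moves with [y], hence the expansion in the fixed directions [b i] before the
   product rule. *)
pose g y : R^o := \sum_i l i (Yf y) * 'D_(b i) Phi y.
have gE y : U y -> g y = 'D_(Yf y) Phi y.
  move=> Uy; rewrite /g [in RHS](lb (Yf y)) derive_sumv //; exact: dPhi.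
have dt i : differentiable (fun y => l i (Yf y) * 'D_(b i) Phi y : R^o) x.
  by apply: differentiableM; [exact: dl|exact: dDP].
have gsum : g = \sum_i (fun y => l i (Yf y) * 'D_(b i) Phi y : R^o).
  by apply/funext => y; rewrite fct_sumE.
have dg : differentiable g x by rewrite gsum; exact: differentiable_sum.
set Z := 'D_1 c 0.
have Dg : 'D_Z g x = 0.
  rewrite /Z -c0; apply: (derive_along_curve e0 cs _ _ Sc); rewrite c0 //.
  have nU : nbhs x U by exact: open_nbhs_nbhs.
  have nU1 : nbhs x U1 by exact: open_nbhs_nbhs.
  by apply: filterS2 nU nU1 => y Uy U1y Sy; rewrite gE // Yt.
have DgE : 'D_Z g x = 'D_('D_Z Yf x) Phi x + 'D_Z ('D_Y Phi) x.
  have -> : 'D_Z ('D_Y Phi) x = \sum_i l i Y * 'D_Z ('D_(b i) Phi) x.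
    have -> : 'D_Z ('D_Y Phi) x =
              'D_Z (\sum_i (fun y => l i Y *: 'D_(b i) Phi y : R^o)) x.
      apply: near_eq_derive.
      have nU : nbhs x U by exact: open_nbhs_nbhs.
      apply: filterS nU => y Uy; rewrite fct_sumE.
      by rewrite [in LHS](lb Y) derive_sumv //; exact: dPhi.
    rewrite derive_sum => [|i]; last first.
      by apply/diff_derivable/differentiableZ/dDP.
    by apply: eq_bigr => i _; rewrite deriveZ //; exact/diff_derivable/dDP.
  rewrite gsum derive_sum; last by move=> i; exact/diff_derivable/dt.
  rewrite [in X in _ = X + _](lb ('D_Z Yf x)) derive_sumv; last exact: dPhi.
  rewrite -big_split /=; apply: eq_bigr => i _.
  rewrite [LHS](@deriveM _ _ (l i \o Yf) ('D_(b i) Phi)); last 2 first.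
  - exact/diff_derivable/dl.
  - exact/diff_derivable/dDP.
  rewrite addrC /= YE; congr (_ + _).
  rewrite -[LHS]/('D_(b i) Phi x * 'D_Z (l i \o Yf) x) mulrC.
  rewrite derive_comp //; last exact: linear_differentiable.
  by rewrite derive_linear.
by apply/eqP; rewrite -addr_eq0 -DgE Dg.
Qed.

End LevelSet.

(** * Second fundamental form of a regular level set *)

Section SecondFundamentalForm.
Variables (R : realType) (n : nat).
Notation V := 'rV[R]_n.

(** Applying $d\Phi$ to the tangent vector $D_XY-h\xi$ gives $h\,D_\xi\Phi=d\Phi(D_XY)=-D_XD_Y\Phi$
    for every admissible extension of [Y]. So [h] does not depend on the extension, and exhibiting
    one extension makes the choice in the definition effective. *)
Lemma level_second_fundamental_form (S U : set V) (Phi : V -> R^o)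
    (x xi X Y : V) :
  open U -> smooth_on U Phi -> (forall y, U y -> (S y <-> Phi y = 0)) ->
  U x -> S x -> 'D_xi Phi x != 0 -> tangent_to S x X -> tangent_to S x Y ->
  second_fundamental_form S x xi X Y = - 'D_X ('D_Y Phi) x / 'D_xi Phi x.
Proof.
move=> oU Ps SU Ux Sx b0 SX SY.
have fV := @findim_row R n.
have dPhi y : U y -> differentiable Phi y.
  by move=> Uy; have [] := Ps 1%N => + _; exact.
have cD : {for x, continuous ('D_xi Phi)}.
  by have [_ /(_ xi)] := Ps 1%N; exact.
have nV : nbhs x (U `&` [set y | 'D_xi Phi y != 0]).
  by apply: filterI; [exact: open_nbhs_nbhs|exact: (cvgr_neq0 _ cD)].
have [N [oN Nx NP]] := nbhs_openP nV.
have tangent y Z : N y -> S y -> tangent_to S y Z <-> 'D_Z Phi y = 0.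
  by move=> /NP[Uy by_] Sy; exact: (@level_tangent R V fV S U Phi oU Ps SU y xi Z Uy Sy by_).
have DY : 'D_Y Phi x = 0 by apply/tangent.
apply: xget_unique.
  (* The constant field [Y] is corrected along [xi] so as to be tangent to all level sets of [Phi]
     near [x]. *)
  pose Yf y := Y - ('D_Y Phi y * ('D_xi Phi y)^-1) *: xi.
  have NU : N `<=` U by move=> y /NP[].
  have Ys : smooth_on N Yf.
    move=> k; apply: Ck_add => //; first exact: Ck_cst.
    apply: Ck_opp => //; apply: Ck_scalel => //; apply: Ck_mul => //.
      by have [_ /(_ Y)] := Ps k.+1; exact: Ck_sub.
    apply: Ck_inv => //; first by move=> y /NP[].
    by have [_ /(_ xi)] := Ps k.+1; exact: Ck_sub.
  have YT y : N y -> 'D_(Yf y) Phi y = 0.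
    move=> Ny; have [Uy by_] := NP _ Ny; have dy := dPhi _ Uy.
    rewrite /Yf deriveDv // deriveNv // deriveZv //.
    by rewrite -[_ *: 'D_xi Phi y]/(_ * 'D_xi Phi y) mulfVK // subrr.
  have YE : Yf x = Y by rewrite /Yf DY mul0r scale0r subr0.
  exists N, Yf; split => //.
    by split => // y Ny Sy; apply/tangent => //; exact: YT.
  apply/tangent => //; rewrite deriveDv ?deriveNv ?deriveZv; try exact: dPhi.
  rewrite (level_second_derivative fV oU Ps Ux SX oN Nx Ys _ YE); last first.
    by move=> y Ny _ _; exact: YT.
  by rewrite -[_ *: 'D_xi Phi x]/(_ * 'D_xi Phi x) mulfVK // subrr.
move=> h [U1 [Yf [oU1 U1x Ys [Yt YE] T]]].
have oU1N : open (U1 `&` N) by exact: openI.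
have Ys' : smooth_on (U1 `&` N) Yf.
  by move=> k; apply: Ck_sub (Ys k) => y [].
have E := @level_second_derivative _ _ fV S U Phi oU Ps x X Y
  (U1 `&` N) Yf Ux SX oU1N (conj U1x Nx) Ys'.
have {}E := E (fun y UN _ Sy => (tangent y (Yf y) UN.2 Sy).1 (Yt y UN.1 Sy)) YE.
move: T => /tangent - /(_ Nx Sx).
rewrite deriveDv ?deriveNv ?deriveZv; try exact: dPhi.
rewrite E => /eqP; rewrite subr_eq0 => /eqP ->.
by rewrite -[_ *: 'D_xi Phi x]/(_ * 'D_xi Phi x) mulfK.
Qed.

End SecondFundamentalForm.

(** * Convex cones and graphs of homogeneous functions *)

Lemma convex_setP (R : realType) (W : normedModType R) (A : set W) :
  convex_set A <-> forall x y (t : R), A x -> A y -> 0 <= t <= 1 ->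
    A (t *: x + (1 - t) *: y).
Proof.
split=> [cA x y t Ax Ay /andP[t0 t1]|cA x y t].
  have tI : Itv.spec (@Itv.num_sem R) (Itv.Real `[0%Z, 1%Z]) t.
    by rewrite /Itv.spec /= /Itv.num_sem /= in_itv /= t0 t1 num_real.
  have := cA x y (Itv.mk tI); rewrite !inE; apply => //.
rewrite !inE => Ax Ay; apply: cA => //.
by rewrite ge0 le1.
Qed.

Lemma findim_linear_continuous (R : realType) (V W : normedModType R)
    (l : {linear V -> W}) : findim V -> continuous l.
Proof.
move=> [s [e [k [kc ke]]]] x.
have -> : (l : V -> W) = fun v => \sum_i k i v *: l (e i).
  apply/funext => v; rewrite [in LHS](ke v) linear_sum.
  by apply: eq_bigr => i _; rewrite linearZ.
apply: (@Ck_sum R V W 0 setT s (fun i v => k i v *: l (e i)) openT _ x I) => i.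
by apply: Ck_scalel; [exact: openT|exact: Ck_linear].
Qed.

Lemma continuous_line (R : realType) (W : normedModType R) (x u : W) :
  continuous (fun t : R => x + t *: u).
Proof.
move=> t; apply: cvgD; first exact: cvg_cst.
by apply: cvgZr_tmp; exact: cvg_id.
Qed.

(** * Convex cones and the lines parallel to an interior vector *)

Section ConvexCone.
Variables (R : realType) (W : normedModType R) (A C : set W).
Variables (lam : {linear W -> R^o}) (T : W).
Hypothesis oA : open A.
Hypothesis cA : forall x y (t : R), A x -> A y -> 0 <= t <= 1 ->
  A (t *: x + (1 - t) *: y).
Hypothesis CE : C = (closure A `\` A°) `\` [set 0].
Hypothesis CZ : forall v (a : R), C v -> 0 < a -> C (a *: v).
Hypothesis lamA : forall v, A v -> 0 < lam v.
Hypothesis lamC : forall v, C v -> 0 < lam v.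
Hypothesis AT : A T.
Hypothesis lamT : lam T = 1.

Lemma cone_boundaryP v : C v <-> [/\ closure A v, ~ A v & v != 0].
Proof.
rewrite CE (_ : A° = A); last by apply/interior_id.
split=> [[[? ?] /eqP ?]//|[? ? /eqP ?]//].
Qed.

(** Scale invariance is given for the boundary only. A ray could leave the interior only through a
    boundary point, and scaling that point back would put [v] itself on the boundary; connectedness
    of the ray concludes. *)
Lemma interior_coneZ v (a : R) : A v -> 0 < a -> A (a *: v).
Proof.
move=> Av a0; have v0 : v != 0.
  by apply: contraTN (lamA Av) => /eqP ->; rewrite linear0 ltxx.
pose f (t : R) : W := t *: v.
have fc : continuous f by move=> t; apply: cvgZr_tmp; exact: cvg_id.
have cE (s : R) : 0 < s -> closure A (f s) -> A (f s).
  move=> s0 cs; apply: contrapT => nA.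
  have : C (s^-1 *: (s *: v)).
    apply: CZ; rewrite ?invr_gt0 //; apply/cone_boundaryP; split => //.
    by rewrite scaler_eq0 negb_or gt_eqF.
  by rewrite scalerA mulVf ?gt_eqF // scale1r => /cone_boundaryP[_ /(_ Av)].
have cI : connected [set s : R | 0 < s].
  apply/connected_intervalP => x y /= x0 _ z /andP[xz _].
  exact: lt_le_trans xz.
suff /seteqP[_ /(_ a a0)] : [set s : R | 0 < s /\ A (f s)] = [set s : R | 0 < s].
  by move=> [].
apply: cI.
- by exists 1; rewrite /= ltr01 /f scale1r.
- by exists (f @^-1` A) => //; apply: open_comp oA => ? _; exact: fc.
- exists (f @^-1` closure A).
    by apply: closed_comp; [move=> ? _; exact: fc|exact: closed_closure].
  apply/seteqP; split=> s /= [s0 As]; split => //; first exact: subset_closure.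
  exact: cE.
Qed.

Lemma interior_coneD u v : A u -> A v -> A (u + v).
Proof.
move=> Au Av.
have -> : u + v = 2 *: (2^-1 *: u + (1 - 2^-1) *: v).
  rewrite scalerDr !scalerA mulfV ?pnatr_eq0 // scale1r.
  by rewrite (_ : 2 * _ = 1) ?scale1r //; lra.
apply: interior_coneZ => //; apply: cA => //.
by rewrite invr_ge0 ler0n invf_le1 // ler1n.
Qed.

(** For [x] in [A] close to [u], the vector [v + (u - x)] is still in the open set [A], and its sum
    with [x] is [u + v]. *)
Lemma closure_coneD u v : closure A u -> A v -> A (u + v).
Proof.
move=> cu Av.
pose g (x : W) := v + (u - x).
have gc : {for u, continuous g}.
  by apply: cvgD; [exact: cvg_cst|apply: cvgB; [exact: cvg_cst|exact: cvg_id]].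
have nA : nbhs u (g @^-1` A).
  by apply: gc; rewrite /g subrr addr0; exact: open_nbhs_nbhs.
have [x [Ax Agx]] := cu _ nA.
have -> : u + v = x + g x by rewrite /g addrCA subrKC addrC.
exact: interior_coneD.
Qed.

Lemma closure_coneDD u v : closure A u -> closure A v -> closure A (u + v).
Proof.
move=> cu cv B nB.
have : {for 0, continuous (fun t : R => (u + v) + t *: T)}.
  exact: continuous_line.
rewrite /prop_for /continuous_at scale0r addr0 => /(_ B nB) /nbhs_normP[e /= e0 eB].
exists (u + v + (e / 2) *: T); split.
  rewrite -addrA; apply: closure_coneD => //; apply: closure_coneD => //.
  by apply: interior_coneZ; rewrite // divr_gt0.
apply: (eB (e / 2)); rewrite /ball_ /= sub0r normrN gtr0_norm ?divr_gt0 //.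
by rewrite ltr_pdivrMr // ltr_pMr // ltr1n.
Qed.

Lemma cone_line_neq0 u (t : R) : lam u = 0 -> u != 0 -> u + t *: T != 0.
Proof.
move=> lu u0; apply: contra_neq u0 => ut.
have : lam (u + t *: T) = 0 by rewrite ut linear0.
rewrite linearD linearZ /= lu lamT add0r -[_ *: 1]/(t * 1) mulr1 => t0.
by move: ut; rewrite t0 scale0r addr0.
Qed.

(** The line meets [A], because $T+\varepsilon u$ lies in this open cone, but misses it at [u],
    where [lam] vanishes. Without a boundary point, the trace of [A] on the line would be open and
    closed. *)
Lemma cone_line_ex u : lam u = 0 -> u != 0 -> exists t : R, C (u + t *: T).
Proof.
move=> lu u0; apply: contrapT => nC.
pose f (t : R) : W := u + t *: T.
have fc : continuous f by exact: continuous_line.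
have cI : connected [set: R] by apply/connected_intervalP.
suff /seteqP[_ /(_ 0 I)] : [set t : R | A (f t)] = setT.
  by rewrite /= /f scale0r addr0 => /lamA; rewrite lu ltxx.
apply: cI.
- have : {for 0, continuous (fun s : R => T + s *: u)} by exact: continuous_line.
  have nA : nbhs (T + 0 *: u) A.
    by rewrite scale0r addr0; exact: open_nbhs_nbhs.
  move=> /(_ A nA) /nbhs_normP[e /= e0 eA].
  have e2 : 0 < e / 2 by rewrite divr_gt0.
  exists (e / 2)^-1; rewrite /= /f.
  have -> : u + (e / 2)^-1 *: T = (e / 2)^-1 *: (T + (e / 2) *: u).
    by rewrite scalerDr scalerA mulVf ?gt_eqF // scale1r addrC.
  apply: interior_coneZ; rewrite ?invr_gt0 //; apply: eA.
  rewrite /ball_ /= sub0r normrN gtr0_norm //.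
  by rewrite ltr_pdivrMr // ltr_pMr // ltr1n.
- exists (f @^-1` A); last by rewrite setTI.
  by apply: open_comp oA => ? _; exact: fc.
- exists (f @^-1` closure A).
    by apply: closed_comp; [move=> ? _; exact: fc|exact: closed_closure].
  rewrite setTI; apply/seteqP; split=> t /= At; first exact: subset_closure.
  apply: contrapT => nA; apply: nC; exists t; apply/cone_boundaryP; split=> //.
  exact: cone_line_neq0.
Qed.

Lemma cone_line_interior u (t s : R) : C (u + t *: T) -> t < s -> A (u + s *: T).
Proof.
move=> /cone_boundaryP[ct _ _] ts.
have -> : u + s *: T = u + t *: T + (s - t) *: T.
  by rewrite -addrA -scalerDl subrKC.
by apply: closure_coneD => //; apply: interior_coneZ; rewrite // subr_gt0.
Qed.

Lemma cone_line_uniq u (t s : R) : C (u + t *: T) -> C (u + s *: T) -> t = s.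
Proof.
move=> Ct Cs; have [ts|st|//] := ltgtP t s.
  by have [] := (cone_boundaryP _).1 Cs; have := cone_line_interior Ct ts.
by have [] := (cone_boundaryP _).1 Ct; have := cone_line_interior Cs st.
Qed.

Lemma cone_line_gt0 u (t : R) : lam u = 0 -> C (u + t *: T) -> 0 < t.
Proof.
by move=> lu /lamC; rewrite linearD linearZ /= lu lamT add0r -[t *: 1]/(t * 1) mulr1.
Qed.

Lemma cone_line_closure u (t s : R) : C (u + t *: T) ->
  closure A (u + s *: T) -> t <= s.
Proof.
move=> Ct cs; rewrite leNgt; apply/negP => st.
have [_ + _] := (cone_boundaryP _).1 Ct; apply.
have -> : u + t *: T = u + s *: T + (t - s) *: T.
  by rewrite -addrA -scalerDl subrKC.
by apply: closure_coneD => //; apply: interior_coneZ; rewrite // subr_gt0.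
Qed.

Lemma cone_line_open u (t s : R) : C (u + t *: T) -> A (u + s *: T) -> t < s.
Proof.
move=> Ct As; rewrite lt_neqAle (cone_line_closure Ct) ?andbT; last first.
  exact: subset_closure.
by apply/eqP => ts; have [_ + _] := (cone_boundaryP _).1 Ct; rewrite ts.
Qed.

(* A curve in C leaving v in the direction a would enter v + A, hence A. *)
Lemma interior_not_tangent v a : C v -> A a -> ~ tangent_to C v a.
Proof.
move=> Cv Aa [e [c [e0 cs c0 Sc aE]]].
have [cv nAv v0] := (cone_boundaryP _).1 Cv.
have dc := smooth_curve0 e0 cs.
have [r /= r0 rA] := (nbhs_normP a _).1 (open_nbhs_nbhs (conj oA Aa)).
have r2 : 0 < r / 2 by rewrite divr_gt0.
have /nbhs_normP[d /= d0 dP] := differentiable_eps dc r2.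
pose h := Num.min (d / 2) (e / 2).
have h0 : 0 < h by rewrite lt_min !divr_gt0.
have hd : h < d.
  apply: (@le_lt_trans _ _ (d / 2)); first by rewrite ge_min lexx.
  by rewrite ltr_pdivrMr // ltr_pMr // ltr1n.
have he : h < e.
  apply: (@le_lt_trans _ _ (e / 2)); first by rewrite ge_min lexx orbT.
  by rewrite ltr_pdivrMr // ltr_pMr // ltr1n.
have := dP h; rewrite /ball_ /= sub0r normrN gtr0_norm // => /(_ hd).
rewrite addr0 c0 -(deriveE (h : R^o) dc).
have -> : 'D_h c 0 = h *: a.
  by rewrite aE -deriveZv // -[h *: 1]/(h * 1) mulr1.
move=> ch; have := Sc h; rewrite gtr0_norm // => /(_ he) /cone_boundaryP[_ + _].
apply; rewrite -[c h](subrKC v); apply: closure_coneD => //.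
have -> : c h - v = h *: (h^-1 *: (c h - v)).
  by rewrite scalerA mulfV ?gt_eqF // scale1r.
apply: interior_coneZ => //; apply: rA; rewrite /ball_ /= distrC.
have -> : h^-1 *: (c h - v) - a = h^-1 *: (c h - v - h *: a).
  by rewrite [RHS]scalerBr [X in _ = _ - X]scalerA mulVf ?gt_eqF // scale1r.
rewrite normrZ gtr0_norm ?invr_gt0 // mulrC ltr_pdivrMr //.
by apply: le_lt_trans ch _; rewrite ltr_pM2r // ltr_pdivrMr // ltr_pMr // ltr1n.
Qed.

End ConvexCone.

Section DeriveInvariance.
Local Transparent derive.
Variables (R : realType) (V W : normedModType R).

(** The difference quotients coincide, whether or not [f] is differentiable; this is why it can be
    iterated without side conditions in [derive2_sqr_graphT]. *)
Lemma derive_translate (f : V -> W) (v w u : V) :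
  (forall x, f (x + w) = f x) -> 'D_u f (v + w) = 'D_u f v.
Proof.
move=> fw; rewrite /derive.
have -> // : (fun h : R => h^-1 *: ((f \o shift (v + w)) (h *: u) - f (v + w))) =
             (fun h : R => h^-1 *: ((f \o shift v) (h *: u) - f v)).
by apply/funext => h /=; rewrite addrA !fw.
Qed.

End DeriveInvariance.

Local Opaque derive.

(** Meant for [b] $=df(u)$, [p] $=f$ and [q] the Hessian of $f$ on [u]: the product rule gives the
    second derivative of $f^2$ in this form. *)
Lemma sqr_add_mul_gt0 (R : realFieldType) (p q b : R) : 0 < p -> 0 <= q ->
  (b = 0 -> q = 0 -> False) -> 0 < 2 * (b ^+ 2 + p * q).
Proof.
move=> p0 q0 bq; have pq : 0 <= p * q by rewrite mulr_ge0 // ltW.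
have b2 := sqr_ge0 b; rewrite pmulr_rgt0 // lt_neqAle addr_ge0 // andbT eq_sym.
apply/negP; rewrite paddr_eq0 // sqrf_eq0 mulf_eq0 (gt_eqF p0) /=.
by case/andP => /eqP /bq + /eqP; exact.
Qed.

Lemma quadratic_ge0_linear_eq0 (R : realFieldType) (b c : R) :
  (forall t, 0 <= t * (2 * b) + t ^+ 2 * c) -> b = 0.
Proof.
move=> H; have [c0|c0] := leP c 0.
  have := H 1; have := H (-1); rewrite expr1n sqrrN expr1n => h1 h2; lra.
(* For positive [c] this is the minimum, with value $-b^2/c$. *)
have := H (- b / c).
have -> : - b / c * (2 * b) + (- b / c) ^+ 2 * c = - (b ^+ 2 / c).
  by field; rewrite gt_eqF.
rewrite oppr_ge0 pmulr_lle0 ?invr_gt0 // => b2.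
by apply/eqP; rewrite -sqrf_eq0 eq_le b2 sqr_ge0.
Qed.

(** Degenerate Cauchy-Schwarz: if $B(X,Y)$ were nonzero for a null vector $X$, the form would be
    negative at some $X+tY$. It links the strong cone condition, which speaks of the radical, with
    the diagonal values of the Hessian. *)
Lemma psd_radical (R : realFieldType) (W : lmodType R) (B : W -> W -> R)
    (P : W -> Prop) :
  (forall X Y t, B (X + t *: Y) (X + t *: Y) =
     B X X + (t * (2 * B X Y) + t ^+ 2 * B Y Y)) ->
  (forall X Y t, P X -> P Y -> P (X + t *: Y)) ->
  (forall X, P X -> 0 <= B X X) ->
  forall X Y, P X -> P Y -> B X X = 0 -> B X Y = 0.
Proof.
move=> BE PL psd X Y PX PY BX0.
apply: (@quadratic_ge0_linear_eq0 R _ (B Y Y)) => t.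
by have := psd _ (PL X Y t PX PY); rewrite BE BX0 add0r.
Qed.

(** * Positively homogeneous functions invariant along [T] *)

Section ConeGraph.
Variables (R : realType) (W : normedModType R) (lam : {linear W -> R^o}) (T : W).
Variable f : W -> R^o.
Hypothesis fW : findim W.
Hypothesis lamT : lam T = 1.
Let pi (w : W) : W := w - lam w *: T.
(** The complement of the axis $\mathbb RT$. The function [f] stands for $F\circ\pi$ on a whole
    fibre, smooth only off this axis. *)
Let D : set W := [set w | pi w != 0].
Hypothesis fT : forall w (c : R), f (w + c *: T) = f w.
Hypothesis fZ : forall w (a : R), 0 < a -> f (a *: w) = a * f w.
Hypothesis fs : smooth_on D f.
Hypothesis f_gt0 : forall w, D w -> 0 < f w.

Lemma projE w : w = pi w + lam w *: T. Proof. by rewrite subrK. Qed.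

Lemma linear_proj : linear pi.
Proof.
move=> a u v; rewrite /pi linearP /= scalerDl -[a *: lam u]/(a * lam u) -scalerA.
by rewrite scalerBr opprD addrACA.
Qed.

Lemma form_proj w : lam (pi w) = 0.
Proof. by rewrite /pi linearB linearZ /= lamT -[_ *: 1]/(_ * 1) mulr1 subrr. Qed.

Lemma fproj w : f (pi w) = f w. Proof. by rewrite [in RHS](projE w) fT. Qed.

Lemma projZ (a : R) w : pi (a *: w) = a *: pi w.
Proof. by rewrite -[a *: w]addr0 linear_proj /pi linear0 scale0r subr0 addr0. Qed.

Lemma projD u w : pi (u + w) = pi u + pi w.
Proof. by rewrite /pi linearD scalerDl opprD addrACA. Qed.

Lemma projT : pi T = 0. Proof. by rewrite /pi lamT scale1r subrr. Qed.

Lemma open_projD : open D.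
Proof.
have lc := @findim_linear_continuous _ _ _ lam fW.
have pc : continuous pi.
  move=> w; apply: cvgB; first exact: cvg_id.
  by apply: cvgZr_tmp; exact: lc.
rewrite openE => w Dw; exact: (cvgr_neq0 _ (pc w)).
Qed.

Lemma projDZ w (a : R) : 0 < a -> D w -> D (a *: w).
Proof. by move=> a0; rewrite /D /= projZ scaler_eq0 negb_or gt_eqF. Qed.

Lemma projDT w (c : R) : D w -> D (w + c *: T).
Proof. by rewrite /D /= projD projZ projT scaler0 addr0. Qed.

Let df w : D w -> differentiable f w.
Proof. by move=> Dw; have [] := fs 1%N => + _; exact. Qed.

Let dDf u w : D w -> differentiable ('D_u f) w.
Proof. by move=> Dw; have [_ /(_ u)[+ _]] := fs 2%N; exact. Qed.

Lemma graph_f0 : f 0 = 0.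
Proof.
have := fZ 0 (ltr0n R 2); rewrite scaler0 => /eqP; rewrite mulr2n mulrDl mul1r.
by rewrite -subr_eq0 opprD addrA subrr add0r oppr_eq0 => /eqP.
Qed.

Lemma graph_f_ge0 w : 0 <= f w.
Proof.
have [w0|] := eqVneq (pi w) 0; first by rewrite -fproj w0 graph_f0.
by move=> Dw; exact/ltW/f_gt0.
Qed.

Lemma derive_graphT u w (c : R) : 'D_u f (w + c *: T) = 'D_u f w.
Proof. by apply: derive_translate => x; exact: fT. Qed.

Lemma derive_along_line (X : normedModType R) (g : W -> X) w u (h : R -> X) :
  differentiable g w -> (\forall t \near (0 : R), g (w + t *: u) = h t) ->
  'D_u g w = 'D_(1 : R) h 0.
Proof.
move=> dg gh; have dg0 : differentiable g (w + (0 : R) *: u).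
  by rewrite scale0r addr0.
have := is_derive_line dg0; rewrite scale0r addr0 => -[_ <-].
exact: near_eq_derive.
Qed.

Lemma derive_invariant (X : normedModType R) (g : W -> X) w u :
  differentiable g w -> (forall c : R, g (w + c *: u) = g w) -> 'D_u g w = 0.
Proof.
move=> dg gT; rewrite (@derive_along_line _ g w u (cst (g w))) ?derive_cst //.
by near do exact: gT.
Unshelve. all: by end_near.
Qed.

Lemma near_scale : \forall t \near (0 : R), 0 < 1 + t :> R.
Proof.
have c : {for (0 : R), continuous (fun t : R => 1 + t)}.
  by apply: cvgD; [exact: cvg_cst|exact: cvg_id].
by apply: (cvgr_gt _ c); rewrite addr0.
Qed.

Lemma euler w : D w -> 'D_w f w = f w.
Proof.
move=> Dw; rewrite (@derive_along_line _ f w w (fun t => f w + t * f w)).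
- rewrite deriveD // derive_cst add0r deriveM // derive_cst scaler0 add0r derive_id.
    exact: mulr1.
- exact: df.
- apply: filterS near_scale => t t0.
  by rewrite -[X in X + _]scale1r -scalerDl fZ // mulrDl mul1r.
Qed.

Lemma derive_graphZ u w (a : R) : D w -> 0 < a -> 'D_u f (a *: w) = 'D_u f w.
Proof.
move=> Dw a0; have Daw := projDZ a0 Dw.
have dZ : differentiable (fun x : W => a *: x) w by exact: differentiableZ.
have /(_ u) E := derive_comp _ dZ (df Daw).
have := E.
rewrite (_ : f \o _ = fun x => a *: f x); last by apply/funext => x /=; rewrite fZ.
rewrite deriveZ; last by apply/diff_derivable/df.
rewrite (_ : 'D_u (fun x => a *: x) w = a *: u); last by rewrite deriveZ // derive_id.
rewrite deriveZv; last exact: df.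
by move/(scalerI (lt0r_neq0 a0)).
Qed.

Lemma derive2_graph_euler u w : D w -> 'D_w ('D_u f) w = 0.
Proof.
move=> Dw; rewrite (@derive_along_line _ ('D_u f) w w (cst ('D_u f w))).
- exact: derive_cst.
- exact: dDf.
- apply: filterS near_scale => t t0.
  by rewrite -[X in X + _]scale1r -scalerDl derive_graphZ.
Qed.

Lemma derive2_graphC u v w : D w -> 'D_u ('D_v f) w = 'D_v ('D_u f) w.
Proof. by move=> Dw; apply: (deriveC v u open_projD _ Dw); exact: fs. Qed.

Lemma derive2_graph_vertical u w : D w -> 'D_T ('D_u f) w = 0.
Proof.
move=> Dw; apply: derive_invariant; first exact: dDf.
by move=> c; exact: derive_graphT.
Qed.

(** By homogeneity [w], and by invariance [T], lie in the radical of the Hessian at [w], which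
    therefore only sees vectors modulo these two. *)
Lemma derive2_graph_shift u w (r s : R) : D w ->
  'D_(u + r *: w + s *: T) ('D_(u + r *: w + s *: T) f) w = 'D_u ('D_u f) w.
Proof.
move=> Dw.
have E v : 'D_(u + r *: w + s *: T) ('D_v f) w = 'D_u ('D_v f) w.
  rewrite !deriveDv ?deriveZv; try exact: dDf.
  by rewrite derive2_graph_euler // derive2_graph_vertical // !scaler0 !addr0.
by rewrite E derive2_graphC // E.
Qed.

Lemma derive_graph_sqr u w : D w -> 'D_u (fun x => f x ^+ 2 : R^o) w = 2 * f w * 'D_u f w.
Proof.
move=> Dw; rewrite (_ : (fun x => f x ^+ 2 : R^o) = f * f); last first.
  by apply/funext => x; rewrite expr2.
rewrite deriveM; try exact/diff_derivable/df.
by rewrite -mulr2n -mulrA mulr2n mulrDl mul1r.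
Qed.

Lemma derive2_graph_sqr u w : D w -> 'D_u ('D_u (fun x => f x ^+ 2 : R^o)) w =
  2 * ('D_u f w ^+ 2 + f w * 'D_u ('D_u f) w).
Proof.
move=> Dw.
have nD : nbhs w D by apply: open_nbhs_nbhs; split => //; exact: open_projD.
rewrite (@near_eq_derive _ _ _ _ (fun x => 2 *: (f x * 'D_u f x : R^o))); last first.
  by apply: filterS nD => x Dx; rewrite derive_graph_sqr // -mulrA.
rewrite deriveZ; last first.
  by apply: derivableM; apply: diff_derivable; [exact: df|exact: dDf].
rewrite (@deriveM _ _ f ('D_u f)); last 2 first.
- exact/diff_derivable/df.
- exact/diff_derivable/dDf.
by rewrite -[_ *: _ in LHS]/(2 * _) addrC expr2.
Qed.

Lemma derive2_graph_quadratic w X Y (t : R) : D w ->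
  'D_(X + t *: Y) ('D_(X + t *: Y) f) w =
  'D_X ('D_X f) w + (t * (2 * 'D_X ('D_Y f) w) + t ^+ 2 * 'D_Y ('D_Y f) w).
Proof.
move=> Dw; have [Z ZE] : exists Z, Z = X + t *: Y by eexists.
have E U : 'D_Z ('D_U f) w = 'D_X ('D_U f) w + t * 'D_Y ('D_U f) w.
  by rewrite ZE (deriveDv _ _ (dDf U Dw)) (deriveZv _ _ (dDf U Dw)).
have real_eq (z xz yz xx xy yx yy : R) : z = xz + t * yz -> xz = xx + t * yx ->
    yz = xy + t * yy -> yx = xy -> z = xx + (t * (2 * xy) + t ^+ 2 * yy).
  by move=> -> -> -> ->; ring.
have EX := etrans (derive2_graphC X Z Dw) (E X).
have EY := etrans (derive2_graphC Y Z Dw) (E Y).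
by rewrite -ZE; exact: (real_eq _ _ _ _ _ _ _ (E Z) EX EY (derive2_graphC Y X Dw)).
Qed.

(** The last two hypotheses are the strong cone condition expressed through [f]. If both terms of
    $df(u)^2+fQ(u,u)$ vanished, [u] itself would be a tangent null vector, hence a multiple $av$;
    then $0=\lambda(u)=a\,f(v)$ would give $u=0$. *)
Lemma graph_hessian_sqr_gt0 v u : D v -> lam v = f v -> lam u = 0 -> u != 0 ->
  (forall X, lam X = 'D_X f v -> 0 <= 'D_X ('D_X f) v) ->
  (forall X, lam X = 'D_X f v ->
     (forall Y, lam Y = 'D_Y f v -> 'D_X ('D_Y f) v = 0) ->
     exists a : R, X = a *: v) ->
  0 < 'D_u ('D_u (fun x => f x ^+ 2 : R^o)) v.
Proof.
move=> Dv lv lu u0 psd rad; rewrite (derive2_graph_sqr u Dv).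
have fv := f_gt0 Dv; set d := 'D_u f v.
have DfT : 'D_T f v = 0 by apply: derive_invariant => //; exact: df.
(* The tangent vector of the graph that projects to [u]; the summand with coefficient 0 matches the
   shape of [derive2_graph_shift]. *)
have [X XE] : exists X, X = u + 0 *: v + d *: T by eexists.
have QX : 'D_X ('D_X f) v = 'D_u ('D_u f) v by rewrite XE; exact: derive2_graph_shift.
have lX : lam X = 'D_X f v.
  rewrite XE scale0r addr0 linearD linearZ /= lu lamT add0r -[d *: 1]/(d * 1).
  rewrite mulr1 deriveDv ?deriveZv; try exact: df.
  by rewrite DfT scaler0 addr0.
have Q0 : 0 <= 'D_u ('D_u f) v by rewrite -QX; exact: psd lX.
apply: (sqr_add_mul_gt0 fv Q0) => d0 Quu.
have [a aX] : exists a : R, X = a *: v.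
  apply: (rad X lX) => Y lY.
  apply: (@psd_radical R W (fun X Y => 'D_X ('D_Y f) v)
            (fun X => lam X = 'D_X f v)) lX lY _.
  - by move=> A B t; exact: derive2_graph_quadratic.
  - move=> A B t lA lB; rewrite linearD linearZ lA lB.
    by rewrite (deriveDv _ _ (df Dv)) (deriveZv _ _ (df Dv)).
  - exact: psd.
  - by rewrite QX.
move: aX; rewrite XE scale0r addr0 d0 scale0r addr0 => uE.
have /eqP : a * lam v = 0 by rewrite -lu uE linearZ.
rewrite lv mulf_eq0 (gt_eqF fv) orbF => /eqP a0.
by move: u0; rewrite uE a0 scale0r eqxx.
Qed.

Lemma derive2_sqr_graphT u w (c : R) :
  'D_u ('D_u (fun x => f x ^+ 2 : R^o)) (w + c *: T) =
  'D_u ('D_u (fun x => f x ^+ 2 : R^o)) w.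
Proof.
apply: derive_translate => x; apply: derive_translate => y.
by rewrite fT.
Qed.

Lemma graph_hessian_ge0 v X : D v ->
  (forall u, lam u = 0 -> u != 0 ->
     0 < 'D_u ('D_u (fun x => f x ^+ 2 : R^o)) v) ->
  0 <= 'D_X ('D_X f) v /\
  ('D_X ('D_X f) v = 0 -> exists r : R, pi X = r *: pi v).
Proof.
move=> Dv pos; have fv := f_gt0 Dv.
(* The coefficient [r] makes $df(u)=0$, so that the second derivative of $f^2$ along [u] is $2f$
   times the Hessian and its positivity passes to the Hessian. Removing multiples of [v] and [T]
   from [X] does not change the Hessian. *)
pose r := 'D_X f v / f v; pose u := pi X - r *: pi v.
have DfT : 'D_T f v = 0 by apply: derive_invariant => //; exact: df.
have Dpi Y : 'D_(pi Y) f v = 'D_Y f v.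
  rewrite /pi deriveDv ?deriveNv ?deriveZv; try exact: df.
  by rewrite DfT scaler0 subr0.
have Du : 'D_u f v = 0.
  rewrite /u deriveDv ?deriveNv ?deriveZv; try exact: df.
  rewrite !Dpi euler // -[r *: f v]/(r * f v) /r divfK ?gt_eqF //.
  exact: subrr.
have XE : X = u + r *: v + (lam X - r * lam v) *: T.
  rewrite /u /pi scalerBr scalerA opprB scalerBl -[_ + (_ - _) + r *: v]addrA.
  by rewrite subrK addrACA subrK subrr addr0.
have QX : 'D_X ('D_X f) v = 'D_u ('D_u f) v.
  by rewrite {1 2}XE derive2_graph_shift.
have lu : lam u = 0.
  by rewrite /u linearB linearZ /= !form_proj -[r *: 0]/(r * 0) mulr0 subr0.
have [u0|u0] := eqVneq u 0.
  have -> : 'D_X ('D_X f) v = 0.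
    by rewrite QX u0 derive0.
  by split=> [|_]; [exact: lexx|exists r; apply/subr0_eq; exact: u0].
have real_gt0 (g d q : R) : 0 < g -> g = 2 * (d ^+ 2 + f v * q) -> d = 0 -> 0 < q.
  by move=> g0 gE d0; move: g0; rewrite gE d0 expr0n /= add0r !pmulr_rgt0.
have Qp := real_gt0 _ _ _ (pos u lu u0) (derive2_graph_sqr u Dv) Du.
rewrite -QX in Qp; split; first exact: ltW.
by move=> Q0; rewrite Q0 ltxx in Qp.
Qed.

Hypothesis f_convex : forall w X, D w -> 0 <= 'D_X ('D_X f) w.

(** By homogeneity this is midpoint convexity. The mean values of $D_uf$ on the two halves of the
    segment are compared by a third mean value, of $D_uD_uf\ge0$. *)
Lemma graph_midpoint x y : (forall t : R, 0 <= t <= 1 -> D (x + t *: (y - x))) ->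
  f (x + y) <= f x + f y.
Proof.
move=> Dxy; pose u := y - x; pose m := x + 2^-1 *: u.
have h0 : 0 < 2^-1 :> R by rewrite invr_gt0.
have d1 (t : R) : 0 <= t <= 2^-1 -> differentiable f (x + t *: u).
  by move=> /andP[t0 t1]; apply/df/Dxy; apply/andP; split; lra.
have mE t : m + t *: u = x + (2^-1 + t) *: u by rewrite /m -addrA -scalerDl.
have d2 (t : R) : 0 <= t <= 2^-1 -> differentiable f (m + t *: u).
  by move=> /andP[t0 t1]; rewrite mE; apply/df/Dxy; apply/andP; split; lra.
have [t1 /andP[t10 t1h] E1] := mean_value_line h0 d1.
have [t2 /andP[t20 t2h] E2] := mean_value_line h0 d2.
have s0 : 0 < 2^-1 + t2 - t1 by lra.
have pE t : x + t1 *: u + t *: u = x + (t1 + t) *: u by rewrite -addrA -scalerDl.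
have d3 (t : R) : 0 <= t <= 2^-1 + t2 - t1 ->
    differentiable ('D_u f) (x + t1 *: u + t *: u).
  by move=> /andP[t0 t3]; rewrite pE; apply/dDf/Dxy; apply/andP; split; lra.
have [t3 /andP[t30 t3h] E3] := mean_value_line s0 d3.
have Q3 : 0 <= 'D_u ('D_u f) (x + t1 *: u + t3 *: u).
  by apply: f_convex; rewrite pE; apply: Dxy; apply/andP; split; lra.
have yE : m + 2^-1 *: u = y.
  by rewrite mE (_ : 2^-1 + 2^-1 = 1) ?scale1r ?subrKC //; lra.
rewrite yE mE in E2; rewrite -/m in E1.
rewrite pE subrKC in E3.
have -> : x + y = 2 *: m.
  rewrite /m scalerDr scalerA mulfV // scale1r scaler_nat mulr2n /u.
  by rewrite -addrA subrKC.
rewrite fZ //.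
have real_le (p q w a b c t : R) : p - q = 2^-1 * a -> w - p = 2^-1 * b ->
    b - a = t * c -> 0 < t -> 0 <= c -> 2 * p <= q + w.
  move=> e1 e2 e3 t_gt0 c0.
  have ab : 0 <= b - a by rewrite e3 mulr_ge0 // ltW.
  lra.
exact: real_le E1 E2 E3 s0 Q3.
Qed.

(** The Hessian only controls segments that miss the axis. If a segment hits it, the projections of
    its endpoints lie on opposite rays or one of them vanishes, and the inequality follows from
    homogeneity and $f\ge0$. *)
Lemma graph_subadditive x y : f (x + y) <= f x + f y.
Proof.
have [Dxy|] := pselect (forall t : R, 0 <= t <= 1 -> D (x + t *: (y - x))).
  exact: graph_midpoint.
move=> /existsNP[t /not_implyP[/andP[t0 t1] /negP]].
rewrite /D /= negbK projD projZ => /eqP E.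
rewrite -(fproj (x + y)) projD -(fproj x) -(fproj y).
have {}E : (1 - t) *: pi x + t *: pi y = 0.
  apply: etrans E; rewrite projD -[- x]scaleN1r projZ.
  move: (pi x) (pi y) => p q.
  by rewrite scaleN1r scalerBl scale1r scalerBr addrAC addrA.
have [t00|tn0] := eqVneq t 0.
  move: E; rewrite t00 subr0 scale1r scale0r addr0 => ->.
  by rewrite add0r graph_f0 add0r.
have tp : 0 < t by rewrite lt_neqAle eq_sym tn0.
pose a := (1 - t) / t.
have a0 : 0 <= a by rewrite divr_ge0 // subr_ge0.
have yE : pi y = - (a *: pi x).
  apply/eqP; rewrite -addr_eq0; apply/eqP.
  apply: (scalerI tn0); rewrite scaler0 scalerDr scalerA /a.
  by rewrite mulrCA mulfV // mulr1 addrC.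
move: (pi x) yE => p ->.
have [a00|an0] := eqVneq a 0.
  by rewrite a00 scale0r oppr0 graph_f0 !addr0.
have ap : 0 < a by rewrite lt_neqAle eq_sym an0.
rewrite -scalerN fZ // scalerN -{1}[p]scale1r -scalerBl.
have h1 := graph_f_ge0 p; have h2 := graph_f_ge0 (- p).
have [a1|a1|a1] := ltgtP a 1.
- by rewrite fZ ?subr_gt0 //; nra.
- have -> : (1 - a) *: p = (a - 1) *: (- p) by rewrite scalerN -scaleNr opprB.
  by rewrite fZ ?subr_gt0 //; nra.
- by rewrite a1 subrr scale0r graph_f0 addr_ge0 // mul1r.
Qed.

End ConeGraph.

(** * Coordinates on the tangent bundle *)

Section ManifoldCharts.
Variables (R : realType) (n : nat) (M : manifold R n).
Notation V := 'rV[R]_n.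
Notation TM := (tangent_bundle M).
Implicit Types (phi psi : chart R n M) (p : M).

Definition chart_img phi : set V := phi @` chart_dom phi.

Lemma open_chart_img phi : open (chart_img phi).
Proof. exact: chart_img_open. Qed.

Lemma chart_img_inv phi x : chart_img phi x ->
  chart_dom phi (chart_inv phi x) /\ phi (chart_inv phi x) = x.
Proof. by move=> [p pd <-]; rewrite chart_mapK. Qed.

Lemma mem_chart_img phi p : chart_dom phi p -> chart_img phi (phi p).
Proof. by move=> pd; exists p. Qed.

Lemma open_overlap phi psi : open (phi @` (chart_dom phi `&` chart_dom psi)).
Proof.
have -> : phi @` (chart_dom phi `&` chart_dom psi) =
          chart_img phi `&` chart_inv phi @^-1` chart_dom psi.
  apply/seteqP; split => [_ [p [pd qd] <-]|x [[p pd <-] /= qd]].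
    by split; [exact: mem_chart_img|rewrite /= chart_mapK].
  by rewrite chart_mapK // in qd; exists p.
apply: open_preimage_within; [exact: open_chart_img|exact: chart_dom_open|].
by move=> x; exact: chart_inv_continuous.
Qed.

Lemma differentiable_transition phi psi p : atlas phi -> atlas psi ->
  chart_dom phi p -> chart_dom psi p -> differentiable (transition phi psi) (phi p).
Proof.
move=> aphi apsi pd qd; have [+ _] := atlas_compatible aphi apsi 1%N.
by apply; exists p.
Qed.

Lemma transitionK phi psi p : chart_dom phi p -> chart_dom psi p ->
  \forall x \near phi p, (transition psi phi \o transition phi psi) x = x.
Proof.
move=> pd qd.
have : nbhs (phi p) (phi @` (chart_dom phi `&` chart_dom psi)).
  by apply: open_nbhs_nbhs; split; [exact: open_overlap|exists p].
apply: filterS => _ [q [qphi qpsi] <-].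
by rewrite /= /transition /= !chart_mapK.
Qed.

Lemma derive_transitionK phi psi p v : atlas phi -> atlas psi ->
  chart_dom phi p -> chart_dom psi p ->
  'd (transition psi phi) (psi p) ('d (transition phi psi) (phi p) v) = v.
Proof.
move=> aphi apsi pd qd.
have d1 := differentiable_transition aphi apsi pd qd.
have tE : transition phi psi (phi p) = psi p by rewrite /transition /= chart_mapK.
have d2 := differentiable_transition apsi aphi qd pd.
rewrite -tE in d2 *.
have E := near_eq_derive v (transitionK pd qd).
rewrite [LHS](derive_comp v d1 d2) derive_id in E.
by rewrite -[RHS]E [RHS](deriveE _ d2) (deriveE v d1).
Qed.

Lemma tcoordK phi p : atlas phi -> chart_dom phi p ->
  cancel (tcoord phi p) (tvec phi p).
Proof.
move=> aphi pd v; apply: derive_transitionK => //; first exact: chart_at_atlas.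
exact: mem_chart_at.
Qed.

Lemma tvecK phi p : atlas phi -> chart_dom phi p ->
  cancel (tvec phi p) (tcoord phi p).
Proof.
move=> aphi pd v; apply: derive_transitionK => //; first exact: chart_at_atlas.
exact: mem_chart_at.
Qed.

Lemma tvec_linear phi p : linear (tvec phi p).
Proof. by move=> a u v; rewrite /tvec linearP. Qed.

Lemma tvec_chart_at p v : tvec (chart_at p) p v = v.
Proof.
rewrite /tvec; have pd := mem_chart_at p; have pa := chart_at_atlas p.
have E : \forall x \near chart_at p p,
    transition (chart_at p) (chart_at p) x = id x.
  have : nbhs (chart_at p p) (chart_img (chart_at p)).
    by apply: open_nbhs_nbhs; split; [exact: open_chart_img|exact: mem_chart_img].
  by apply: filterS => _ [q qd <-]; rewrite /transition /= chart_mapK.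
rewrite -(deriveE v (differentiable_transition pa pa pd pd)).
by rewrite (near_eq_derive v E) derive_id.
Qed.

Lemma TVec_eq (u v : TM) : base u = base v -> vec u = vec v :> V -> u = v.
Proof. by case: u v => [p u] [q v] /= pq; subst q => ->. Qed.

Lemma tchartK phi (u : TM) : atlas phi -> chart_dom phi (base u) ->
  tchart_inv phi (tchart phi u) = u.
Proof.
move=> aphi ud; apply: TVec_eq => /=; first by rewrite chart_mapK.
by rewrite chart_mapK // tcoordK.
Qed.

Lemma tchart_invK phi (y : V * V) : atlas phi -> chart_img phi y.1 ->
  tchart phi (tchart_inv phi y) = y.
Proof.
case: y => x w aphi /= /chart_img_inv[xd xE].
by rewrite /tchart /= xE tvecK.
Qed.

Lemma timageP phi (S : set TM) (y : V * V) : atlas phi ->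
  timage phi S y <-> chart_img phi y.1 /\ S (tchart_inv phi y).
Proof.
move=> aphi; split=> [[u [Su ud] <-]|[yd Sy]].
  by split; [exact: mem_chart_img|rewrite tchartK].
exists (tchart_inv phi y); last exact: tchart_invK.
by split => //; exact: (chart_img_inv yd).1.
Qed.

Lemma timage_chart_at p (S : set TM) w :
  timage (chart_at p) S (chart_at p p, w) <-> fiber S p w.
Proof.
have pd := mem_chart_at p; have pa := chart_at_atlas p.
rewrite timageP // /fiber /=.
have -> : tchart_inv (chart_at p) (chart_at p p, w) = TVec (w : tangent_space p).
  apply: TVec_eq => /=; first by rewrite chart_mapK.
  by rewrite chart_mapK // tvec_chart_at.
by split=> [[]|Sw] //; split => //; exact: mem_chart_img.
Qed.

Lemma tchart_inv_at p (w : V) :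
  tchart_inv (chart_at p) (chart_at p p, w) = TVec (w : tangent_space p).
Proof.
have pd := mem_chart_at p.
apply: TVec_eq => /=; first by rewrite chart_mapK.
by rewrite chart_mapK // tvec_chart_at.
Qed.

Lemma vec_tchart_inv_eq0 phi (y : V * V) : atlas phi -> chart_img phi y.1 ->
  (vec (tchart_inv phi y) == 0 :> V) = (y.2 == 0).
Proof.
case: y => x w aphi /= /chart_img_inv[xd _].
have inj := can_inj (tvecK aphi xd).
by rewrite -[RHS](inj_eq inj) [tvec _ _ 0]linear0.
Qed.

Variables (Om : one_form M) (T : vector_field M).
Hypothesis OmT : forall p, Om p (T p) = 1.

Definition form_in phi (x w : V) : R^o :=
  Om (chart_inv phi x) (tvec phi (chart_inv phi x) w).
Definition field_in phi (x : V) : V :=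
  tcoord phi (chart_inv phi x) (T (chart_inv phi x)).
Definition proj_in phi (x w : V) : V := w - form_in phi x w *: field_in phi x.

Lemma form_in_linear phi x : linear (form_in phi x).
Proof. by move=> a u v; rewrite /form_in tvec_linear linearP. Qed.

Lemma form_in_field phi x : atlas phi -> chart_img phi x ->
  form_in phi x (field_in phi x) = 1.
Proof.
by move=> aphi /chart_img_inv[xd _]; rewrite /form_in /field_in tcoordK.
Qed.

Lemma proj_ker_in phi (y : V * V) : atlas phi -> chart_img phi y.1 ->
  proj_ker Om T (tchart_inv phi y) = tchart_inv phi (y.1, proj_in phi y.1 y.2).
Proof.
case: y => x w aphi /= /chart_img_inv[xd _]; apply: TVec_eq => //=.
rewrite /proj_in [tvec _ _ (_ - _)]linearB [X in _ = _ - X]linearZ /=.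
by rewrite -/(tvec _ _ _) -/(tvec _ _ _) /form_in /field_in tcoordK.
Qed.

Lemma smooth_field_in phi : atlas phi -> smooth_on (chart_img phi) (field_in phi).
Proof. exact: field_smooth. Qed.

Lemma open_chart_imgX phi : open (fst @^-1` chart_img phi : set (V * V)).
Proof. by apply: open_comp (@open_chart_img phi) => q _; exact: cvg_fst. Qed.

Lemma smooth_comp_fst (W : normedModType R) (U : set V) (f : V -> W) : findim W ->
  open U -> smooth_on U f -> smooth_on (fst @^-1` U : set (V * V)) (f \o fst).
Proof.
move=> fW oU fs k.
have oU' : open (fst @^-1` U : set (V * V)).
  by apply: open_comp oU => q _; exact: cvg_fst.
apply: (@Ck_comp R V W (V * V)%type k _ U fst f) => //.
  exact: findim_row.
by apply: (@Ck_linear R (V * V)%type V k _ fst) => q; exact: cvg_fst.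
Qed.

Lemma smooth_form_in phi : atlas phi ->
  smooth_on (fst @^-1` chart_img phi : set (V * V))
    (fun y => form_in phi y.1 y.2).
Proof.
move=> aphi k; have oX := @open_chart_imgX phi.
have [s [e [l [lc le]]]] := @findim_row R n.
apply: (Ck_eq oX (f := fun y : V * V => \sum_i l i y.2 * form_in phi y.1 (e i))).
  move=> [x w] /= _; rewrite [in RHS](le w).
  pose L : {linear V -> R^o} := HB.pack (form_in phi x)
    (GRing.isLinear.Build _ _ _ _ (form_in phi x) (form_in_linear phi x)).
  rewrite -[form_in phi x _]/(L _) linear_sum; apply: eq_bigr => i _.
  by rewrite linearZ.
apply: (@Ck_sum R (V * V)%type R^o) => // i.
apply: (@Ck_mul R (V * V)%type) => //.
  apply: (@Ck_linear_comp R (V * V)%type V R^o k _ snd (l i)) => //.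
  by apply: (@Ck_linear R (V * V)%type V k _ snd) => q; exact: cvg_snd.
apply: (@smooth_comp_fst R^o _ (fun x => form_in phi x (e i))) k.
- exact: findim_real.
- exact: open_chart_img.
- exact: form_smooth.
Qed.

Lemma smooth_proj_in phi : atlas phi ->
  smooth_on (fst @^-1` chart_img phi : set (V * V))
    (fun y => proj_in phi y.1 y.2).
Proof.
move=> aphi k; have oX := @open_chart_imgX phi.
apply: Ck_add => //.
  by apply: (@Ck_linear R (V * V)%type V k _ snd) => q; exact: cvg_snd.
apply: Ck_opp => //; apply: Ck_scale => //; first exact: findim_row.
  exact: smooth_form_in.
apply: (smooth_comp_fst (@findim_row R n) (@open_chart_img phi)).
exact: smooth_field_in.
Qed.

Lemma open_proj_in phi : atlas phi ->
  open [set y : V * V | chart_img phi y.1 /\ proj_in phi y.1 y.2 != 0].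
Proof.
move=> aphi.
apply: (@open_preimage_within _ _ (fst @^-1` chart_img phi)
  (fun y : V * V => proj_in phi y.1 y.2) [set w | w != 0]).
- exact: open_chart_imgX.
- rewrite openE => w w0; have c : {for w, continuous (@idfun V)} by exact: cvg_id.
  exact: (cvgr_neq0 _ c).
- by move=> y; exact: (smooth_proj_in aphi 0%N).
Qed.

Variable F : TM -> R.

(** Composing with the projection extends [F] from the kernel to all vectors over the chart, so that
    its smoothness is ordinary smoothness on an open set of $V\times V$. *)
Definition finsler_in phi (y : V * V) : R^o :=
  F (tchart_inv phi (y.1, proj_in phi y.1 y.2)).

Lemma form_in_proj phi (y : V * V) : atlas phi -> chart_img phi y.1 ->
  form_in phi y.1 (proj_in phi y.1 y.2) = 0.
Proof.
move=> aphi yX; pose L : {linear V -> R^o} := HB.pack (form_in phi y.1)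
  (GRing.isLinear.Build _ _ _ _ (form_in phi y.1) (form_in_linear phi y.1)).
rewrite -[LHS]/(L _) /proj_in linearB linearZ /= form_in_field //.
by rewrite -[_ *: 1]/(_ * 1) mulr1 subrr.
Qed.

Lemma timage_kerP phi (y : V * V) : atlas phi -> chart_img phi y.1 ->
  timage phi [set v : TM | ker Om v /\ vec v != 0] y <->
  form_in phi y.1 y.2 = 0 /\ y.2 != 0.
Proof.
move=> aphi yX; rewrite timageP // /ker /=.
have /= -> := vec_tchart_inv_eq0 aphi yX.
by split=> [[]|] //; split.
Qed.

Lemma smooth_finsler_in phi : is_finsler (ker Om) F -> atlas phi ->
  smooth_on [set y : V * V | chart_img phi y.1 /\ proj_in phi y.1 y.2 != 0]
    (finsler_in phi).
Proof.
move=> FF aphi k; apply: Ck_pointwise => y0 [yX y0p].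
pose q (y : V * V) : V * V := (y.1, proj_in phi y.1 y.2).
have oX := @open_chart_imgX phi.
have qs : smooth_on (fst @^-1` chart_img phi : set (V * V)) q.
  move=> j; apply: (@Ck_pair R (V * V)%type V V j _ fst) => //.
    by apply: (@Ck_linear R (V * V)%type V j _ fst) => r; exact: cvg_fst.
  exact: smooth_proj_in.
(* The map [q] takes its values in the kernel, where [F] agrees with the local smooth extension [g];
   hence [finsler_in] is locally [g \o q]. *)
have [U [g [oU Uq gs gE]]] := finsler_smooth FF aphi
  ((timage_kerP aphi (yX : chart_img phi (q y0).1)).2
     (conj (form_in_proj aphi yX) y0p)).
pose N := [set y : V * V | chart_img phi y.1 /\ proj_in phi y.1 y.2 != 0] `&`
  q @^-1` U.
have oN : open N.
  apply: (open_preimage_within (open_proj_in aphi) oU).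
  by move=> y [yXX _]; exact: (qs 0%N).
exists N; first by split.
apply: (Ck_eq oN (f := g \o q)).
  move=> y [[yXX yp] Uy] /=; rewrite -gE //.
  by apply/timage_kerP => //; split => //; exact: form_in_proj.
apply: (@Ck_comp R _ _ _ k N U) => //.
- exact: findim_prod (@findim_row R n) (@findim_row R n).
- exact: findim_real.
- by move=> y [].
- by apply: Ck_sub (qs k) => y [[]].
Qed.

Lemma finsler_in_at p (w : V) :
  finsler_in (chart_at p) (chart_at p p, w) =
  F (TVec (w - Om p w *: T p : tangent_space p)).
Proof.
have pd := mem_chart_at p; have pa := chart_at_atlas p.
have E := @proj_ker_in (chart_at p) (chart_at p p, w) pa (mem_chart_img pd).
by rewrite /finsler_in -E tchart_inv_at.
Qed.

Lemma smooth_fiber_comp (x : V) (X : normedModType R) (U : set (V * V))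
    (g : V * V -> X) : findim X -> open U -> smooth_on U g ->
  smooth_on [set w : V | U (x, w)] (fun w => g (x, w)).
Proof.
move=> fX oU gs k.
have as_ : smooth_on setT (fun w : V => (x, w)).
  move=> j; apply: Ck_pair; [exact: openT|exact: Ck_cst|].
  exact: (@Ck_linear R V V j setT idfun (fun x => cvg_id)).
have [_ /(_ k)] := smooth_comp_affine
  (findim_prod (@findim_row R n) (@findim_row R n)) fX oU gs as_.
exact.
Qed.

End ManifoldCharts.

(** * Cones that are graphs *)

(** Along a segment of [K] issuing from [x], membership in [A] is both an open and a closed
    condition. *)
Lemma convex_clopen (R : realType) (W : normedModType R) (K A : set W) (x : W) :
  (forall x y (t : R), K x -> K y -> 0 <= t <= 1 -> K (t *: x + (1 - t) *: y)) ->
  open A -> K x -> A x -> (forall z, K z -> closure A z -> A z) -> K `<=` A.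
Proof.
move=> cK oA Kx Ax clA y Ky.
pose f (t : R) : W := x + t *: (y - x).
have fc : continuous f by exact: continuous_line.
have fK t : 0 <= t <= 1 -> K (f t).
  move=> /andP[t0 t1].
  have -> : f t = t *: y + (1 - t) *: x.
    by rewrite /f scalerBr scalerBl scale1r addrCA.
  by apply: cK => //; rewrite t0.
have cI : connected [set t : R | 0 <= t <= 1].
  apply/connected_intervalP => s t /= /andP[s0 s1] /andP[t0 t1] z /andP[sz zt].
  by rewrite (le_trans s0) //= (le_trans zt).
suff /seteqP[_ /(_ 1)] : [set t : R | 0 <= t <= 1 /\ A (f t)] = [set t : R | 0 <= t <= 1].
  by rewrite /= ler01 lexx /f scale1r subrKC => /(_ isT)[].
apply: cI.
- by exists 0; rewrite /= lexx ler01 /f scale0r addr0.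
- by exists (f @^-1` A) => //; apply: open_comp oA => ? _; exact: fc.
- exists (f @^-1` closure A).
    by apply: closed_comp; [move=> ? _; exact: fc|exact: closed_closure].
  apply/seteqP; split=> t /= [t01 At]; split => //; first exact: subset_closure.
  by apply: clA => //; exact: fK.
Qed.

Lemma closure_midpoint (R : realType) (W : normedModType R) (A : set W) (x y : W) :
  (forall x y (t : R), A x -> A y -> 0 <= t <= 1 -> A (t *: x + (1 - t) *: y)) ->
  closure A x -> closure A y -> closure A (2^-1 *: (x + y)).
Proof.
move=> cA cx cy B nB.
have c : {for (x, y), continuous (fun q : W * W => 2^-1 *: (q.1 + q.2))}.
  apply: cvgZl_tmp; apply: cvgD; [exact: cvg_fst|exact: cvg_snd].
have [[P Q] /= [nP nQ] PQ] := c _ nB.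
have [a [Aa Pa]] := cx _ nP; have [b [Ab Qb]] := cy _ nQ.
exists (2^-1 *: (a + b)); split; last exact: (PQ (a, b)).
have h : 1 - 2^-1 = 2^-1 :> R by lra.
have := cA a b 2^-1 Aa Ab; rewrite h -scalerDr; apply.
by rewrite invr_ge0 ler0n invf_le1 // ler1n.
Qed.

Section FiberCone.
Variables (R : realType) (n : nat).
Notation V := 'rV[R]_n.
Variables (lam : {linear V -> R^o}) (T : V) (f : V -> R^o) (C : set V).
Hypothesis lamT : lam T = 1.
Let D : set V := [set w | w - lam w *: T != 0].
Hypothesis fT : forall w (c : R), f (w + c *: T) = f w.
Hypothesis fZ : forall w (a : R), 0 < a -> f (a *: w) = a * f w.
Hypothesis fs : smooth_on D f.
Hypothesis f_gt0 : forall w, D w -> 0 < f w.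
Hypothesis CP : forall w, D w -> (C w <-> lam w = f w).

Let Phi (w : V) : R^o := lam w - f w.

Let fV := @findim_row R n.

Let lamc : continuous lam. Proof. exact: findim_linear_continuous. Qed.

Let oD : open D. Proof. exact: open_projD. Qed.

Let dfD w : D w -> differentiable f w.
Proof. by move=> Dw; have [] := fs 1%N => + _; exact. Qed.

Let dDf u w : D w -> differentiable ('D_u f) w.
Proof. by move=> Dw; have [_ /(_ u)[+ _]] := fs 2%N; exact. Qed.

Lemma smooth_graph_level : smooth_on D Phi.
Proof.
move=> k; apply: Ck_add => //; last by apply: Ck_opp.
exact: Ck_linear.
Qed.

Lemma graph_level w : D w -> (C w <-> Phi w = 0).
Proof.
move=> Dw; rewrite CP //; split=> [E|/eqP]; first by rewrite /Phi E subrr.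
by rewrite subr_eq0 => /eqP.
Qed.

Lemma derive_graph_level w X : D w -> 'D_X Phi w = lam X - 'D_X f w.
Proof.
move=> Dw; rewrite deriveB; first by rewrite derive_linear.
  by apply/diff_derivable/linear_differentiable.
exact/diff_derivable/dfD.
Qed.

Lemma derive2_graph_level w X Y : D w -> 'D_X ('D_Y Phi) w = - 'D_X ('D_Y f) w.
Proof.
move=> Dw; rewrite -sub0r -[X in _ = X - _](derive_cst (lam Y) w X).
rewrite -deriveB; last exact/diff_derivable/dDf.
  apply: near_eq_derive.
  have nD : nbhs w D by exact: open_nbhs_nbhs.
  by apply: filterS nD => y Dy; exact: derive_graph_level.
exact: derivable_cst.
Qed.

Lemma derive_vertical w : D w -> 'D_T f w = 0.
Proof. by move=> Dw; apply: derive_invariant => //; exact: dfD. Qed.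

Lemma derive_graph_level_vertical w : D w -> 'D_T Phi w = 1.
Proof. by move=> Dw; rewrite derive_graph_level // derive_vertical // subr0. Qed.

Lemma graph_tangent w X : D w -> C w -> tangent_to C w X <-> lam X = 'D_X f w.
Proof.
move=> Dw Cw.
have b0 : 'D_T Phi w != 0 by rewrite derive_graph_level_vertical // oner_eq0.
rewrite (level_tangent fV oD smooth_graph_level graph_level X Dw Cw b0).
rewrite derive_graph_level //; split=> [/eqP|->]; last exact: subrr.
by rewrite subr_eq0 => /eqP.
Qed.

Lemma graph_second_fundamental_form w xi X Y : D w -> C w -> 'D_xi Phi w != 0 ->
  tangent_to C w X -> tangent_to C w Y ->
  second_fundamental_form C w xi X Y = 'D_X ('D_Y f) w / 'D_xi Phi w.
Proof.
move=> Dw Cw b0 tX tY.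
rewrite (level_second_fundamental_form oD smooth_graph_level graph_level Dw Cw b0 tX tY).
by rewrite derive2_graph_level // opprK.
Qed.

Lemma graph_lift_D w : D w -> D (w + (f w - lam w) *: T).
Proof. exact: projDT. Qed.

Lemma graph_lift w : D w -> C (w + (f w - lam w) *: T).
Proof.
move=> Dw; apply/CP; first exact: graph_lift_D.
by rewrite fT linearD linearZ /= lamT -[_ *: 1]/(_ * 1) mulr1 subrKC.
Qed.

(** The point [w] of the graph differs from [v] by a multiple of [T], which changes no derivative of
    [f]. At [w] the second fundamental form is the Hessian of [f] divided by ['D_xi Phi w], so the
    sign of this number has to be settled. *)
Lemma cone_graph_posdef : is_cone C ->
  (forall w, cone_interior C w -> f w < lam w) ->
  forall v u, D v -> lam u = 0 -> u != 0 ->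
  0 < 'D_u ('D_u (fun x => f x ^+ 2 : R^o)) v.
Proof.
move=> coneC Aint v u Dv lu u0.
pose w := v + (f v - lam v) *: T.
have Dw : D w by exact: graph_lift_D.
have Cw : C w by exact: graph_lift.
rewrite -(derive2_sqr_graphT fT u v (f v - lam v)) -/w.
have [xi [nt [e e0 eA]] [psd rad]] := cone_strong coneC Cw.
have b0 : 'D_xi Phi w != 0.
  apply/eqP => b0; apply: nt; apply/graph_tangent => //.
  by apply/eqP; rewrite -subr_eq0 -derive_graph_level // b0.
(* An inward vector cannot decrease [Phi]: a negative derivative would make [Phi] negative just
   after [w] along [xi], whereas it is positive on the interior. *)
have b_gt0 : 0 < 'D_xi Phi w.
  rewrite lt_neqAle eq_sym b0 leNgt /=; apply/negP => bneg.
  have [_ /(_ xi) Dc] := smooth_graph_level 1%N.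
  have nD : nbhs w D by exact: open_nbhs_nbhs.
  have nB : nbhs w (D `&` [set y | 'D_xi Phi y < 0]).
    by apply: filterI nD _; exact: (cvgr_lt _ (Dc w Dw) _ bneg).
  have := @continuous_line R V w xi 0; rewrite /continuous_at scale0r addr0.
  move=> /(_ _ nB) /nbhs_normP[d /= d0 dB].
  pose t := Num.min (d / 2) (e / 2).
  have t0 : 0 < t by rewrite lt_min !divr_gt0.
  have td : t < d.
    apply: (@le_lt_trans _ _ (d / 2)); first by rewrite ge_min lexx.
    by rewrite ltr_pdivrMr // ltr_pMr // ltr1n.
  have te : t < e.
    apply: (@le_lt_trans _ _ (e / 2)); first by rewrite ge_min lexx orbT.
    by rewrite ltr_pdivrMr // ltr_pMr // ltr1n.
  have seg s : 0 <= s <= t -> D (w + s *: xi) /\ 'D_xi Phi (w + s *: xi) < 0.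
    move=> /andP[s0 st]; apply: dB.
    by rewrite /ball_ /= sub0r normrN ger0_norm // (le_lt_trans st).
  have ds s : 0 <= s <= t -> differentiable Phi (w + s *: xi).
    by move=> /seg[Ds _]; have [dP _] := smooth_graph_level 1%N; exact: dP.
  have [s /andP[s0 st] E] := mean_value_line t0 ds.
  have Phiw : Phi w = 0 by apply/graph_level.
  have : 0 < Phi (w + t *: xi) by rewrite subr_gt0; apply/Aint/eA.
  rewrite Phiw subr0 in E; rewrite E pmulr_rgt0 //.
  have [|_ sneg] := seg s; first by rewrite !ltW.
  by move=> spos; have := lt_trans spos sneg; rewrite ltxx.
apply: (graph_hessian_sqr_gt0 fV lamT fT fZ fs f_gt0 Dw) => //.
- by apply/CP.
- move=> X /graph_tangent - /(_ Dw Cw) tX; have := psd X tX.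
  rewrite graph_second_fundamental_form //.
  by rewrite pmulr_lge0 // invr_gt0.
- move=> X /graph_tangent - /(_ Dw Cw) tX QX.
  apply: (rad X tX).1 => Y tY.
  rewrite graph_second_fundamental_form // QX ?mul0r //.
  by apply/graph_tangent.
Qed.

(** * The graph of a function with positive definite fundamental tensor is a cone *)

Hypothesis fcont : continuous f.
Hypothesis posdef : forall v u, D v -> lam u = 0 -> u != 0 ->
  0 < 'D_u ('D_u (fun x => f x ^+ 2 : R^o)) v.
Hypothesis C_neq0 : forall w, C w -> w != 0.
Hypothesis CE : forall w, w != 0 -> (C w <-> lam w = f w).
(** A nonzero vector of the kernel, available in dimension at least 2: the lifts of [u0] and [- u0]
    are points of the cone. *)
Variable u0 : V.
Hypotheses (lam_u0 : lam u0 = 0) (u0_neq0 : u0 != 0).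

Let A : set V := [set w | f w < lam w].

Let f0 : f 0 = 0. Proof. exact: graph_f0 fZ. Qed.

Let fproj0 w : w - lam w *: T = 0 -> f w = 0.
Proof. by move=> w0; rewrite -(fproj lam fT w) w0 f0. Qed.

Let CD w : C w -> D w.
Proof.
move=> Cw; apply/negP => /eqP w0; have wn0 := C_neq0 Cw.
have := (CE wn0).1 Cw; rewrite fproj0 // => lw.
by move: w0 wn0; rewrite lw scale0r subr0 => ->; rewrite eqxx.
Qed.

Let u0D : D u0. Proof. by rewrite /D /= lam_u0 scale0r subr0. Qed.

Let nu0D : D (- u0).
Proof. by rewrite /D /= linearN lam_u0 oppr0 scale0r subr0 oppr_eq0. Qed.

Let hess_ge0 w X : D w -> 0 <= 'D_X ('D_X f) w.
Proof.
move=> Dw; apply: (proj1 (graph_hessian_ge0 fV lamT fT fZ fs f_gt0 X Dw _)).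
by move=> u lu un0; exact: posdef.
Qed.

Let f_subadd x y : f (x + y) <= f x + f y.
Proof. exact: (graph_subadditive fT fZ fs f_gt0 hess_ge0). Qed.

Let fZ0 w (a : R) : 0 <= a -> f (a *: w) = a * f w.
Proof.
rewrite le_eqVlt => /predU1P[<-|]; last exact: fZ.
by rewrite scale0r mul0r f0.
Qed.

Let gc : continuous Phi.
Proof. by move=> w; exact: (cvgB (@lamc w) (@fcont w)). Qed.

Lemma open_graph_interior : open A.
Proof.
have -> : A = Phi @^-1` [set t | 0 < t].
  by apply/seteqP; split=> w /=; rewrite /A /Phi /= subr_gt0.
by apply: open_comp (@open_gt R 0) => w _; exact: gc.
Qed.

Lemma convex_graph_interior x y (t : R) : A x -> A y -> 0 <= t <= 1 ->
  A (t *: x + (1 - t) *: y).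
Proof.
rewrite /A /= => Ax Ay /andP[t0 t1]; have t1' : 0 <= 1 - t by rewrite subr_ge0.
apply: le_lt_trans (f_subadd _ _) _; rewrite !fZ0 // linearD !linearZ /=.
rewrite -[t *: lam x]/(t * lam x) -[(1 - t) *: lam y]/((1 - t) * lam y).
move: Ax Ay; move: (lam x) (lam y) (f x) (f y) => a b c d ca db.
by have [t00|tn0] := eqVneq t 0; [subst t; lra|];
  have tp : 0 < t by [rewrite lt_neqAle eq_sym tn0]; nra.
Qed.

Lemma closure_graph_interior w : closure A w <-> f w <= lam w.
Proof.
split=> [cw|fw].
  have cl : closed [set w | 0 <= Phi w].
    by apply: closed_comp (@closed_ge R 0) => w' _; exact: gc.
  have : closure [set w | 0 <= Phi w] w.
    apply: closure_subset cw => y; rewrite /A /= => Ay.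
    by rewrite subr_ge0 ltW.
  by rewrite -(closure_id _).1 //= subr_ge0.
move=> B nB.
have := @continuous_line R V w T 0; rewrite /continuous_at scale0r addr0.
move=> /(_ _ nB) /nbhs_normP[e /= e0 eB].
have e2 : 0 < e / 2 by rewrite divr_gt0.
exists (w + (e / 2) *: T); split.
  rewrite /A /= fT linearD linearZ /= lamT -[_ *: 1]/(_ * 1) mulr1.
  by apply: le_lt_trans fw _; rewrite ltrDl.
apply: (eB (e / 2)); rewrite /ball_ /= sub0r normrN gtr0_norm //.
by rewrite ltr_pdivrMr // ltr_pMr // ltr1n.
Qed.

Lemma graph_boundaryE (A' : set V) : open A' -> C = (closure A' `\` A'°) `\` [set 0] ->
  forall w, C w <-> [/\ closure A' w, ~ A' w & w != 0].
Proof.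
move=> oA' CE' w; rewrite CE' (_ : A'° = A'); last by apply/interior_id.
split=> [[[? ?] /eqP ?]//|[? ? /eqP ?]//].
Qed.

Lemma graph_interior : is_cone_interior C A.
Proof.
split.
- exact: open_graph_interior.
- by rewrite /A /= f0 linear0 ltxx.
- by apply/convex_setP; exact: convex_graph_interior.
- rewrite (_ : A° = A); last by apply/interior_id/open_graph_interior.
  apply/seteqP; split=> [w Cw|w [[/closure_graph_interior cw nA] /eqP w0]].
    have wn0 := C_neq0 Cw; have E := (CE wn0).1 Cw.
    split; last exact/eqP.
    split; first by apply/closure_graph_interior; rewrite E.
    by rewrite /A /= E ltxx.
  apply/CE => //; apply/eqP; rewrite eq_le cw andbT leNgt.
  exact/negP.
Qed.

(* The second case excludes an interior on the other side of the cone: its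
   closure would contain points [b/2 + kT] with k arbitrarily large. *)
Lemma graph_interior_unique A' : is_cone_interior C A' -> A' = A.
Proof.
move=> [oA' nA'0 /convex_setP cA' CA'].
have bP := graph_boundaryE oA' CA'.
have Pn0 z : A' z -> Phi z != 0.
  move=> Az; apply/eqP => /eqP; rewrite subr_eq0 => /eqP Pz.
  have zn0 : z != 0 by apply/eqP => z0; apply: nA'0; rewrite -z0.
  by have /bP[_ /(_ Az)] := (CE zn0).2 Pz.
have [[x [A'x Ax]]|nAA'] := pselect (exists x, A' x /\ A x).
  apply/seteqP; split.
    apply: (convex_clopen cA' open_graph_interior A'x Ax) => z A'z.
    move=> /closure_graph_interior fz; rewrite /A /= lt_neqAle fz andbT.
    by have := Pn0 z A'z; rewrite subr_eq0 eq_sym.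
  apply: (convex_clopen convex_graph_interior oA' Ax A'x) => z Az clz.
  apply: contrapT => nA'z.
  have zn0 : z != 0.
    by apply: contraTneq Az => ->; rewrite f0 linear0 ltxx.
  have /(CE zn0) E : C z by apply/bP.
  by move: Az; rewrite /A /= E ltxx.
exfalso.
have CA : C `<=` closure A' by move=> z /bP[].
have [b A'b] : A' !=set0.
  have := CA _ (graph_lift u0D) setT filterT.
  by case=> b [A'b _]; exists b.
have clb : closure A' b by exact: subset_closure.
pose cT := (f u0 + f (- u0)).
have cT0 : 0 < cT by rewrite addr_gt0 // f_gt0.
(* The points of the cone above $ku_0$ and $-ku_0$ have their midpoint on the axis, at a height
   proportional to [k]. *)
have ray k : 0 < k -> closure A' (2^-1 *: ((k * cT) *: T)).
  move=> k0.
  have h1 : C (k *: (u0 + (f u0 - lam u0) *: T)).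
    apply/CP; last by rewrite fZ // fT linearZ linearD linearZ /= lamT lam_u0 subr0
      add0r -[_ *: 1]/(_ * 1) mulr1.
    by apply: projDZ => //; exact: graph_lift_D.
  have h2 : C (k *: (- u0 + (f (- u0) - lam (- u0)) *: T)).
    apply/CP; last by rewrite fZ // fT linearZ linearD linearZ /= lamT linearN
      lam_u0 oppr0 subr0 add0r -[_ *: 1]/(_ * 1) mulr1.
    by apply: projDZ => //; exact: graph_lift_D.
  have := closure_midpoint cA' (CA _ h1) (CA _ h2).
  rewrite linearN lam_u0 !oppr0 !addr0 -scalerDr addrACA subrr add0r -scalerDl.
  by rewrite scalerA.
have B' z : A' z -> Phi z <= 0.
  move=> A'z; rewrite leNgt; apply/negP => Pz; apply: nAA'; exists z.
  by split=> //; rewrite /A /= -subr_gt0.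
have clB z : closure A' z -> Phi z <= 0.
  have cl : closed [set w | Phi w <= 0].
    by apply: closed_comp (@closed_le R 0) => w' _; exact: gc.
  move=> clz; have : closure [set w | Phi w <= 0] z by exact: closure_subset clz.
  by rewrite -(closure_id _).1.
have bad k : 0 < k -> 2^-1 * (lam b + 2^-1 * (k * cT)) <= 2^-1 * f b.
  move=> k0; have := clB _ (closure_midpoint cA' clb (ray k k0)).
  rewrite /Phi subr_le0 linearZ linearD !linearZ /= lamT.
  rewrite -[_ *: 1]/(_ * 1) mulr1 fZ // scalerA fT.
  by [].
(* Then [k * cT / 2] exceeds [f b - lam b], against [bad]. *)
pose k := (`|f b - lam b| * 2 + 1) / cT.
have k0 : 0 < k by rewrite divr_gt0 // ltr_wpDl // mulr_ge0.
have := bad k k0; rewrite /k divfK ?gt_eqF //.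
have := ler_norm (f b - lam b); lra.
Qed.

Lemma graph_cone_interiorE : cone_interior C = A.
Proof.
apply: graph_interior_unique; apply: xgetPex; exists A; exact: graph_interior.
Qed.

Lemma is_cone_graph : is_cone C.
Proof.
split.
- by exists (u0 + (f u0 - lam u0) *: T); exact: graph_lift.
- exact: C_neq0.
- move=> w Cw; have Dw := CD Cw.
  have b0 : 'D_T Phi w != 0 by rewrite derive_graph_level_vertical // oner_eq0.
  exact: (level_slice fV oD smooth_graph_level graph_level Dw b0).
- move=> w a Cw a0; have wn0 := C_neq0 Cw.
  apply/CE; first by rewrite scaler_eq0 negb_or gt_eqF.
  by rewrite fZ // linearZ /= ((CE wn0).1 Cw).
- move=> w Cw CNw; have Dw := CD Cw.
  have := (CE (C_neq0 CNw)).1 CNw; rewrite linearN => E.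
  have := (CP Dw).1 Cw; have := f_gt0 Dw; have := f_gt0 (CD CNw).
  by rewrite -E; move: (lam w) (f w) => a b; lra.
- by exists A; exact: graph_interior.
- move=> w Cw; have Dw := CD Cw; have wn0 := C_neq0 Cw.
  have lw := (CE wn0).1 Cw.
  have b1 := derive_graph_level_vertical Dw.
  have b0 : 'D_T Phi w != 0 by rewrite b1 oner_eq0.
  have hP X := graph_hessian_ge0 fV lamT fT fZ fs f_gt0 X Dw
    (fun u lu un0 => posdef Dw lu un0).
  have II X Y : tangent_to C w X -> tangent_to C w Y ->
      second_fundamental_form C w T X Y = 'D_X ('D_Y f) w.
    by move=> tX tY; rewrite graph_second_fundamental_form // b1 divr1.
  (* Since $D_T\Phi=1$, the second fundamental form with respect to [T] is the Hessian of [f]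
     itself. *)
  exists T; [split|split].
  + by move=> /graph_tangent - /(_ Dw Cw); rewrite lamT derive_vertical // => /eqP;
      rewrite oner_eq0.
  + exists 1 => // t t0 _; rewrite graph_cone_interiorE /A /= fT linearD linearZ /=.
    by rewrite lamT -[_ *: 1]/(_ * 1) mulr1 lw ltrDl.
  + by move=> X tX; rewrite II //; exact: (hP X).1.
  + move=> X tX; split=> [rad|[a ->] Y tY].
      (* A null vector has the form $X=rw+cT$, and tangency of both [X] and [w] forces $c=0$. *)
      have [r Xr] := (hP X).2 (etrans (esym (II X X tX tX)) (rad X tX)).
      exists r; have lX := (graph_tangent X Dw Cw).1 tX.
      have XE : X = r *: w + (lam X - r * lam w) *: T.
        rewrite scalerBl -scalerA addrCA -scalerBr -Xr addrC subrK //.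
      have : 'D_X f w = r * lam w.
        rewrite {1}XE deriveDv ?deriveZv; try exact: dfD.
        rewrite derive_vertical // scaler0 addr0 (euler fZ fs) // lw //.
      by rewrite -lX => E; rewrite XE E subrr scale0r addr0.
    rewrite II //; last first.
      apply/graph_tangent => //; rewrite linearZ deriveZv; last exact: dfD.
      by rewrite (euler fZ fs) // lw.
    rewrite deriveZv; last exact: dDf.
    by rewrite (derive2_graph_euler fZ fs) // scaler0.
Qed.

End FiberCone.

(** * From Finsler metrics to cone structures *)

Lemma ker_linear_neq0 (R : realType) (n : nat) (lam : {linear 'rV[R]_n -> R^o}) :
  (2 <= n)%N -> exists2 u : 'rV[R]_n, u != 0 & lam u = 0.
Proof.
case: n lam => [|[|n]] // lam _.
have dn0 (i : 'I_n.+2) : delta_mx 0 i != 0 :> 'rV[R]_n.+2.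
  by apply/eqP => /matrixP/(_ 0 i)/eqP; rewrite !mxE !eqxx oner_eq0.
pose e0 : 'rV[R]_n.+2 := delta_mx 0 ord0; pose e1 : 'rV[R]_n.+2 := delta_mx 0 ord_max.
have [l0|l0] := eqVneq (lam e0) 0; first by exists e0 => //; exact: dn0.
exists (lam e0 *: e1 - lam e1 *: e0); last first.
  by apply/eqP; rewrite linearB subr_eq0 !linearZ; apply/eqP; exact: mulrC.
apply/eqP => /matrixP/(_ 0 ord_max)/eqP; rewrite !mxE !eqxx /= mulr1 mulr0 subr0.
by rewrite (negbTE l0).
Qed.

Lemma derive1_line (R : realType) (W : normedModType R) (g : W -> R^o) (x u : W) :
  differentiable g x -> derive1 (fun s : R => g (x + s *: u) : R) 0 = 'D_u g x.
Proof.
move=> dg; have dg0 : differentiable g (x + (0 : R) *: u).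
  by rewrite scale0r addr0.
have [_] := is_derive_line dg0; rewrite scale0r addr0 => <-.
exact: derive1E.
Qed.

Lemma fundamental_tensorE (R : realType) (n : nat) (M : manifold R n)
    (F : tangent_bundle M -> R) (p : M) (f : 'rV[R]_n -> R^o) (D : set 'rV[R]_n)
    (v u : 'rV[R]_n) :
  open D -> smooth_on D f -> D v ->
  (forall r s : R, F (TVec (v + r *: u + s *: u : tangent_space p)) =
                   f (v + r *: u + s *: u)) ->
  fundamental_tensor F p v u u =
  2^-1 * 'D_u ('D_u (fun w => f w ^+ 2 : R^o)) v.
Proof.
move=> oD fs Dv Ff; rewrite /fundamental_tensor; apply: (congr1 ( *%R 2^-1)).
have gs k : Ck k D (fun w => f w ^+ 2 : R^o).
  by apply: (Ck_eq oD _ (Ck_mul oD (fs k) (fs k))) => w _; rewrite expr2.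
have [dg Dg] := gs 2%N; have [dDg _] := Dg u.
rewrite derive1E.
have E : \forall r \near (0 : R),
    derive1 (fun s : R => F (TVec (v + r *: u + s *: u : tangent_space p)) ^+ 2) 0
    = 'D_u (fun w => f w ^+ 2 : R^o) (v + r *: u).
  have := @continuous_line R _ v u 0; rewrite /continuous_at scale0r addr0.
  have nD : nbhs v D by exact: open_nbhs_nbhs.
  move=> c0; have Dr0 : \forall r \near (0 : R), D (v + r *: u) by exact: c0 _ nD.
  apply: filterS Dr0 => r Dr.
  rewrite (_ : (fun s : R => _) = fun s : R => f (v + r *: u + s *: u) ^+ 2); last first.
    by apply/funext => s; rewrite Ff.
  by apply: (@derive1_line _ _ (fun w => f w ^+ 2 : R^o)); exact: dg.
rewrite (near_eq_derive _ E) -derive1E.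
by apply: derive1_line; exact: dDg.
Qed.

Section FinslerFiber.
Variables (R : realType) (n : nat) (M : manifold R n).
Notation V := 'rV[R]_n.
Notation TM := (tangent_bundle M).
Variables (Om : one_form M) (T : vector_field M) (F : TM -> R).
Hypothesis OmT : forall p, Om p (T p) = 1.

(** $F\circ\pi$ on the fibre over [p]: the function [f] of the results on graphs. *)
Definition finsler_fiber (p : M) (w : V) : R^o :=
  F (TVec (w - Om p w *: T p : tangent_space p)).

Lemma form_proj_ker p (w : V) : Om p (w - Om p w *: T p) = 0.
Proof. by rewrite linearB linearZ /= OmT -[_ *: 1]/(_ * 1) mulr1 subrr. Qed.

Lemma finsler_fiberT p w (c : R) :
  finsler_fiber p (w + c *: T p) = finsler_fiber p w.
Proof.
have E : Om p (w + c *: T p) = Om p w + c.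
  by rewrite linearD linearZ OmT; congr (_ + _); exact: mulr1.
by rewrite /finsler_fiber E scalerDl opprD addrACA subrr addr0.
Qed.

Lemma finsler_fiber_ker p (w : V) : Om p w = 0 -> finsler_fiber p w = F (TVec (w : tangent_space p)).
Proof. by move=> w0; rewrite /finsler_fiber w0 scale0r subr0. Qed.

Lemma proj_in_at p (w : V) :
  proj_in Om T (chart_at p) (chart_at p p) w = w - Om p w *: T p.
Proof.
have pd := mem_chart_at p; have pa := chart_at_atlas p.
have E := @proj_ker_in _ _ _ Om T (chart_at p) (chart_at p p, w) pa (mem_chart_img pd).
have := congr1 (fun v : TM => vec v : V) E.
by rewrite !tchart_inv_at /= => <-.
Qed.

Lemma finsler_in_fiber p w :
  finsler_in Om T F (chart_at p) (chart_at p p, w) = finsler_fiber p w.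
Proof. by rewrite finsler_in_at. Qed.

Lemma smooth_finsler_fiber_of p :
  smooth_on [set y : V * V | chart_img (chart_at p) y.1 /\
    proj_in Om T (chart_at p) y.1 y.2 != 0] (finsler_in Om T F (chart_at p)) ->
  smooth_on [set w : V | w - Om p w *: T p != 0] (finsler_fiber p).
Proof.
move=> Fs k.
have oD := @open_proj_in _ _ _ Om T (chart_at p) (chart_at_atlas p).
have -> : finsler_fiber p =
    fun w => finsler_in Om T F (chart_at p) (chart_at p p, w).
  by apply/funext => w; rewrite finsler_in_fiber.
apply: Ck_sub (smooth_fiber_comp (chart_at p p) (@findim_real R) oD Fs k).
move=> w /= Dw; split; first exact/mem_chart_img/mem_chart_at.
by rewrite proj_in_at.
Qed.

Hypothesis FF : is_finsler (ker Om) F.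

Lemma finsler_fiberZ p w (a : R) : 0 < a ->
  finsler_fiber p (a *: w) = a * finsler_fiber p w.
Proof.
move=> a0; have E : Om p (a *: w) = a * Om p w by rewrite linearZ.
rewrite /finsler_fiber E -scalerA -scalerBr.
by apply: (finsler_homogeneous FF) => //; exact: form_proj_ker.
Qed.

Lemma finsler_fiber_gt0 p w : w - Om p w *: T p != 0 -> 0 < finsler_fiber p w.
Proof. by move=> w0; apply: (finsler_gt0 FF) => //; exact: form_proj_ker. Qed.

Lemma smooth_finsler_fiber p :
  smooth_on [set w : V | w - Om p w *: T p != 0] (finsler_fiber p).
Proof.
by apply: smooth_finsler_fiber_of; apply: smooth_finsler_in => //; exact: chart_at_atlas.
Qed.

Lemma continuous_finsler_fiber p : continuous (finsler_fiber p).
Proof.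
move=> w; have pd := mem_chart_at p; have pa := chart_at_atlas p.
pose q (w : V) : V * V := (chart_at p p, w - Om p w *: T p).
have qc : continuous q.
  move=> w'; apply: (@cvg_pair _ _ _ (nbhs w') (nbhs (chart_at p p)) (nbhs (w' - Om p w' *: T p))).
    exact: cvg_cst.
  apply: cvgB; first exact: cvg_id.
  by apply: cvgZr_tmp; apply: findim_linear_continuous; exact: findim_row.
have qE w' : timage (chart_at p) (ker Om) (q w').
  by apply/timage_chart_at; exact: form_proj_ker.
have -> : finsler_fiber p = (F \o tchart_inv (chart_at p)) \o q.
  by apply/funext => w'; rewrite /= /q tchart_inv_at.
have /subspace_continuousP/(_ _ (qE w)) c := finsler_continuous FF pa.
apply: cvg_comp c => B nB.
have nB' : nbhs w (q @^-1` [set y | timage (chart_at p) (ker Om) y -> B y]).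
  exact: qc w _ nB.
by apply: filterS nB' => w' /=; apply; exact: qE.
Qed.

Lemma finsler_fiber_posdef p v u : v - Om p v *: T p != 0 -> Om p u = 0 -> u != 0 ->
  0 < 'D_u ('D_u (fun x => finsler_fiber p x ^+ 2 : R^o)) v.
Proof.
move=> v0 lu u0; set w := v - Om p v *: T p in v0.
have lw : Om p w = 0 by exact: form_proj_ker.
have := finsler_posdef FF (lw : ker Om (TVec (w : tangent_space p)))
  (lu : ker Om (TVec (u : tangent_space p))) v0 u0.
have oD : open [set w : V | w - Om p w *: T p != 0].
  by apply: open_projD; exact: findim_row.
rewrite (fundamental_tensorE oD (@smooth_finsler_fiber p)); last 2 first.
- by rewrite /= lw scale0r subr0.
- move=> r s; rewrite finsler_fiber_ker //.
  have lZ (a : R) : Om p (a *: u) = 0 by rewrite linearZ lu; exact: mulr0.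
  have l1 : Om p (w + r *: u) = 0 by rewrite linearD lZ lw addr0.
  by rewrite [LHS]linearD lZ l1 addr0.
have half_gt0 (a : R) : 0 < 2^-1 * a -> 0 < a by rewrite pmulr_rgt0 ?invr_gt0.
have E := derive2_sqr_graphT (@finsler_fiberT p) u v (- Om p v).
by move/half_gt0; rewrite scaleNr -/w in E; rewrite [X in 0 < X -> _]E.
Qed.

End FinslerFiber.

Section Converse.
Variables (R : realType) (n : nat) (M : manifold R n).
Notation V := 'rV[R]_n.
Notation TM := (tangent_bundle M).
Variables (Om : one_form M) (T : vector_field M) (F : TM -> R).
Hypothesis hn : (2 <= n)%N.
Hypothesis OmT : forall p, Om p (T p) = 1.
Hypothesis FF : is_finsler (ker Om) F.

(** The graph equation is equivalent to its image under $\Omega$, namely $\Omega(v)=F(\pi(v))$. The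
    zero vector also solves it and has to be excluded. *)
Definition graph_cone : set TM :=
  [set v | vec v != 0 /\ Om (base v) (vec v) = F (proj_ker Om T v)].

Lemma graph_cone_eq : cone_triple_eq graph_cone Om T F.
Proof.
move=> v v0; have vE : vec v = Om (base v) (vec v) *: T (base v) + vec (proj_ker Om T v) :> V.
  by rewrite /= addrC subrK.
split=> [[_ <-]//|E]; split => //.
have := congr1 (Om (base v)) E.
have TE (a : R) (u : V) : Om (base v) u = 0 ->
    Om (base v) (a *: T (base v) + u) = a.
  move=> u0; rewrite linearD u0 addr0 linearZ OmT; exact: mulr1.
by rewrite TE //; exact: form_proj_ker.
Qed.

Lemma graph_cone_unique (C : set TM) : is_cone_structure C ->
  cone_triple_eq C Om T F -> graph_cone = C.
Proof.
move=> CS CE; apply/seteqP; split=> v Cv.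
  by have v0 := Cv.1; apply/(CE v v0)/(graph_cone_eq v0).
have v0 : vec v != 0.
  by apply: (cone_neq0 (cstr_cone CS (base v))); rewrite /fiber /=; case: v Cv.
by apply/(graph_cone_eq v0)/(CE v v0).
Qed.

Lemma fiber_graph_cone p (w : V) : w != 0 ->
  fiber graph_cone p w <-> Om p w = finsler_fiber Om T F p w.
Proof. by move=> w0; split=> [[_]|]. Qed.

Lemma graph_cone_fiber p : is_cone (fiber graph_cone p).
Proof.
have [u u0 lu] := @ker_linear_neq0 R n (Om p) hn.
apply: (@is_cone_graph R n (Om p) (T p) (finsler_fiber Om T F p) _ (OmT p)
  _ _ _ _ _ _ _ _ _ u lu u0).
- exact: finsler_fiberT.
- by move=> w a a0; exact: finsler_fiberZ.
- exact: smooth_finsler_fiber.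
- by move=> w w0; exact: finsler_fiber_gt0.
- move=> w Dw; apply: fiber_graph_cone; apply: contraNneq Dw => ->.
  by rewrite linear0 scale0r subrr.
- exact: continuous_finsler_fiber.
- by move=> v u' Dv lu' u0'; exact: finsler_fiber_posdef.
- by move=> w [].
- exact: fiber_graph_cone.
Qed.

Variable phi : chart R n M.
Hypothesis aphi : atlas phi.

Let D : set (V * V) :=
  [set y | chart_img phi y.1 /\ proj_in Om T phi y.1 y.2 != 0].
Let Phi (y : V * V) : R^o := form_in Om phi y.1 y.2 - finsler_in Om T F phi y.
Let S := timage phi graph_cone.

Let oD : open D. Proof. exact: open_proj_in. Qed.

Lemma finsler0 p : F (TVec (0 : tangent_space p)) = 0.
Proof.
have E0 : ker Om (TVec (0 : tangent_space p)) by exact: linear0.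
have := finsler_homogeneous FF E0 (ltr0n R 2).
rewrite scaler0 => /eqP; rewrite mulr2n mulrDl mul1r.
by rewrite -subr_eq0 opprD addrA subrr add0r oppr_eq0 => /eqP.
Qed.

Lemma timage_graph_coneE y : S y <->
  [/\ chart_img phi y.1, y.2 != 0 &
      form_in Om phi y.1 y.2 = finsler_in Om T F phi y].
Proof.
rewrite /S timageP //; split=> [[yX [h1 h2]]|[yX h1 h2]].
  rewrite (proj_ker_in _ _ aphi yX) in h2.
  by split=> //; rewrite -(vec_tchart_inv_eq0 aphi yX).
split=> //; split; first by rewrite (vec_tchart_inv_eq0 aphi yX).
by rewrite (proj_ker_in _ _ aphi yX).
Qed.

Lemma form_in0 x : form_in Om phi x 0 = 0.
Proof. by rewrite /form_in [tvec _ _ 0]linear0 linear0. Qed.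

Lemma timage_graph_coneP y : D y -> (S y <-> Phi y = 0).
Proof.
move=> [yX yD].
have y2 : y.2 != 0.
  by apply: contraNneq yD => y20; rewrite /proj_in y20 form_in0 scale0r subrr.
rewrite timage_graph_coneE; split=> [[_ _ E]|/eqP]; first by rewrite /Phi E subrr.
by rewrite subr_eq0 => /eqP.
Qed.

Lemma timage_graph_coneD y : S y -> D y.
Proof.
move=> /timage_graph_coneE[yX y2 E]; split => //; apply: contraNneq y2 => y0.
move: E; rewrite /finsler_in y0 /tchart_inv /= [tvec _ _ 0]linear0 finsler0 => E.
by move: y0; rewrite /proj_in E scale0r subr0 => ->.
Qed.

Let Ps : smooth_on D Phi.
Proof.
move=> k; apply: Ck_add => //.
  by apply: Ck_sub (smooth_form_in Om aphi k) => y [].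
by apply: Ck_opp => //; exact: smooth_finsler_in.
Qed.

(** The vertical lift of [T]. [Phi] grows at unit speed along it, which yields both the slice charts
    of the graph and its transversality to the fibres. *)
Let xi (y : V * V) : V * V := (0, field_in T phi y.1).

Lemma derive_vertical_field y : D y -> 'D_(xi y) Phi y = 1.
Proof.
move=> Dy; have [yX _] := Dy.
rewrite (@derive_along_line R (V * V)%type R^o Phi y (xi y) (fun t => Phi y + t)).
- by rewrite deriveD // derive_cst add0r derive_id.
- by have [dP _] := Ps 1%N; exact: dP.
have PhiE t : Phi (y + t *: xi y) = Phi y + t.
  rewrite /Phi /finsler_in /= scaler0 addr0.
  have fE : form_in Om phi y.1 (y.2 + t *: field_in T phi y.1) =
            form_in Om phi y.1 y.2 + t.
    rewrite addrC form_in_linear form_in_field // addrC; congr (_ + _).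
    exact: mulr1.
  have pE : proj_in Om T phi y.1 (y.2 + t *: field_in T phi y.1) =
            proj_in Om T phi y.1 y.2.
    by rewrite /proj_in fE scalerDl opprD addrACA subrr addr0.
  by rewrite fE pE addrAC.
by near do exact: PhiE.
Unshelve. all: by end_near. Qed.

Let fVV := findim_prod (@findim_row R n) (@findim_row R n).

Lemma hypersurface_graph_cone : embedded_hypersurface S.
Proof.
move=> y Sy; have Dy := timage_graph_coneD Sy.
have b0 : 'D_(xi y) Phi y != 0 by rewrite derive_vertical_field // oner_eq0.
exact: (level_slice fVV oD Ps timage_graph_coneP Dy b0).
Qed.

Lemma line_derive (W : normedModType R) (z u : W) :
  u = 'D_(1 : R^o) (fun t : R^o => z + t *: u) 0.
Proof.
have did : differentiable (@idfun W) (z + (0 : R) *: u) by [].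
by have [_ /= ->] := is_derive_line did; rewrite derive_id.
Qed.

Lemma transverse_graph_cone (v : TM) : graph_cone v -> chart_dom phi (base v) ->
  forall w : V * V, exists a b : V * V,
    [/\ tangent_to (timage phi [set u : TM | base u = base v]) (tchart phi v) a,
        tangent_to S (tchart phi v) b & w = a + b].
Proof.
move=> Cv vd w; set z := tchart phi v.
have Sz : S z by exists v.
have Dz := timage_graph_coneD Sz.
have dz : differentiable Phi z by have [dP _] := Ps 1%N; exact: dP.
have D1 := derive_vertical_field Dz.
have b0 : 'D_(xi z) Phi z != 0 by rewrite D1 oner_eq0.
(* As $D_\xi\Phi=1$, subtracting [c *: xi z] from [w] leaves a vector killed by $d\Phi$, hence
   tangent to the graph; the vertical part is the velocity of a straight line in the fibre. *)
pose c := 'D_w Phi z.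
exists (c *: xi z), (w - c *: xi z); split; last by rewrite subrKC.
  exists 1, (fun t : R^o => z + t *: (c *: xi z)); split => //.
  - move=> k; apply: (@Ck_sub _ _ _ _ _ setT) => //.
    apply: Ck_add; [exact: openT|exact: Ck_cst|].
    apply: (@Ck_scalel R R^o _ k setT idfun); first exact: openT.
    exact: (@Ck_linear R R^o R^o k setT idfun (fun x => cvg_id)).
  - by rewrite scale0r addr0.
  - move=> t _; rewrite timageP //= !scaler0 addr0; split.
      exact: mem_chart_img.
    exact: chart_mapK.
  - exact: line_derive.
apply/(level_tangent fVV oD Ps timage_graph_coneP _ Dz Sz b0).
rewrite deriveDv // deriveNv // deriveZv // D1.
by rewrite -[c *: 1]/(c * 1) mulr1 subrr.
Qed.

End Converse.

Lemma graph_cone_structure (R : realType) (n : nat) (M : manifold R n)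
    (Om : one_form M) (T : vector_field M) (F : tangent_bundle M -> R) :
  (2 <= n)%N -> (forall p, Om p (T p) = 1) -> is_finsler (ker Om) F ->
  is_cone_structure (graph_cone Om T F).
Proof.
move=> hn OmT FF; split.
- by move=> phi aphi; exact: hypersurface_graph_cone.
- by move=> p; exact: graph_cone_fiber.
- by move=> phi v aphi Cv vd w; exact: transverse_graph_cone.
Qed.

(** * From cone structures to Finsler metrics *)

Lemma tangent_to_linear (R : realType) (V W : normedModType R) (S : set V)
    (S' : set W) (l : {linear V -> W}) (x u : V) : continuous l ->
  (forall y, S y -> S' (l y)) -> tangent_to S x u -> tangent_to S' (l x) (l u).
Proof.
move=> lc SS' [e [c [e0 cs c0 Sc ->]]].
exists e, (l \o c); split => //.
- have oE : open [set t : R^o | `|t| < e].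
    have -> : [set t : R^o | `|t| < e] = ball (0 : R^o) e.
      by apply/seteqP; split => t; rewrite -ball_normE /ball_ /= sub0r normrN.
    exact: ball_open.
  by move=> k; apply: Ck_linear_comp => //; exact: cs.
- by rewrite /= c0.
- by move=> t te; apply/SS'/Sc.
- have dc := smooth_curve0 e0 cs.
  have dl : differentiable l (c 0) by exact: linear_differentiable.
  by rewrite [RHS](derive_comp (1 : R^o) dc dl) derive_linear.
Qed.

(** With [g] the inverse of [f], the differential of [f] sends $dg(v)$ back to [v], on which [l]
    does not vanish. So a slice chart provides a regular defining function [l \o f]. *)
Lemma diffeo_submersion (R : realType) (V : normedModType R) (U : set V)
    (f : V -> V) (l : {linear V -> R^o}) (x v : V) : findim V ->
  open U -> diffeo_on U f -> U x -> l v != 0 ->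
  exists e, 'D_e (l \o f) x != 0.
Proof.
move=> fV oU [g [fs ofU gs gf]] Ux lv.
have lc := @findim_linear_continuous _ _ _ l fV.
have Ufx : (f @` U) (f x) by exists x.
have df y : U y -> differentiable f y by move=> Uy; have [d _] := fs 1%N; exact: d.
have dg : differentiable g (f x) by have [d _] := gs 1%N; exact: d.
have gfx := gf _ Ux.
exists ('D_v g (f x)).
rewrite derive_comp ?derive_linear //; [|exact: df|exact: linear_differentiable].
suff -> : 'D_('D_v g (f x)) f x = v by [].
have dfg : differentiable f (g (f x)) by rewrite gfx; exact: df.
have E := derive_comp v dg dfg; rewrite gfx in E.
rewrite -E (near_eq_derive v (g := id)) ?derive_id //.
have nU : nbhs (f x) (f @` U) by exact: open_nbhs_nbhs.
by apply: filterS nU => _ [z Uz <-] /=; rewrite gf.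
Qed.

Section Direct.
Variables (R : realType) (n : nat) (M : manifold R n).
Notation V := 'rV[R]_n.
Notation TM := (tangent_bundle M).
Variables (C : set TM) (Om : one_form M) (T : vector_field M).
Hypothesis hn : (2 <= n)%N.
Hypothesis CS : is_cone_structure C.
Hypothesis OmC : timelike_form C Om.
Hypothesis TC : unit_timelike_field C Om T.

Let OmT p : Om p (T p) = 1. Proof. exact: TC.2. Qed.

Let A p : set V := cone_interior (fiber C p).

Let AP p : is_cone_interior (fiber C p) (A p).
Proof. by apply: xgetPex; exact: cone_boundary (cstr_cone CS p). Qed.

Let oA p : open (A p). Proof. by have [] := AP p. Qed.

Let cA p x y (t : R) : A p x -> A p y -> 0 <= t <= 1 ->
  A p (t *: x + (1 - t) *: y).
Proof. by have [_ _ /convex_setP + _] := AP p; exact. Qed.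

Let CE p : fiber C p = (closure (A p) `\` (A p)°) `\` [set 0].
Proof. by have [] := AP p. Qed.

Let CZ p (v : V) (a : R) : fiber C p v -> 0 < a -> fiber C p (a *: v).
Proof. exact: cone_scale (cstr_cone CS p) v a. Qed.

Let lamA p (v : V) : A p v -> 0 < Om p v.
Proof. by move=> Av; apply: (OmC (v := TVec (v : tangent_space p))); left. Qed.

Let lamC p (v : V) : fiber C p v -> 0 < Om p v.
Proof. by move=> Cv; apply: (OmC (v := TVec (v : tangent_space p))); right. Qed.

Let AT p : A p (T p). Proof. exact: (TC.1 p). Qed.

(** The height of the cone above [u] along [T]. The axis $\mathbb RT$ does not meet the cone, so the
    zero vector gets its value separately. *)
Definition cone_metric (u : TM) : R :=
  if vec u == 0 :> V then 0 else
  xget 0 [set t : R | fiber C (base u) (vec u + t *: T (base u))].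

Lemma cone_metric0 p : cone_metric (TVec (0 : tangent_space p)) = 0.
Proof. by rewrite /cone_metric /= eqxx. Qed.

Lemma cone_metricP p (u : V) : Om p u = 0 -> u != 0 ->
  fiber C p (u + cone_metric (TVec (u : tangent_space p)) *: T p).
Proof.
move=> lu u0; rewrite /cone_metric /= (negbTE u0).
apply: (@xgetPex _ 0 [set t : R | fiber C p (u + t *: T p)]).
exact: (cone_line_ex (@oA p) (CE p) (@CZ p) (@lamA p) (@AT p) (OmT p) lu u0).
Qed.

Lemma cone_metric_uniq p (u : V) (t : R) : Om p u = 0 -> u != 0 ->
  fiber C p (u + t *: T p) -> cone_metric (TVec (u : tangent_space p)) = t.
Proof.
move=> lu u0 Ct; have Cm := cone_metricP lu u0.
exact: (cone_line_uniq (@oA p) (@cA p) (CE p) (@CZ p) (@lamA p) (@AT p) Cm Ct).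
Qed.

Lemma cone_metric_gt0 p (u : V) : Om p u = 0 -> u != 0 ->
  0 < cone_metric (TVec (u : tangent_space p)).
Proof. by move=> lu u0; exact: (cone_line_gt0 (@lamC p) (OmT p) lu (cone_metricP lu u0)). Qed.

Lemma cone_metric_ge0 p (u : V) : Om p u = 0 ->
  0 <= cone_metric (TVec (u : tangent_space p)).
Proof.
move=> lu; have [->|u0] := eqVneq u 0; first by rewrite cone_metric0.
exact/ltW/cone_metric_gt0.
Qed.

Lemma cone_metricZ p (u : V) (a : R) : Om p u = 0 -> 0 < a ->
  cone_metric (TVec (a *: u : tangent_space p)) =
  a * cone_metric (TVec (u : tangent_space p)).
Proof.
move=> lu a0; have [->|u0] := eqVneq u 0.
  by rewrite scaler0 cone_metric0 mulr0.
apply: cone_metric_uniq.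
- by rewrite linearZ lu; exact: mulr0.
- by rewrite scaler_eq0 negb_or gt_eqF.
- by rewrite -scalerA -scalerDr; apply: CZ => //; exact: cone_metricP.
Qed.

(** The boundary points above [u] and [v] add up to a point of the closed convex cone above [u + v],
    and no point of that closed cone lies below the boundary point on its vertical line. *)
Lemma cone_metric_subadd p (u v : V) : Om p u = 0 -> Om p v = 0 ->
  cone_metric (TVec (u + v : tangent_space p)) <=
  cone_metric (TVec (u : tangent_space p)) + cone_metric (TVec (v : tangent_space p)).
Proof.
move=> lu lv; have [->|u0] := eqVneq u 0.
  by rewrite add0r cone_metric0 add0r.
have [->|v0] := eqVneq v 0; first by rewrite addr0 cone_metric0 addr0.
have luv : Om p (u + v) = 0 by rewrite linearD lu lv addr0.
have [uv0|uv0] := eqVneq (u + v) 0.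
  by rewrite uv0 cone_metric0 addr_ge0 // cone_metric_ge0.
have bP := cone_boundaryP (@oA p) (CE p).
have [cu _ _] := (bP _).1 (cone_metricP lu u0).
have [cv _ _] := (bP _).1 (cone_metricP lv v0).
apply: (cone_line_closure (@oA p) (@cA p) (CE p) (@CZ p) (@lamA p) (@AT p)
  (cone_metricP luv uv0)).
rewrite scalerDl addrACA.
exact: (closure_coneDD (@oA p) (@cA p) (CE p) (@CZ p) (@lamA p) (@AT p) cu cv).
Qed.

Lemma cone_metric_interior p (w : V) : A p w ->
  finsler_fiber Om T cone_metric p w < Om p w.
Proof.
move=> Aw; have lw := form_proj_ker OmT p w.
rewrite /finsler_fiber; have [->|w0] := eqVneq (w - Om p w *: T p) 0.
  by rewrite cone_metric0; exact: lamA.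
apply: (cone_line_open (@oA p) (@cA p) (CE p) (@CZ p) (@lamA p) (@AT p)
  (cone_metricP lw w0)).
by rewrite subrK.
Qed.

Lemma cone_metric_eq : cone_triple_eq C Om T cone_metric.
Proof.
move=> v v0; have Cf : C v <-> fiber C (base v) (vec v) by case: v {v0}.
rewrite Cf; set p := base v in Cf *; set w : V := vec v in v0 Cf *.
have lw := form_proj_ker OmT p w.
have wE : w = w - Om p w *: T p + Om p w *: T p by rewrite subrK.
rewrite -[vec (proj_ker Om T v)]/(w - Om p w *: T p).
rewrite -[proj_ker Om T v]/(TVec (w - Om p w *: T p : tangent_space p)).
(* On the axis both sides fail: a point of the cone would be a positive multiple of [T p], hence
   interior, and the equation would give [w = 0]. *)
have [u0|u0] := eqVneq (w - Om p w *: T p) 0.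
  rewrite u0 cone_metric0 scale0r addr0; split=> [Cw|w0]; last by rewrite w0 eqxx in v0.
  have [_ nA _] := (cone_boundaryP (@oA p) (CE p) w).1 Cw.
  exfalso; apply: nA; rewrite wE u0 add0r.
  by apply: (interior_coneZ (@oA p) (CE p) (@CZ p) (@lamA p)); [exact: AT|exact: lamC].
rewrite addrC; split=> [Cw|->]; last exact: cone_metricP.
by rewrite (@cone_metric_uniq p _ (Om p w)) // ?subrK //.
Qed.

(** * Smoothness and continuity of the metric in a chart *)

Section DirectChart.
Variable phi : chart R n M.
Hypothesis aphi : atlas phi.

Let X := chart_img phi.
Let S := timage phi C.
Let D : set (V * V) := [set y | X y.1 /\ proj_in Om T phi y.1 y.2 != 0].
(** The point at height [t] above the projection of [y]. Lying on the cone becomes an equation in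
    the real unknown [t], with solution [Fin y]. *)
Let lift (y : V * V) (t : R) : V * V :=
  (y.1, proj_in Om T phi y.1 y.2 + t *: field_in T phi y.1).
Let Fin := finsler_in Om T cone_metric phi.
Let fVV := findim_prod (@findim_row R n) (@findim_row R n).

Let oD : open D. Proof. exact: open_proj_in. Qed.

Lemma timage_lift y t : X y.1 -> S (lift y t) <->
  fiber C (chart_inv phi y.1)
    (tvec phi (chart_inv phi y.1) (proj_in Om T phi y.1 y.2) +
     t *: T (chart_inv phi y.1)).
Proof.
move=> yX; have [xd _] := chart_img_inv yX; rewrite /S timageP //.
have -> : tchart_inv phi (lift y t) = TVec (tvec phi (chart_inv phi y.1)
    (proj_in Om T phi y.1 y.2) + t *: T (chart_inv phi y.1)
    : tangent_space (chart_inv phi y.1)).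
  apply: TVec_eq => //=; rewrite addrC tvec_linear /field_in tcoordK //.
  exact: addrC.
by split=> [[]|].
Qed.

Lemma tvec_proj_ker y : X y.1 ->
  Om (chart_inv phi y.1)
    (tvec phi (chart_inv phi y.1) (proj_in Om T phi y.1 y.2)) = 0.
Proof. by move=> yX; exact: (form_in_proj OmT aphi yX). Qed.

Lemma tvec_proj_neq0 y : D y ->
  tvec phi (chart_inv phi y.1) (proj_in Om T phi y.1 y.2) != 0.
Proof.
move=> [yX y0].
by have := @vec_tchart_inv_eq0 _ _ _ phi (y.1, proj_in Om T phi y.1 y.2) aphi yX => /= ->.
Qed.

Lemma timage_lift_metric y : D y -> S (lift y (Fin y)).
Proof.
move=> Dy; apply/timage_lift; first exact: Dy.1.
by apply: cone_metricP; [exact: tvec_proj_ker Dy.1|exact: tvec_proj_neq0].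
Qed.

Lemma timage_lift_uniq y t : D y -> S (lift y t) -> Fin y = t.
Proof.
move=> Dy /(timage_lift _ Dy.1) St.
by apply: cone_metric_uniq St; [exact: tvec_proj_ker Dy.1|exact: tvec_proj_neq0].
Qed.

(* [T] lies inside the cone, hence is transverse to it in the fibre. *)
Lemma field_not_tangent y t : D y -> S (lift y t) ->
  ~ tangent_to [set w | S (y.1, w)] (lift y t).2 (field_in T phi y.1).
Proof.
move=> Dy St tT; have yX := Dy.1; have [xd _] := chart_img_inv yX.
set p := chart_inv phi y.1 in xd *.
pose l : {linear V -> V} := HB.pack (tvec phi p)
  (GRing.isLinear.Build _ _ _ _ (tvec phi p) (tvec_linear phi p)).
have lc : continuous l by apply: findim_linear_continuous; exact: findim_row.
have SC w : S (y.1, w) -> fiber C p (l w) by rewrite /S timageP // => -[].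
have := tangent_to_linear lc SC tT.
have -> : l (field_in T phi y.1) = T p by rewrite /= /field_in tcoordK.
apply: (interior_not_tangent (@oA p) (@cA p) (CE p) (@CZ p) (@lamA p)).
  exact: (SC _ St).
exact: AT.
Qed.

Lemma vertical_tangent (v : TM) a :
  tangent_to (timage phi [set u : TM | base u = base v]) (tchart phi v) a ->
  a.1 = 0.
Proof.
move=> [e [c [e0 cs c0 cv ->]]].
have dc := smooth_curve0 e0 cs.
have df : differentiable (fst : V * V -> V) (c 0).
  by apply: (@linear_differentiable _ _ _ fst) => q; exact: cvg_fst.
have <- : 'D_(1 : R^o) (fst \o c) 0 = ('D_(1 : R^o) c 0).1.
  rewrite (derive_comp (1 : R^o) dc df) (@derive_linear _ _ _ fst) // => q.
  exact: cvg_fst.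
rewrite (@near_eq_derive _ _ _ _ (cst (phi (base v)))) ?derive_cst //.
have te : \forall t \near (0 : R^o), `|t| < e.
  by apply/nbhs_normP; exists e => // t /=; rewrite /ball_ /= sub0r normrN.
by apply: filterS te => t /cv[u [ub _] uE]; rewrite /= -uE /= ub.
Qed.

(** A vector that is not tangent to the fibre of the cone has a nonzero derivative only once the
    restriction of [Psi] to the fibre is known to be regular. Then the tangent space of the fibre is
    the whole kernel of the restricted differential, and [T] lies outside it. *)
Lemma level_vertical_neq0 y (U : set (V * V)) (Psi : V * V -> R^o) :
  D y -> open U -> smooth_on U Psi -> U (lift y (Fin y)) ->
  (forall z, U z -> (S z <-> Psi z = 0)) ->
  (exists e, 'D_e Psi (lift y (Fin y)) != 0) ->
  'D_(0, field_in T phi y.1) Psi (lift y (Fin y)) != 0.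
Proof.
move=> Dy oU Ps + SP.
have Sz := timage_lift_metric Dy.
have z1 : (lift y (Fin y)).1 = y.1 by [].
have nT := field_not_tangent Dy Sz.
move: (lift y (Fin y)) z1 Sz nT => z z1 Sz nT Uz [e e0].
rewrite -z1 in nT *.
have dz : differentiable Psi z by have [d _] := Ps 1%N; exact: d.
(* Transversality splits a direction [e] with nonzero derivative into a vertical part and a part
   tangent to [S]. The latter is killed by the differential of [Psi], so the former is not. *)
have [b b0] : exists b : V, 'D_(0, b) Psi z != 0.
  have [v [Cv vd] vz] := Sz.
  have [a [b []]] := cstr_transverse CS aphi Cv vd e.
  rewrite vz => ta [d [c [d0 cs c0 Sc bE]]] eE.
  have Db : 'D_b Psi z = 0.
    rewrite bE -c0; apply: (derive_along_curve d0 cs _ _ Sc); rewrite c0 //.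
    have nU : nbhs z U by exact: open_nbhs_nbhs.
    by apply: filterS nU => x Ux /(SP _ Ux).
  rewrite -vz in ta; exists a.2.
  have -> : (0, a.2) = a by rewrite -(vertical_tangent ta); case: (a).
  by move: e0; rewrite eE deriveDv // Db addr0.
pose Ux : set V := [set w | U (z.1, w)].
have Psx : smooth_on Ux (fun w => Psi (z.1, w)).
  exact: (smooth_fiber_comp z.1 (@findim_real R) oU Ps).
have oUx : open Ux.
  have := @open_preimage_within _ _ setT (fun w : V => (z.1, w)) U openT oU.
  rewrite setTI; apply => w _.
  apply: (@cvg_pair _ _ _ (nbhs w) (nbhs z.1) (nbhs w)); first exact: cvg_cst.
  exact: cvg_id.
have zE : (z.1, z.2) = z by case: (z).
have dp : differentiable (fun w : V => (z.1, w)) z.2 by exact: differentiable_pair.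
have Dp u : 'D_u (fun w : V => (z.1, w)) z.2 = (0, u).
  have did : differentiable (@idfun V) z.2 by [].
  rewrite (derive_pair u (differentiable_cst z.1 z.2) did).
  by rewrite derive_cst derive_id.
have Dvert u : 'D_u (fun w => Psi (z.1, w)) z.2 = 'D_(0, u) Psi z.
  have dz' : differentiable Psi (z.1, z.2) by rewrite zE.
  have E := derive_comp u dp dz'.
  by rewrite Dp zE in E.
have SPx w : Ux w -> (S (z.1, w) <-> Psi (z.1, w) = 0) by exact: SP.
have bx : 'D_b (fun w => Psi (z.1, w)) z.2 != 0 by rewrite Dvert.
have Uz' : Ux z.2 by rewrite /Ux /= zE.
have Sz' : S (z.1, z.2) by rewrite zE.
have tP := @level_tangent R V (@findim_row R n) [set w | S (z.1, w)] Ux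
  (fun w => Psi (z.1, w)) oUx Psx SPx z.2 b (field_in T phi z.1) Uz' Sz' bx.
by apply/eqP => T0; apply: nT; apply/tP; rewrite Dvert.
Qed.

(** [Fin y] is the only height at which [lift y t] meets the cone, so the implicit function theorem
    applies to the slice equation without prior continuity of the metric. *)
Lemma smooth_cone_metric : smooth_on D Fin.
Proof.
move=> k; apply: Ck_pointwise => y Dy.
have Sz := timage_lift_metric Dy.
have [U [f [l [oU Uz df [v lv] SP]]]] := cstr_hypersurface CS aphi Sz.
have [g [fs _ _ _]] := df.
have Ps : smooth_on U (l \o f).
  move=> j; apply: (Ck_linear_comp oU _ (fs j)).
  exact: findim_linear_continuous.
have D0 := level_vertical_neq0 Dy oU Ps Uz SP (diffeo_submersion fVV oU df Uz lv).
set z := lift y (Fin y) in Uz D0 Sz.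
pose th (q : (V * V) * R^o) : V * V := lift q.1 q.2.
pose N : set ((V * V) * R^o) := fst @^-1` D.
have oN : open N by apply: open_comp oD => q _; exact: cvg_fst.
have ths : smooth_on N th.
  move=> j; apply: Ck_pair => //.
    apply: (@Ck_linear_comp R ((V * V) * R^o)%type (V * V)%type V j N fst fst) => //.
      by move=> q; exact: cvg_fst.
    by apply: (@Ck_linear R ((V * V) * R^o)%type (V * V)%type j N fst) => q; exact: cvg_fst.
  apply: Ck_add => //.
    apply: (@Ck_comp R (V * V)%type V _ j N (fst @^-1` X) fst
      (fun y => proj_in Om T phi y.1 y.2)) => //.
    - exact: findim_row.
    - by move=> q [].
    - by apply: (@Ck_linear R ((V * V) * R^o)%type (V * V)%type j N fst) => q; exact: cvg_fst.
    - exact: smooth_proj_in.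
  apply: Ck_scale => //; first exact: findim_row.
    by apply: (@Ck_linear R ((V * V) * R^o)%type R^o j N snd) => q; exact: cvg_snd.
  apply: (@Ck_comp R (V * V)%type V _ j N (fst @^-1` X) fst
    (fun y => field_in T phi y.1)) => //.
  - exact: findim_row.
  - by move=> q [].
  - by apply: (@Ck_linear R ((V * V) * R^o)%type (V * V)%type j N fst) => q; exact: cvg_fst.
  - exact: (smooth_comp_fst (@findim_row R n) (@open_chart_img _ _ _ phi) (smooth_field_in T aphi)).
pose O := N `&` th @^-1` U.
have oO : open O.
  by apply: (open_preimage_within oN oU) => q; exact: (ths 0%N).
pose G (q : (V * V) * R^o) : R^o := (l \o f) (th q).
have Gs : smooth_on O G.
  move=> j; apply: (@Ck_comp R (V * V)%type R^o _ j O U th (l \o f)) => //.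
  - exact: findim_real.
  - by move=> q [].
  - by apply: Ck_sub (ths j) => q [].
have O0 : O (y, Fin y) by [].
have G0 : G (y, Fin y) = 0 by apply/SP.
have dz : differentiable (l \o f) z by have [d _] := Ps 1%N; exact: d.
(* Varying [t] moves [lift y t] along the vertical lift of [T], so this is the derivative shown
   nonzero in [D0]. *)
have B0 : 'D_(0, 1) G (y, Fin y) != 0.
  rewrite (@derive_along_line R ((V * V) * R^o)%type R^o G _ _
    (fun s => (l \o f) (z + s *: (0, field_in T phi y.1)))).
  - have dz0 : differentiable (l \o f) (z + (0 : R) *: (0, field_in T phi y.1)).
      by rewrite scale0r addr0.
    have [_ ->] := is_derive_line dz0.
    by rewrite scale0r addr0.
  - by have [d _] := Gs 1%N; exact: d.
  have GE (s : R) : G ((y, Fin y) + s *: (0, 1)) =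
      (l \o f) (z + s *: (0, field_in T phi y.1)).
    rewrite /G; congr ((l \o f) _); rewrite /th /lift /=.
    apply/pair_equal_spec; rewrite /= !scaler0 !addr0; split => //.
    by rewrite -[s *: 1]/(s * 1) mulr1 scalerDl addrA.
  by near do exact: GE.
have uniq : \forall x \near y, forall t, O (x, t) -> G (x, t) = 0 -> Fin x = t.
  have u x t : O (x, t) -> G (x, t) = 0 -> Fin x = t.
    by move=> [Dx Ux] Gx; apply: timage_lift_uniq Dx _; apply/SP.
  by near do exact: u.
have [_ [N' [oN' N'y Ns _]]] := implicit_function fVV oO Gs O0 G0 B0 uniq.
by exists N'.
Unshelve. all: by end_near. Qed.

Lemma proj_in_linear x : linear (proj_in Om T phi x).
Proof.
move=> a u v; rewrite /proj_in form_in_linear scalerBr scalerDl -scalerA.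
by rewrite opprD addrACA.
Qed.

Let FinE x w : Fin (x, w) = cone_metric (TVec (tvec phi (chart_inv phi x)
  (proj_in Om T phi x w) : tangent_space (chart_inv phi x))).
Proof. by []. Qed.

Lemma metric_in_subadd x u v : X x -> Fin (x, u + v) <= Fin (x, u) + Fin (x, v).
Proof.
move=> xX; rewrite !FinE -[u]scale1r proj_in_linear tvec_linear !scale1r.
by apply: cone_metric_subadd; [exact: (@tvec_proj_ker (x, u))|exact: (@tvec_proj_ker (x, v))].
Qed.

Lemma metric_in_ge0 x w : X x -> 0 <= Fin (x, w).
Proof. by move=> xX; rewrite FinE; apply: cone_metric_ge0; exact: (@tvec_proj_ker (x, w)). Qed.

Lemma metric_in_proj0 x w : proj_in Om T phi x w = 0 -> Fin (x, w) = 0.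
Proof. by move=> w0; rewrite FinE w0 [tvec _ _ 0]linear0 cone_metric0. Qed.

Lemma proj_in0 x : proj_in Om T phi x 0 = 0.
Proof. by rewrite /proj_in form_in0 scale0r subrr. Qed.

Lemma metric_inZ x w (a : R) : X x -> 0 <= a -> Fin (x, a *: w) = a * Fin (x, w).
Proof.
move=> xX; rewrite le_eqVlt => /predU1P[<-|a0].
  by rewrite scale0r mul0r metric_in_proj0 // proj_in0.
rewrite !FinE -[a *: w]addr0 proj_in_linear proj_in0 addr0.
rewrite -[a *: proj_in _ _ _ _ _]addr0 tvec_linear [tvec _ _ 0]linear0 addr0.
by rewrite cone_metricZ //; exact: (@tvec_proj_ker (x, w)).
Qed.

Lemma metric_in_abs x w (a : R) : X x ->
  Fin (x, a *: w) <= `|a| * (Fin (x, w) + Fin (x, - w)).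
Proof.
move=> xX; have h1 := metric_in_ge0 w xX; have h2 := metric_in_ge0 (- w) xX.
have [a0|a0] := leP 0 a.
  by rewrite metric_inZ // ger0_norm // ler_wpM2l // lerDl.
have -> : a *: w = (- a) *: (- w) by rewrite scalerN scaleNr opprK.
have na : 0 <= - a by rewrite oppr_ge0 ltW.
by rewrite (metric_inZ _ xX na) ltr0_norm // ler_wpM2l // lerDr.
Qed.

Lemma metric_in_continuous x w : D (x, w) -> {for x, continuous (fun x => Fin (x, w))}.
Proof.
move=> Dxw; apply: (@continuous_comp _ _ _ (fun x : V => (x, w)) Fin).
  apply: (@cvg_pair _ _ _ (nbhs x) (nbhs x) (nbhs w)); first exact: cvg_id.
  exact: cvg_cst.
exact: (Ck_continuous (@smooth_cone_metric 0%N) Dxw).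
Qed.

Lemma metric_in_near_le x w : D (x, w) ->
  \forall z \near x, Fin (z, w) <= Fin (x, w) + 1.
Proof.
move=> Dxw; have c := metric_in_continuous Dxw.
have lt1 : Fin (x, w) < Fin (x, w) + 1 by rewrite ltrDl.
have nlt : \forall z \near x, Fin (z, w) < Fin (x, w) + 1 by exact: (cvgr_lt _ c _ lt1).
by apply: filterS nlt => z /ltW.
Qed.

Lemma exists_proj_neq0 x : X x -> exists w, proj_in Om T phi x w != 0.
Proof.
move=> xX; pose L : {linear V -> R^o} := HB.pack (form_in Om phi x)
  (GRing.isLinear.Build _ _ _ _ (form_in Om phi x) (form_in_linear Om phi x)).
have [u u0 lu] := ker_linear_neq0 L hn.
by exists u; rewrite /proj_in -[form_in Om phi x u]/(L u) lu scale0r subr0.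
Qed.

(** If [w] is a multiple of [T] at [x] it need not remain one at nearby points, and smoothness says
    nothing at [(x, w)]. Splitting [w] as [u + (w - u)], both with nonzero projection at [x],
    reduces to the smooth case by subadditivity. *)
Lemma metric_in_locally_bounded x w : X x -> exists B : R,
  \forall z \near x, Fin (z, w) <= B.
Proof.
move=> xX; have [w0|w0] := eqVneq (proj_in Om T phi x w) 0; last first.
  by exists (Fin (x, w) + 1); apply: metric_in_near_le.
have [u u0] := exists_proj_neq0 xX.
have v0 : proj_in Om T phi x (w - u) != 0.
  have -> : w - u = -1 *: u + w by rewrite scaleN1r addrC.
  by rewrite proj_in_linear w0 addr0 scaleN1r oppr_eq0.
exists (Fin (x, u) + 1 + (Fin (x, w - u) + 1)).
have nX : nbhs x X by apply: open_nbhs_nbhs; split => //; exact: open_chart_img.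
have Dxu : D (x, u) by split.
have Dxv : D (x, w - u) by split.
apply: filterS3 nX (metric_in_near_le Dxu) (metric_in_near_le Dxv) => z zX h1 h2.
have := metric_in_subadd u (w - u) zX; rewrite subrKC => h.
exact: le_trans h (lerD h1 h2).
Qed.

(** Squeeze: expanding [w] in the [e i], subadditivity and homogeneity give $0\le
    F(z,w)\le\sum_i|l_i(w)|B_i$ for all [z] near [x], and the bound tends to 0 with [w]. *)
Lemma metric_in_zero_continuous x : X x -> {for (x, 0), continuous Fin}.
Proof.
move=> xX; have [s [e [l [lc le]]]] := @findim_row R n.
have F0 : Fin (x, 0) = 0 by rewrite metric_in_proj0 // proj_in0.
have [B BP] : exists B : 'I_s -> R, forall i,
    \forall z \near x, Fin (z, e i) + Fin (z, - e i) <= B i.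
  have H i : exists b : R, \forall z \near x, Fin (z, e i) + Fin (z, - e i) <= b.
    have [b1 h1] := metric_in_locally_bounded (e i) xX.
    have [b2 h2] := metric_in_locally_bounded (- e i) xX.
    by exists (b1 + b2); apply: filterS2 h1 h2 => z; exact: lerD.
  by have [B BP] := choice H; exists B.
pose g (y : V * V) : R^o := \sum_i `|l i y.2| * B i.
have gc : {for (x, 0), continuous g}.
  apply: (@Ck_sum R (V * V)%type R^o 0 setT s (fun i y => `|l i y.2| * B i)
    openT _ (x, 0) I) => i y _.
  apply: cvgM; last exact: cvg_cst.
  apply: cvg_norm; apply: (@continuous_comp _ _ _ (snd : V * V -> V) (l i)).
    exact: cvg_snd.
  exact: lc.
have g0 : g (x, 0) = 0 by rewrite /g big1 // => i _; rewrite /= linear0 normr0 mul0r.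
have nX : nbhs x X by apply: open_nbhs_nbhs; split => //; exact: open_chart_img.
have bound : \forall y \near (x, 0 : V), 0 <= Fin y <= g y.
  pose P (z : V) := X z /\ forall i, Fin (z, e i) + Fin (z, - e i) <= B i.
  have nP : nbhs x P.
    apply: filterI nX _; exact: filter_forall BP.
  have nPf : \forall y \near (x, 0 : V), P y.1 by exact: (@cvg_fst _ _ (nbhs x) (nbhs (0 : V)) _ _ nP).
  apply: filterS nPf => -[z w] /= [zX zB].
  rewrite metric_in_ge0 //= /g /= {1}(le w).
  have sub r : Fin (z, \sum_(i <- r) l i w *: e i) <= \sum_(i <- r) `|l i w| * B i.
    elim: r => [|i r IH]; first by rewrite !big_nil metric_in_proj0 // proj_in0.
    rewrite !big_cons; apply: le_trans (metric_in_subadd _ _ zX) _.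
    apply: lerD IH; apply: le_trans (metric_in_abs _ _ zX) _.
    by rewrite ler_wpM2l.
  exact: sub.
rewrite /prop_for /continuous_at F0.
apply: (@squeeze_cvgr _ _ _ _ (cst 0) g) => //; first exact: cvg_cst.
by rewrite -g0; exact: gc.
Qed.

Lemma cone_metric_ker y : X y.1 -> form_in Om phi y.1 y.2 = 0 ->
  (cone_metric \o tchart_inv phi) y = Fin y.
Proof.
case: y => x w /= xX w0.
by rewrite FinE /proj_in w0 scale0r subr0.
Qed.

Lemma cone_metric_continuous :
  {within timage phi (ker Om), continuous (cone_metric \o tchart_inv phi)}.
Proof.
have kerP (y : V * V) : timage phi (ker Om) y ->
    X y.1 /\ form_in Om phi y.1 y.2 = 0.
  by move/(timageP _ _ aphi).
apply/subspace_continuousP => y /kerP[yX lw].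
have c : {for y, continuous Fin}.
  have [w0|w0] := eqVneq (proj_in Om T phi y.1 y.2) 0; last first.
    by apply: (Ck_continuous (@smooth_cone_metric 0%N)); split.
  have y20 : y.2 = 0 by move: w0; rewrite /proj_in lw scale0r subr0.
  have -> : y = (y.1, 0) by rewrite -y20; case: (y).
  exact: metric_in_zero_continuous.
move=> B nB; have nB' : nbhs (Fin y) B by rewrite -(cone_metric_ker yX lw).
have cB : nbhs y (Fin @^-1` B) by exact: c _ nB'.
apply: filterS cB => z Bz /kerP[zX lz].
by move: Bz; rewrite /preimage /= -(cone_metric_ker zX lz).
Qed.

Lemma cone_metric_smooth_within :
  smooth_within (timage phi [set v : TM | ker Om v /\ vec v != 0])
    (cone_metric \o tchart_inv phi : V * V -> R^o).
Proof.
have kerP (y : V * V) : timage phi [set v : TM | ker Om v /\ vec v != 0] y ->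
    [/\ X y.1, form_in Om phi y.1 y.2 = 0 & y.2 != 0].
  move=> Ky; have yX : X y.1 by have [] := (timageP _ _ aphi).1 Ky.
  by have [] := (timage_kerP Om aphi yX).1 Ky.
move=> y /kerP[yX lw w0]; exists D, Fin; split.
- exact: oD.
- by split => //; rewrite /proj_in lw scale0r subr0.
- exact: smooth_cone_metric.
- by move=> z _ /kerP[zX lz _]; exact: cone_metric_ker.
Qed.

End DirectChart.

Lemma cone_metric_posdef p (v u : V) : Om p v = 0 -> Om p u = 0 ->
  v != 0 -> u != 0 -> 0 < fundamental_tensor cone_metric p v u u.
Proof.
move=> lv lu v0 u0; pose f := finsler_fiber Om T cone_metric p.
pose Dp : set V := [set w | w - Om p w *: T p != 0].
have oDp : open Dp by apply: open_projD; exact: findim_row.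
have fs : smooth_on Dp f.
  by apply: smooth_finsler_fiber_of; apply: smooth_cone_metric; exact: chart_at_atlas.
have Dv : Dp v by rewrite /Dp /= lv scale0r subr0.
rewrite (fundamental_tensorE oDp fs Dv); last first.
  move=> r s; rewrite /f finsler_fiber_ker //.
  have lZ (a : R) : Om p (a *: u) = 0 by rewrite linearZ lu; exact: mulr0.
  have l1 : Om p (v + r *: u) = 0 by rewrite linearD lZ lv addr0.
  by rewrite [LHS]linearD lZ l1 addr0.
have half_gt0 (a : R) : 0 < a -> 0 < 2^-1 * a by rewrite pmulr_rgt0 ?invr_gt0.
apply: half_gt0.
apply: (@cone_graph_posdef R n (Om p) (T p) f (fiber C p) (OmT p) _ _ fs _ _
  (cstr_cone CS p)) => //.
- exact: finsler_fiberT.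
- move=> w a a0; have E : Om p (a *: w) = a * Om p w by rewrite linearZ.
  rewrite /f /finsler_fiber E -scalerA -scalerBr.
  by apply: cone_metricZ => //; exact: form_proj_ker.
- by move=> w w0; apply: cone_metric_gt0 => //; exact: form_proj_ker.
- move=> w w0; have lw := form_proj_ker OmT p w.
  split=> [Cw|E].
    by apply/esym/cone_metric_uniq => //; rewrite subrK.
  have Cw : fiber C p (w - Om p w *: T p + f w *: T p) by exact: cone_metricP.
  by rewrite -E subrK in Cw.
- exact: cone_metric_interior.
Qed.

Lemma cone_metric_finsler : is_finsler (ker Om) cone_metric.
Proof.
split.
- by move=> [p v] lv; exact: cone_metric_ge0.
- by move=> phi aphi; exact: cone_metric_continuous.
- by move=> [p v] lv v0; exact: cone_metric_gt0.
- by move=> phi aphi; exact: cone_metric_smooth_within.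
- by move=> p v a lv a0; exact: cone_metricZ.
- by move=> p v u lv lu v0 u0; exact: cone_metric_posdef.
Qed.

Lemma cone_metric_unique (F F' : TM -> R) :
  is_finsler (ker Om) F -> cone_triple_eq C Om T F ->
  is_finsler (ker Om) F' -> cone_triple_eq C Om T F' ->
  forall v, ker Om v -> F v = F' v.
Proof.
move=> FF CF FF' CF' [p v] lv; rewrite /ker /= in lv.
have [->|v0] := eqVneq v 0; first by rewrite (finsler0 FF) (finsler0 FF').
(* The point of the cone above [v] according to [F]; reading it with the graph equation of [F'] and
   applying $\Omega$ compares the two heights. *)
pose z : TM := TVec (v + F (TVec (v : tangent_space p)) *: T p : tangent_space p).
have lz : Om p (vec z) = F (TVec (v : tangent_space p)).
  by rewrite /= linearD lv add0r linearZ OmT; exact: mulr1.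
have pz : proj_ker Om T z = TVec (v : tangent_space p).
  by apply: TVec_eq => //=; rewrite -[Om p _]/(Om p (vec z)) lz addrK.
have z0 : vec z != 0 :> V.
  apply: contraNneq v0 => z0; move: lz; rewrite z0 linear0 => lz.
  by move: z0; rewrite /= -lz scale0r addr0 => ->.
have Cz : C z by apply/(CF z z0); rewrite pz /= addrC.
have := (CF' z z0).1 Cz; rewrite pz /= => E.
have := congr1 (Om p) E; rewrite -[Om p (v + _)]/(Om p (vec z)) lz => ->.
by rewrite linearD lv addr0 linearZ OmT; exact: mulr1.
Qed.

End Direct.

Theorem theorem2p17 (R : realType) (n : nat) (hn : (2 <= n)%N)
    (M : manifold R n) :
  (forall C : set (tangent_bundle M), is_cone_structure C ->
   forall (Om : one_form M) (T : vector_field M),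
     timelike_form C Om -> unit_timelike_field C Om T ->
     (exists F : tangent_bundle M -> R,
        is_finsler (ker Om) F /\ cone_triple_eq C Om T F) /\
     (forall F F' : tangent_bundle M -> R,
        is_finsler (ker Om) F -> cone_triple_eq C Om T F ->
        is_finsler (ker Om) F' -> cone_triple_eq C Om T F' ->
        forall v, ker Om v -> F v = F' v))
  /\
  (forall (Om : one_form M) (T : vector_field M) (F : tangent_bundle M -> R),
     nonvanishing Om -> (forall p, Om p (T p) = 1) -> is_finsler (ker Om) F ->
     exists! C : set (tangent_bundle M),
       is_cone_structure C /\ cone_triple_eq C Om T F).
Proof.
split=> [C CS Om T OmC TC|Om T F _ OmT FF].
  split; last by move=> F F'; exact: cone_metric_unique.
  exists (cone_metric C T); split; first exact: cone_metric_finsler.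
  exact: cone_metric_eq.
exists (graph_cone Om T F); split.
  by split; [exact: graph_cone_structure|exact: graph_cone_eq].
by move=> C [CS CE]; exact: graph_cone_unique.
Qed.
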